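(* Let $k$ be an even positive integer and let $\chi:\mathrm{PSL}_2(\mathbb Z)\to\mathbb C^\times$ be the unique character with $\chi(S)=\chi(T)=-1$. Then the map $$\mathcal S(\mathrm{SL}_2(\mathbb Z),k,\chi)\rightarrow\mathcal S^{\mathrm{new}}(\Gamma_0(4),k,1),\qquad f(\tau)\mapsto g(\tau)=f(2\tau)$$ is well-defined and is an isomorphism (of complex vector spaces).
   Context: $\mathbb H$ is the upper half plane. $S=\begin{pmatrix}0&-1\\1&0\end{pmatrix}$ and $T=\begin{pmatrix}1&1\\0&1\end{pmatrix}$; the same letters denote their images in $\mathrm{PSL}_2(\mathbb Z)=\mathrm{SL}_2(\mathbb Z)/\{\pm I\}=\langle S,T: S^2=(ST)^3=I\rangle$. A character of a group is a homomorphism into $\mathbb C^\times$ with finite image. A character of $\mathrm{PSL}_2(\mathbb Z)$ is also regarded as a character of $\mathrm{SL}_2(\mathbb Z)$ by composing with the projection. There is exactly one character of $\mathrm{PSL}_2(\mathbb Z)$ with $\chi(S)=\chi(T)=-1$. For a real matrix $M=\begin{pmatrix}a&b\\c&d\end{pmatrix}$ of positive determinant and a function $f$ on $\mathbb H$, the weight-$k$ slash operator is $(f|_kM)(\tau)=\det(M)^{k/2}(c\tau+d)^{-k}f\left(\frac{a\tau+b}{c\tau+d}\right)$. For a congruence subgroup $\Gamma\subseteq\mathrm{SL}_2(\mathbb Z)$ and a character $\chi$ of $\Gamma$, $\mathcal S(\Gamma,k,\chi)$ is the space of cusp forms for $\Gamma$ of weight $k$ and character $\chi$: holomorphic functions $f$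 on $\mathbb H$ with $f|_kM=\chi(M)f$ for all $M\in\Gamma$ that vanish at all cusps. $\Gamma_0(N)$ is the group of matrices in $\mathrm{SL}_2(\mathbb Z)$ with lower-left entry divisible by $N$. $\mathcal S^{\mathrm{new}}(\Gamma_0(N),k,1)\subseteq\mathcal S(\Gamma_0(N),k,1)$ is the usual new subspace (Atkin–Lehner–Li) for trivial character, i.e. the orthogonal complement, under the Petersson inner product, of the span of all $h(d\tau)$ with $h\in\mathcal S(\Gamma_0(M),k,1)$, $M\mid N$, $M\neq N$, $d\mid N/M$. *)

(* Defs.v *)
From HB Require Import structures.
From mathcomp Require Import all_boot all_order all_algebra.
From mathcomp Require Import generic_quotient.
From mathcomp Require Import all_classical all_reals all_analysis.
From mathcomp Require Import complex ring.

Set Implicit Arguments.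
Unset Strict Implicit.
Unset Printing Implicit Defensive.

Import Order.TTheory GRing.Theory Num.Theory numFieldNormedType.Exports.
Import ComplexField.

Local Open Scope classical_set_scope.
Local Open Scope complex_scope.
Local Open Scope ring_scope.
Local Open Scope quotient_scope.

Definition mx22 (R : Type) (a b c d : R) : 'M[R]_2 :=
  \matrix_(i, j) if i == 0 then (if j == 0 then a else b)
                 else (if j == 0 then c else d).

Definition SL2Z := {M : 'M[int]_2 | \det M == 1}.

HB.instance Definition _ := Choice.on SL2Z.

Section SL2ZGroup.

Implicit Types A B : SL2Z.

Let unitSL A : val A \in unitmx.
Proof. by rewrite unitmxE (eqP (valP A)) unitr1. Qed.

Let detM A B : \det (val A *m val B) == 1.
Proof. by rewrite det_mulmx (eqP (valP A)) (eqP (valP B)) mulr1. Qed.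

Let det_inv A : \det (invmx (val A)) == 1.
Proof. by rewrite det_inv (eqP (valP A)) invr1. Qed.

Let det_one : \det (1%:M : 'M[int]_2) == 1.
Proof. by rewrite det1. Qed.

Definition SL2Z_mul A B : SL2Z := Sub (val A *m val B) (detM A B).
Definition SL2Z_inv A : SL2Z := Sub (invmx (val A)) (det_inv A).
Definition SL2Z_one : SL2Z := Sub 1%:M det_one.

Let mulA : associative SL2Z_mul.
Proof. by move=> A B C; apply: val_inj; rewrite /= mulmxA. Qed.
Let mul1 : left_id SL2Z_one SL2Z_mul.
Proof. by move=> A; apply: val_inj; rewrite /= mul1mx. Qed.
Let muld1 : right_id SL2Z_one SL2Z_mul.
Proof. by move=> A; apply: val_inj; rewrite /= mulmx1. Qed.
Let mulV : left_inverse SL2Z_one SL2Z_inv SL2Z_mul.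
Proof. by move=> A; apply: val_inj; rewrite /= mulVmx ?unitSL. Qed.
Let muldV : right_inverse SL2Z_one SL2Z_inv SL2Z_mul.
Proof. by move=> A; apply: val_inj; rewrite /= mulmxV ?unitSL. Qed.

HB.instance Definition _ := isGroup.Build SL2Z mulA mul1 muld1 mulV muldV.

End SL2ZGroup.

Lemma SL2Z_valM (A B : SL2Z) : val (A * B)%g = val A *m val B.
Proof. by []. Qed.

Lemma SL2Z_val1 : val (1%g : SL2Z) = 1%:M.
Proof. by []. Qed.

Lemma det_mx22 (R : comNzRingType) (a b c d : R) :
  \det (mx22 a b c d) = a * d - b * c.
Proof.
rewrite (expand_det_row _ 0) !big_ord_recl big_ord0 /cofactor !det_mx11 !mxE /=.
by rewrite expr0 expr1 mul1r mulN1r mulrN addr0.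
Qed.

Fact SL2Z_S_subproof : \det (mx22 0 (-1) 1 0 : 'M[int]_2) == 1.
Proof. by rewrite det_mx22. Qed.

Fact SL2Z_T_subproof : \det (mx22 1 1 0 1 : 'M[int]_2) == 1.
Proof. by rewrite det_mx22. Qed.

Definition SL2Z_S : SL2Z := Sub (mx22 0 (-1) 1 0) SL2Z_S_subproof.
Definition SL2Z_T : SL2Z := Sub (mx22 1 1 0 1) SL2Z_T_subproof.

Definition pm_rel : rel SL2Z :=
  fun A B => (val A == val B) || (val A == - val B).

Section PSL2ZGroup.

Let pm_refl : reflexive pm_rel.
Proof. by move=> A; rewrite /pm_rel eqxx. Qed.

Let pm_sym : symmetric pm_rel.
Proof.
by move=> A B; rewrite /pm_rel eq_sym [val A == - _]eq_sym -[in RHS]eqr_oppLR.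
Qed.

Let pm_trans : transitive pm_rel.
Proof.
move=> B A C; rewrite /pm_rel => /orP[/eqP->//|/eqP->].
by case/orP=> /eqP->; rewrite ?opprK eqxx ?orbT.
Qed.

Canonical pm_equiv := EquivRel pm_rel pm_refl pm_sym pm_trans.

Definition PSL2Z := {eq_quot pm_rel}.

HB.instance Definition _ := Choice.on PSL2Z.
HB.instance Definition _ := EqQuotient.on PSL2Z.

Definition PSL2Z_proj (A : SL2Z) : PSL2Z := \pi_PSL2Z A.

Lemma PSL2Z_proj_eq (A B : SL2Z) :
  (PSL2Z_proj A == PSL2Z_proj B) = (val A == val B) || (val A == - val B).
Proof. exact: (@eqmodE _ pm_equiv). Qed.

Let projK (x : PSL2Z) : PSL2Z_proj (repr x) = x.
Proof. exact: reprK. Qed.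

Let reprP (A : SL2Z) : pm_rel (repr (PSL2Z_proj A)) A.
Proof. by rewrite /pm_rel -PSL2Z_proj_eq projK. Qed.

Definition PSL2Z_mul (x y : PSL2Z) : PSL2Z := PSL2Z_proj (repr x * repr y)%g.
Definition PSL2Z_inv (x : PSL2Z) : PSL2Z := PSL2Z_proj (repr x)^-1%g.
Definition PSL2Z_one : PSL2Z := PSL2Z_proj 1%g.

Let projM (A B : SL2Z) :
  PSL2Z_mul (PSL2Z_proj A) (PSL2Z_proj B) = PSL2Z_proj (A * B)%g.
Proof.
apply/eqP; rewrite PSL2Z_proj_eq !SL2Z_valM.
case/orP: (reprP A) => /eqP->; case/orP: (reprP B) => /eqP->.
- by rewrite eqxx.
- by rewrite mulmxN eqxx orbT.
- by rewrite mulNmx eqxx orbT.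
- by rewrite mulNmx mulmxN opprK eqxx.
Qed.

Let mulA : associative PSL2Z_mul.
Proof.
move=> x y z; rewrite -(projK x) -(projK y) -(projK z) !projM.
by rewrite mulgA.
Qed.
Let mul1 : left_id PSL2Z_one PSL2Z_mul.
Proof. by move=> x; rewrite -(projK x) projM mul1g. Qed.
Let muld1 : right_id PSL2Z_one PSL2Z_mul.
Proof. by move=> x; rewrite -(projK x) projM mulg1. Qed.
Let mulV : left_inverse PSL2Z_one PSL2Z_inv PSL2Z_mul.
Proof. by move=> x; rewrite -{2}(projK x) projM mulVg. Qed.
Let muldV : right_inverse PSL2Z_one PSL2Z_inv PSL2Z_mul.
Proof. by move=> x; rewrite -{1}(projK x) projM mulgV. Qed.

HB.instance Definition _ := isGroup.Build PSL2Z mulA mul1 muld1 mulV muldV.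

Lemma PSL2Z_projM (A B : SL2Z) :
  PSL2Z_proj (A * B)%g = (PSL2Z_proj A * PSL2Z_proj B)%g.
Proof. by rewrite -projM. Qed.

End PSL2ZGroup.

Record character (R : realType) (G : groupType) := Character {
  char_fun :> G -> R[i];
  char_neq0 : forall x, char_fun x != 0;
  charM : forall x y, char_fun (x * y)%g = char_fun x * char_fun y;
  char_finite : finite_set (range char_fun)
}.

Section ModularForms.

Variable R : realType.

Local Notation C := R[i].

Definition uhp := {z : C | 0 < complex.Im z}.

(* Functions on the half plane have type [uhp -> C]; [ext f] is [f] on the
   half plane, with the junk value 0 elsewhere. *)
Definition ext (f : uhp -> C) (z : C) : C := oapp f 0 (insub z).

Definition cexp (z : C) : C := (expR (complex.Re z))%:C * (cos (complex.Im z) +i* sin (complex.Im z)).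

(* Complex differentiability; [C^o] carries the norm topology of [C]. *)
Definition holomorphic (f : uhp -> C) : Prop :=
  forall t : uhp, derivable (ext f : C^o -> C^o) (val t) 1.

Definition moebius (M : 'M[R]_2) (z : C) : C :=
  ((M 0 0)%:C * z + (M 0 1)%:C) / ((M 1 0)%:C * z + (M 1 1)%:C).

Definition slash (k : nat) (M : 'M[R]_2) (f : uhp -> C) : uhp -> C :=
  fun t => (\det M `^ (k%:R / 2))%:C
           * ((M 1 0)%:C * val t + (M 1 1)%:C) ^- k
           * ext f (moebius M (val t)).

Definition realmx (M : SL2Z) : 'M[R]_2 := map_mx intr (val M).

(* [f] has a Fourier expansion  sum_(n >= 1) a_n exp(2 pi i n t / h),
   that is, one without terms of index n <= 0. *)
Definition vanishes_at_infty (f : uhp -> C) : Prop :=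
  exists (h : nat) (a : nat -> C), (0 < h)%N /\
    forall t : uhp,
      (series (fun n => a n * cexp ((2 * pi)%:C * 'i * n.+1%:R * val t / h%:R))
        : nat -> C^o) @ \oo --> (f t : C^o).

Lemma Im_moebius (M : 'M[R]_2) (t : uhp) :
  0 < \det M -> 0 < complex.Im (moebius M (val t)).
Proof.
have -> : \det M = M 0 0 * M 1 1 - M 0 1 * M 1 0.
  rewrite -det_mx22; congr (\det _); apply/matrixP => i j.
  by rewrite mxE; case: i => [[|[|[]]]] //= ?; case: j => [[|[|[]]]] //= ?;
    congr (M _ _); apply: val_inj.
case: t => -[x y] /= y0 detM; rewrite /moebius.
move: (M 0 0) (M 0 1) (M 1 0) (M 1 1) detM => a b c d detM.
have n0 : 0 < (c * x + d) ^+ 2 + (c * y) ^+ 2.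
  rewrite lt_neqAle addr_ge0 ?sqr_ge0// andbT eq_sym paddr_eq0 ?sqr_ge0//.
  apply/negP => /andP[]; rewrite !sqrf_eq0 [c * y == 0]mulf_eq0 (gt_eqF y0) orbF.
  move=> cxd /eqP c0; move: cxd; rewrite c0 mul0r add0r => /eqP d0.
  by move: detM; rewrite c0 d0 !mulr0 subrr ltxx.
simpc => /=.
set n := (_ ^+ 2 + _) in n0 *.
have -> : - ((a * x + b) * (c * y / n)) + a * y * ((c * x + d) / n) =
   (a * d - b * c) * y / n by ring.
by rewrite divr_gt0// mulr_gt0.
Qed.

(* Only the values of [chi] on [Gamma] matter.  Every cusp is M(oo) for some M
   in SL2(Z), so vanishing at all cusps is a condition on all [slash k M f]. *)
Definition cusp_forms (Gamma : set SL2Z) (k : nat) (chi : SL2Z -> C) :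
    set (uhp -> C) :=
  [set f | [/\ holomorphic f,
      forall M, Gamma M -> slash k (realmx M) f = chi M *: f &
      forall M, vanishes_at_infty (slash k (realmx M) f)]].

Definition Gamma0 (N : nat) : set SL2Z := [set M : SL2Z | (N%:Z %| (val M 1 0)%R)%Z].

Definition dilate (d : nat) (f : uhp -> C) : uhp -> C :=
  fun t => ext f (d%:R * val t).

(* The closed standard fundamental domain of SL2(Z), in coordinates (x, y);
   its boundary is a null set. *)
Definition fund_domain : set (R * R) :=
  [set p | [/\ `|p.1| <= 1 / 2, 0 < p.2 & 1 <= p.1 ^+ 2 + p.2 ^+ 2]].

Definition cintegral d (T : measurableType d) (mu : {measure set T -> \bar R})
    (D : set T) (f : T -> C) : C :=
  (\int[mu]_(p in D) complex.Re (f p)) +i* (\int[mu]_(p in D) complex.Im (f p)).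

(* The integral of f(z) conj(g(z)) Im(z)^k dx dy / y^2 over Gamma0(N)\H, not
   normalised by the volume: the sum over the right cosets c of Gamma0(N) in
   SL2(Z) of the integrals over M(fund_domain), M a representative of c, pulled
   back to [fund_domain] along M (which preserves dx dy / y^2).  The choice of
   M is immaterial when f and g have weight k for Gamma0(N). *)
Definition petersson (N k : nat) (f g : uhp -> C) : C :=
  \sum_(c \in range (fun M : SL2Z => [set (A * M)%g | A in Gamma0 N]))
    cintegral (lebesgue_measure \x lebesgue_measure)%E fund_domain
      (fun p => let z := moebius (realmx (xget 1%g c)) (p.1 +i* p.2) in
         ext f z * (ext g z)^* * (complex.Im z ^+ k)%:C * (p.2 ^- 2)%:C).

Definition span (A : set (uhp -> C)) : set (uhp -> C) :=
  [set f | exists (n : nat) (c : 'I_n -> C) (u : 'I_n -> uhp -> C),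
     (forall i, A (u i)) /\ f = \sum_(i < n) c i *: u i].

Definition oldforms (N k : nat) : set (uhp -> C) :=
  span [set f | exists (M d : nat) (h : uhp -> C),
    [/\ (M %| N)%N, M != N, (d %| N %/ M)%N,
        cusp_forms (Gamma0 M) k (fun=> 1) h & f = dilate d h]].

Definition newforms (N k : nat) : set (uhp -> C) :=
  [set g | cusp_forms (Gamma0 N) k (fun=> 1) g /\
     forall h, oldforms N k h -> petersson N k g h = 0].

(* [phi] restricts to an isomorphism of complex vector spaces from the subspace
   [V] to the subspace [W]; that [phi] maps [V] into [W] is part of [set_bij]. *)
Definition linear_iso (V W : set (uhp -> C)) (phi : (uhp -> C) -> (uhp -> C)) :=
  [/\ submod_closed [in V], submod_closed [in W],
      forall a : C, {in V &, {morph phi : u v / a *: u + v}} &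
      set_bij V W phi].

End ModularForms.

(* Main.v *)
(* Let [g] be a form of level 4.  The matrix [1 0; 2 1] and the translation
   [t -> t + 1/2] act as involutions on such forms.  Both traces, [g + g|[1 0; 2 1]]
   and [g + g(t + 1/2)], are old: the first has level 2, the second is [h(2 t)] with
   [h] of level 2; conversely every generator [h(d t)] of the old space is fixed
   by the first involution ([d] odd) or by the second ([d] even).  Both
   involutions are isometries for the Petersson norm, so by polarization [g] is
   new iff both act on it as -1.  Substituting [t/2] for [t] turns them into the
   actions of [T] and [1 0; 1 1], which generate SL2(Z): the two sign conditions
   say that [g(t/2)] transforms under all of SL2(Z) by [chi].

   The first involution permutes the six cosets of Gamma0(4), which makes it
   an isometry.  For the second, the six translates of the standard fundamental
   domain are cut and moved by elements of Gamma0(4) to the strip [|x| <= 1/2]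
   outside the circles [|z + 1/4| = 1/4] and [|z - 1/4| = 1/4]; this domain is
   periodically invariant under [x -> x + 1/2]. *)
From HB Require Import structures.
Require Import Defs.
From mathcomp Require Import all_boot all_order all_algebra.
From mathcomp Require Import all_classical all_reals all_analysis.
From mathcomp Require Import measurable_realfun complex ring lra zify.

Set Implicit Arguments.
Unset Strict Implicit.
Unset Printing Implicit Defensive.

Import Order.TTheory GRing.Theory Num.Theory numFieldNormedType.Exports.
Import ComplexField Normc.

Local Open Scope classical_set_scope.
Local Open Scope complex_scope.
Local Open Scope ring_scope.

(** Polarization reduces both isometries to equalities of norms, hence to integrals of the
    nonnegative function [phi], that is |f|^2 y^k. These are extended reals, so Tonelli, cutting and
    rearranging need no integrability. Integrability enters only for the sesquilinearity of the
    Petersson product and comes from the exponential decay of Fourier series. Moving pieces of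
    domains requires that dx dy / y^2 be invariant under z -> z + b and z -> -1/z. For the latter no
    change of variables in the plane is made: with x = s y the measure is ds dy / y, and z -> -1/z
    becomes s -> -s together with y -> 1 / ((1 + s^2) y), so that the invariance of dy / y under y
    -> c / y suffices. The character enters through an explicit formula in the parities of the
    entries, so that its values on conjugated matrices are computations modulo 2. *)

Local Notation realmx := Defs.realmx.

(** * The hyperbolic measure *)

Section HyperbolicMeasure.
Variable R : realType.
Local Notation mu := (@lebesgue_measure R).
Local Notation mu2 := (product_measure1 mu mu).

(** Inversion is discontinuous at 0; it is glued from the measurable power function of exponent -1
    on nonnegative arguments and its odd reflection. *)
Lemma measurable_invr : measurable_fun [set: R] (@GRing.inv R).
Proof.
have -> : @GRing.inv R =
    (fun y => if 0 <= y then y `^ (-1) else - ((- y) `^ (-1))).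
  apply/funext => y; case: ifPn => [y0|]; first by rewrite powR_inv1.
  by rewrite -ltNge => y0; rewrite powR_inv1 ?oppr_ge0 ?ltW// invrN opprK.
apply: measurable_fun_ifT.
- exact: measurable_fun_ler.
- exact: measurable_powR.
- apply: measurableT_comp => //.
  exact: (measurableT_comp (measurable_powR _) (@oppr_measurable R setT)).
Qed.

Lemma measurable_funV d (T : measurableType d) (D : set T) (f : T -> R) :
  measurable_fun D f -> measurable_fun D (fun x => (f x)^-1).
Proof. by move=> mf; apply: (measurableT_comp measurable_invr). Qed.

(** Lebesgue measure is determined by its values on the intervals []u, v]], and the pushforward
    under the affine map, rescaled by [a], has the same values there. *)
Lemma ge0_integral_affine (a b : R) (f : R -> \bar R) : 0 < a ->
  measurable_fun [set: R] f -> (forall x, 0 <= f x)%E ->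
  (\int[mu]_x f x = a%:E * \int[mu]_x f (a * x + b)%R)%E.
Proof.
move=> a0 mf f0.
have mA : measurable_fun [set: R] (fun x : R => a * x + b).
  by apply: measurable_funD => //; exact: mulrl_measurable.
pose phi : measurableTypeR R -> measurableTypeR R := fun x => a * x + b.
have mphi : measurable_fun [set: measurableTypeR R] phi by [].
have a0' := ltW a0.
pose an : {nonneg R} := NngNum a0'.
have E A : measurable A -> mu A = mscale an (pushforward mu phi) A.
  move=> mAA; apply: lebesgue_measure_unique => //= _ [[u v]] _ <-.
  rewrite /mscale /= /pushforward.
  have -> : phi @^-1` `]u, v] = `](u - b) / a, (v - b) / a]%classic.
    apply/seteqP; split => x /=; rewrite !in_itv/= ltr_pdivrMr// ler_pdivlMr//;
    by rewrite ltrBlDr lerBrDr [x * a]mulrC.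
  rewrite !lebesgue_measure_itv /= !lte_fin ltr_pM2r ?invr_gt0// ltrD2r.
  case: ifPn => _; last by rewrite mule0.
  by rewrite -!EFinB -EFinM -mulrBl mulrCA divff ?gt_eqF// mulr1; congr (_%:E); lra.
rewrite (eq_measure_integral (mscale an (pushforward mu phi))); last first.
  by move=> A mA' _; exact: E.
rewrite ge0_integral_mscale//=; congr (_ * _)%E.
by rewrite ge0_integral_pushforward.
Qed.

Lemma ge0_integral_opp (f : R -> \bar R) :
  measurable_fun [set: R] f -> (forall x, 0 <= f x)%E ->
  (\int[mu]_x f x = \int[mu]_x f (- x)%R)%E.
Proof.
move=> mf f0.
rewrite (eq_measure_integral (pushforward mu (-%R : _ -> measurableTypeR R))).
  by rewrite ge0_integral_pushforward.
by move=> A mA _; apply/esym/lebesgue_measureN.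
Qed.

(** The density of the invariant measure dy / y of the positive reals; the value 0 elsewhere lets
    every integral run over the whole line. *)
Definition haar (y : R) : R := if 0 < y then y^-1 else 0.

Lemma haar_ge0 y : 0 <= haar y.
Proof. by rewrite /haar; case: ifPn => // y0; rewrite invr_ge0 ltW. Qed.

Lemma measurable_haar : measurable_fun [set: R] haar.
Proof.
apply: measurable_fun_ifT => //; first exact: measurable_fun_ltr.
exact: measurable_invr.
Qed.

Lemma haar_scale (c y : R) : 0 < c -> c * haar (c * y) = haar y.
Proof.
move=> c0; rewrite /haar pmulr_rgt0//; case: ifPn => y0; last by rewrite mulr0.
by rewrite invfM mulrA divff ?mul1r// gt_eqF.
Qed.

Lemma measurable_fun_haar d (T : measurableType d) (f : T -> R) :
  measurable_fun setT f -> measurable_fun setT (fun x => haar (f x)).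
Proof. by move=> mf; apply: (measurableT_comp measurable_haar). Qed.

Lemma haar_integral_scale (c : R) (f : R -> R) : 0 < c ->
  measurable_fun setT f -> (forall x, 0 <= f x) ->
  (\int[mu]_y (haar y * f y)%:E = \int[mu]_y (haar y * f (c * y))%:E)%E.
Proof.
move=> c0 mf f0.
rewrite (ge0_integral_affine 0 c0); first last.
- by move=> y; rewrite lee_fin mulr_ge0 ?haar_ge0.
- apply/measurable_EFinP/measurable_funM => //; exact: measurable_haar.
rewrite -ge0_integralZl_EFin ?ltW//; first last.
- apply/measurable_EFinP/measurable_funM.
    by apply: measurable_fun_haar; apply: measurable_funD => //; exact: mulrl_measurable.
  apply: (measurableT_comp mf).
  apply: measurable_funD => //; exact: mulrl_measurable.
- by move=> y _; rewrite lee_fin mulr_ge0 ?haar_ge0.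
by apply: eq_integral => y _; rewrite -EFinM addr0 mulrA haar_scale.
Qed.

(* Uniqueness of Haar measure: integrate [f (c / y) chi (y t)] against
   [dy/y dt/t] in both orders, using only invariance under scaling. *)
Lemma haar_integral_inv (c : R) (f : R -> R) : 0 < c ->
  measurable_fun setT f -> (forall x, 0 <= f x) ->
  (\int[mu]_y (haar y * f y)%:E = \int[mu]_y (haar y * f (c / y))%:E)%E.
Proof.
move=> c0 mf f0.
pose chi : R -> R := \1_(`[1, 2]).
have mchi : measurable_fun setT chi by exact: measurable_indic.
have chi0 x : 0 <= chi x by rewrite /chi indicE.
pose K (g : R -> R) : \bar R := (\int[mu]_y (haar y * g y)%:E)%E.
have KZ (g : R -> R) (a : R) : measurable_fun setT g -> (forall x, 0 <= g x) -> 0 <= a ->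
    (K (fun y => a * g y)%R = a%:E * K g)%E.
  move=> mg g0 a0; rewrite /K -ge0_integralZl_EFin//.
  - by apply: eq_integral => y _; rewrite -EFinM mulrCA.
  - by move=> y _; rewrite lee_fin mulr_ge0 ?haar_ge0.
  - by apply/measurable_EFinP/measurable_funM => //; exact: measurable_haar.
have K0 (g : R -> R) : (forall x, 0 <= g x) -> (0 <= K g)%E.
  by move=> g0; apply: integral_ge0 => y _; rewrite lee_fin mulr_ge0 ?haar_ge0.
have mfc : measurable_fun setT (fun y : R => f (c / y)).
  apply: (measurableT_comp mf).
  by apply: measurable_funM => //; exact: measurable_invr.
have Kchi : exists2 r : R, 0 < r & K chi = r%:E.
  (* On [[1, 2]] the density lies between 1/2 and 1, hence so does [K chi]. Only its positivity and
     finiteness matter, since it is cancelled at the end. *)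
  suff [ge lt] : (2^-1%:E <= K chi)%E /\ (K chi <= 1%:E)%E.
    have fK : K chi \is a fin_num.
      by rewrite ge0_fin_numE ?K0// (le_lt_trans lt)// ltey.
    exists (fine (K chi)); last by rewrite fineK.
    by rewrite -lte_fin fineK//; apply: lt_le_trans ge; rewrite lte_fin.
  have I12 (a : R) : 0 <= a -> (\int[mu]_y (a * chi y)%:E = a%:E)%E.
    move=> a0; under eq_integral do rewrite EFinM.
    rewrite ge0_integralZl_EFin//; last first.
    - exact/measurable_EFinP.
    - by move=> y _; rewrite lee_fin.
    rewrite integral_indic//= setIT lebesgue_measure_itv/= lte_fin ltr1n.
    by rewrite -EFinB -EFinM; congr (_%:E); lra.
  split.
  - rewrite -(I12 2^-1) ?invr_ge0//; apply: ge0_le_integral => //.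
    + by move=> y _; rewrite lee_fin mulr_ge0.
    + by apply/measurable_EFinP; apply: measurable_funM.
    + by apply/measurable_EFinP; apply: measurable_funM => //; exact: measurable_haar.
    + move=> y _; rewrite lee_fin /chi indicE.
      case: (boolP (y \in _)) => [|_]; last by rewrite !mulr0.
      rewrite inE/= in_itv/= => /andP[y1 y2]; rewrite !mulr1 /haar ifT; last by lra.
      by rewrite lef_pV2 ?posrE; lra.
  - rewrite -(I12 1)//; apply: ge0_le_integral => //.
    + by move=> y _; rewrite lee_fin mulr_ge0 ?haar_ge0.
    + by apply/measurable_EFinP; apply: measurable_funM => //; exact: measurable_haar.
    + by apply/measurable_EFinP; apply: measurable_funM.
    + move=> y _; rewrite lee_fin /chi indicE.
      case: (boolP (y \in _)) => [|_]; last by rewrite !mulr0.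
      rewrite inE/= in_itv/= => /andP[y1 y2]; rewrite !mulr1 /haar ifT; last by lra.
      by rewrite invf_le1//; lra.
case: Kchi => r r0 Kr.
pose F (p : R * R) := haar p.1 * (haar p.2 * (f (c / p.1) * chi (p.1 * p.2))).
have F0 p : (0 <= (F p)%:E)%E by rewrite lee_fin !mulr_ge0 ?haar_ge0.
have mF : measurable_fun setT (EFin \o F).
  apply/measurable_EFinP; rewrite /F; apply: measurable_funM.
    by apply: measurable_fun_haar; exact: measurable_fst.
  apply: measurable_funM; first by apply: measurable_fun_haar; exact: measurable_snd.
  apply: measurable_funM; first by apply: (measurableT_comp mfc); exact: measurable_fst.
  by apply: (measurableT_comp mchi); apply: measurable_funM; [exact: measurable_fst|exact: measurable_snd].
have := @fubini_tonelli _ _ _ _ _ mu mu (EFin \o F) mF F0.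
rewrite /F /=.
have mchiM (y : R) : measurable_fun setT (fun x : R => chi (y * x)).
  by apply: (measurableT_comp mchi); exact: mulrl_measurable.
have mhaar : forall g : R -> R, measurable_fun setT g ->
    measurable_fun setT (fun y => (haar y * g y)%:E).
  by move=> g mg; apply/measurable_EFinP/measurable_funM => //; exact: measurable_haar.
(* With [t] innermost, scaling by [y] frees [chi] from [y]. *)
have E1 y : (\int[mu]_t (haar y * (haar t * (f (c / y) * chi (y * t))))%:E =
    (haar y * f (c / y))%:E * K chi)%E.
  rewrite /haar; case: ifPn => y0; last first.
    by rewrite mul0r mul0e; under eq_integral do rewrite mul0r; rewrite integral0.
  rewrite /K (haar_integral_scale y0 mchi chi0) -/(K _) -KZ//.
  - by rewrite /K; apply: eq_integral => t _; congr (_%:E); rewrite -/(haar t); ring.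
  - by rewrite mulr_ge0// invr_ge0 ltW.
(* With [y] innermost, scaling by [t] frees [chi] from [t], at the price of moving [t] into the
   argument of [f]. *)
have E2 t : (\int[mu]_y (haar y * (haar t * (f (c / y) * chi (y * t))))%:E =
    K (fun y => haar t * (f (c * t / y) * chi y))%R)%E.
  rewrite /haar; case: ifPn => t0; last first.
    rewrite /K; apply: eq_integral => y _; congr (_%:E); ring.
  rewrite -/(haar t) /K [RHS](@haar_integral_scale t _ t0); last 2 first.
  - apply: measurable_funM => //; apply: measurable_funM => //.
    apply: (measurableT_comp mf); apply: measurable_funM => //.
    exact: measurable_invr.
  - by move=> x; rewrite !mulr_ge0// invr_ge0 ltW.
  apply: eq_integral => y _; congr (_%:E); rewrite -/(haar y).
  rewrite [t * y]mulrC; congr (_ * (_ * (f _ * _))).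
  by rewrite invfM mulrACA divff ?mulr1// gt_eqF.
under eq_integral do rewrite E1.
under [RHS]eq_integral do rewrite E2.
pose F2 (p : R * R) := haar p.2 * (haar p.1 * (f (c * p.1 / p.2) * chi p.2)).
have F20 p : (0 <= (F2 p)%:E)%E by rewrite lee_fin !mulr_ge0 ?haar_ge0.
have mF2 : measurable_fun setT (EFin \o F2).
  apply/measurable_EFinP; rewrite /F2; apply: measurable_funM.
    by apply: measurable_fun_haar; exact: measurable_snd.
  apply: measurable_funM; first by apply: measurable_fun_haar; exact: measurable_fst.
  apply: measurable_funM; last by apply: (measurableT_comp mchi); exact: measurable_snd.
  apply: (measurableT_comp mf); apply: measurable_funM.
    by apply: (measurableT_comp (mulrl_measurable c)); exact: measurable_fst.
  by apply: measurable_funV; exact: measurable_snd.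
have := @fubini_tonelli _ _ _ _ _ mu mu (EFin \o F2) mF2 F20.
rewrite /F2 /= -/K => ->.
(* After a second exchange of the integrals, scaling by [c / y] removes [c] and [y] from [f], and
   both sides share the factor [K chi]. *)
have E3 y : (\int[mu]_t (haar y * (haar t * (f (c * t / y) * chi y)))%:E =
    K f * (haar y * chi y)%:E)%E.
  rewrite muleC {1 3}/haar; case: ifPn => y0; last first.
    by rewrite mul0r mul0e; under eq_integral do rewrite mul0r; rewrite integral0.
  have cy0 : 0 < c / y by rewrite divr_gt0.
  rewrite /K (haar_integral_scale cy0 mf f0) -/(K _) -KZ//.
  - rewrite /K; apply: eq_integral => t _; congr (_%:E).
    by rewrite -/(haar t) [c / y * t]mulrAC; ring.
  - by apply: (measurableT_comp mf); exact: mulrl_measurable.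
  - by rewrite mulr_ge0// invr_ge0 ltW.
under [RHS]eq_integral do rewrite E3.
rewrite ge0_integralZr//; last 3 first.
- exact: mhaar.
- by move=> y _; rewrite lee_fin mulr_ge0 ?haar_ge0.
- exact: K0.
rewrite ge0_integralZl//; last 3 first.
- exact: mhaar.
- by move=> y _; rewrite lee_fin mulr_ge0 ?haar_ge0.
- exact: K0.
rewrite -/(K chi) Kr => /(congr1 (fun x => x * r^-1%:E)%E).
by rewrite -!muleA -!EFinM divff ?gt_eqF// !mule1.
Qed.

(* The hyperbolic integral over the upper half plane: [haar y] is 0 for
   [y <= 0]. *)
Definition hint (f : R * R -> R) : \bar R :=
  (\int[mu2]_p (f p * haar p.2 ^+ 2)%:E)%E.

Definition trans (b : R) (p : R * R) : R * R := (p.1 + b, p.2).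

(** The map z -> -1/z in real coordinates. *)
Definition invS (p : R * R) : R * R :=
  (- p.1 / (p.1 ^+ 2 + p.2 ^+ 2), p.2 / (p.1 ^+ 2 + p.2 ^+ 2)).

Lemma measurable_trans b : measurable_fun setT (trans b).
Proof.
apply/measurable_fun_pairP; split => /=.
- by apply: measurable_funD => //; exact: measurable_fst.
- exact: measurable_snd.
Qed.

Lemma measurable_sqnorm :
  measurable_fun setT (fun p : R * R => p.1 ^+ 2 + p.2 ^+ 2).
Proof.
by apply: measurable_funD; apply: measurable_funX;
  [exact: measurable_fst|exact: measurable_snd].
Qed.

Lemma measurable_invS : measurable_fun setT invS.
Proof.
have mV := measurable_funV measurable_sqnorm.
apply/measurable_fun_pairP; split => /=.
- by apply: measurable_funM => //; apply: measurableT_comp => //; exact: measurable_fst.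
- by apply: measurable_funM => //; exact: measurable_snd.
Qed.

Section Invariance.
Variable f : R * R -> R.
Hypotheses (mf : measurable_fun setT f) (f0 : forall p, 0 <= f p).

Let mhaar2 : measurable_fun setT (fun p : R * R => haar p.2 ^+ 2).
Proof.
apply: measurable_funX; apply: measurable_fun_haar; exact: measurable_snd.
Qed.

Lemma measurable_hint : measurable_fun setT (fun p => (f p * haar p.2 ^+ 2)%:E).
Proof. exact/measurable_EFinP/measurable_funM. Qed.

Lemma hint_trans b : hint f = hint (f \o trans b).
Proof.
have mtf : measurable_fun setT (f \o trans b).
  by apply: measurableT_comp => //; exact: measurable_trans.
rewrite /hint [LHS]fubini_tonelli2; last 2 first.
- exact: measurable_hint.
- by move=> p; rewrite lee_fin mulr_ge0// exprn_ge0// haar_ge0.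
rewrite [RHS]fubini_tonelli2; last 2 first.
- apply/measurable_EFinP; exact: measurable_funM.
- by move=> p; rewrite lee_fin mulr_ge0//= exprn_ge0// haar_ge0.
apply: eq_integral => y _; rewrite /fubini_G /=.
rewrite (@ge0_integral_affine 1 b _ ltr01); first last.
- by move=> x; rewrite lee_fin mulr_ge0//= exprn_ge0// haar_ge0.
- have := measurableT_comp measurable_hint (pair2_measurable y); exact.
by rewrite mul1e; apply: eq_integral => x _ /=; rewrite mul1r.
Qed.

(** The substitution x = s y has Jacobian [y], which cancels one of the two factors [haar y]. In the
    coordinates (s, y) the map z -> -1/z only reflects [s] and, for fixed [s], inverts [y]. *)
Lemma hint_shear :
  hint f = (\int[mu]_s \int[mu]_y (haar y * f (s * y, y))%:E)%E.
Proof.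
have mg : measurable_fun setT (fun p : R * R => (haar p.2 * f (p.1 * p.2, p.2))%:E).
  apply/measurable_EFinP/measurable_funM.
    by apply: measurable_fun_haar; exact: measurable_snd.
  apply: (measurableT_comp mf); apply/measurable_fun_pairP; split => /=.
  - by apply: measurable_funM; [exact: measurable_fst|exact: measurable_snd].
  - exact: measurable_snd.
have g0 (p : R * R) : (0 <= (haar p.2 * f (p.1 * p.2, p.2))%:E)%E.
  by rewrite lee_fin mulr_ge0//= haar_ge0.
rewrite /hint [LHS]fubini_tonelli2; last 2 first.
- exact: measurable_hint.
- by move=> p; rewrite lee_fin mulr_ge0// exprn_ge0// haar_ge0.
rewrite (@fubini_tonelli _ _ _ _ _ mu mu _ mg g0)/=; apply: eq_integral => y _; rewrite /fubini_G /=.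
have [y0|y0] := ltP 0 y; last first.
  have -> : haar y = 0 by rewrite /haar ltNge y0.
  by under eq_integral do rewrite expr0n/= mulr0; under [RHS]eq_integral do rewrite mul0r.
rewrite (@ge0_integral_affine y 0 _ y0); first last.
- by move=> x; rewrite lee_fin mulr_ge0//= exprn_ge0// haar_ge0.
- have := measurableT_comp measurable_hint (pair2_measurable y); exact.
rewrite -ge0_integralZl_EFin ?(ltW y0)//; first last.
- have mh := measurableT_comp measurable_hint (pair2_measurable y).
  apply: (measurableT_comp mh); apply: measurable_funD => //; exact: mulrl_measurable.
- by move=> x _; rewrite lee_fin mulr_ge0//= exprn_ge0// haar_ge0.
apply: eq_integral => x _; rewrite -EFinM addr0 [y * x]mulrC; congr (_%:E).
by rewrite /haar y0; field; rewrite gt_eqF.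
Qed.

End Invariance.

Lemma hint_invS (f : R * R -> R) : measurable_fun setT f -> (forall p, 0 <= f p) ->
  hint f = hint (f \o invS).
Proof.
move=> mf f0.
have mif : measurable_fun setT (f \o invS).
  by apply: measurableT_comp => //; exact: measurable_invS.
rewrite !hint_shear//; last by move=> p; exact: f0.
have mg : measurable_fun setT (fun p : R * R => (haar p.2 * f (p.1 * p.2, p.2))%:E).
  apply/measurable_EFinP/measurable_funM.
    by apply: measurable_fun_haar; exact: measurable_snd.
  apply: (measurableT_comp mf); apply/measurable_fun_pairP; split => /=.
  - by apply: measurable_funM; [exact: measurable_fst|exact: measurable_snd].
  - exact: measurable_snd.
have g0 (p : R * R) : (0 <= (haar p.2 * f (p.1 * p.2, p.2))%:E)%E.
  by rewrite lee_fin mulr_ge0//= haar_ge0.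
rewrite [LHS]ge0_integral_opp; last 2 first.
- exact: (@measurable_fun_fubini_tonelli_F _ _ _ _ _ mu _ mg g0).
- by move=> s; apply: integral_ge0 => y _; rewrite lee_fin mulr_ge0// haar_ge0.
apply: eq_integral => s _.
have s1 : 0 < 1 + s ^+ 2 by rewrite ltr_pwDl// sqr_ge0.
(* For z = (s + i) y the height of -1/z is 1 / ((1 + s^2) y), which explains the constant of the
   inversion. *)
rewrite (@haar_integral_inv (1 + s ^+ 2)^-1 (fun y => f (- s * y, y))) ?invr_gt0//; last first.
  apply: (measurableT_comp mf); apply/measurable_fun_pairP; split => //=.
    exact: mulrl_measurable.
  exact: measurable_id.
apply: eq_integral => y _ /=; rewrite /haar; case: ifPn => y0; last by rewrite !mul0r.
congr (_ * f _)%:E; rewrite /invS /=.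
have d0 : (s * y) ^+ 2 + y ^+ 2 = (1 + s ^+ 2) * y ^+ 2 by ring.
by rewrite d0; congr (_, _); field; rewrite !gt_eqF.
Qed.

End HyperbolicMeasure.
Arguments invS {R} p.
Arguments trans {R} b p.

(** * A fundamental domain of Gamma0(4) *)

Section Tessellation.
Variable R : realType.
Local Notation mu := (@lebesgue_measure R).
Local Notation mu2 := (product_measure1 mu mu).
Implicit Types (p : R * R) (f g : R * R -> R) (A B C : R * R -> bool).

Definition sqnorm p : R := p.1 ^+ 2 + p.2 ^+ 2.

(** The listed lines and the unit circle are where two closed pieces of a decomposition below may
    overlap, or a closed piece meets a strict cut. The other boundary arcs need no exclusion: both
    sides of each identity describe them by the same inequality. *)
Definition generic p :=
  [&& 0 < p.2, sqnorm p != 1 & p.1 \notin [:: 0; 1/2; -(1/2); 3/2; -(3/2)]].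

Lemma negligible_line (c : R) : mu2.-negligible [set p | p.1 = c].
Proof.
exists ([set c] `*` setT); split.
- exact: measurableX.
- by rewrite product_measure1E//= lebesgue_measure_set1 mul0e.
- by move=> p /= ->.
Qed.

Lemma measurable_circle : measurable [set p : R * R | (0 < p.2) && (sqnorm p == 1)].
Proof.
have -> : [set p : R * R | (0 < p.2) && (sqnorm p == 1)] =
  setT `&` (fun p : R * R => (0 < p.2) && (sqnorm p == 1)) @^-1` [set true].
  by rewrite setTI.
apply: (_ : measurable_fun setT (fun p : R * R => (0 < p.2) && (sqnorm p == 1))) => //.
apply: measurable_and.
- by apply: measurable_fun_ltr => //; exact: measurable_snd.
- by apply: measurable_fun_eqr => //; exact: measurable_sqnorm.
Qed.

(** A vertical line meets the upper half circle in at most one point, so every section is null. *)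
Lemma negligible_circle : mu2.-negligible [set p | (0 < p.2) && (sqnorm p == 1)].
Proof.
exists [set p | (0 < p.2) && (sqnorm p == 1)]; split => //; first exact: measurable_circle.
rewrite /product_measure1; apply: integral0_eq => x _ /=.
apply/eqP; rewrite eq_le measure_ge0 andbT.
rewrite -(lebesgue_measure_set1 (Num.sqrt (1 - x ^+ 2))).
apply: le_measure; rewrite ?inE.
- by apply: measurable_xsection; exact: measurable_circle.
- exact: measurable_set1.
move=> y; rewrite /xsection /= inE /sqnorm /= => /andP[y0 /eqP e].
by rewrite -e addrAC subrr add0r sqrtr_sqr gtr0_norm.
Qed.

Lemma negligible_genericN : mu2.-negligible [set p | (0 < p.2) && ~~ generic p].
Proof.
have sub : [set p : R * R | (0 < p.2) && ~~ generic p] `<=`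
    [set p : R * R | (0 < p.2) && (sqnorm p == 1)] `|`
  ([set p : R * R | p.1 = 0] `|` ([set p : R * R | p.1 = 1/2] `|`
  ([set p : R * R | p.1 = -(1/2)] `|`
  ([set p : R * R | p.1 = 3/2] `|` [set p : R * R | p.1 = -(3/2)])))).
  move=> p /= /andP[y0]; rewrite /generic y0 /= negb_and !negbK.
  case/orP => [->|]; first by left.
  rewrite !inE => H; right; move: H.
  do 4! (case/orP => [/eqP ->|H]; [by left|right; move: H]).
  by move/eqP.
apply: (@negligibleS _ _ _ mu2 _ _ sub).
by apply: negligibleU; [exact: negligible_circle|];
  do 4! (apply: negligibleU; first exact: negligible_line); exact: negligible_line.
Qed.

Lemma hint_ae f g : measurable_fun setT f -> measurable_fun setT g ->
  (forall p, 0 <= f p) -> (forall p, 0 <= g p) ->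
  (forall p, generic p -> f p = g p) -> hint f = hint g.
Proof.
move=> mf mg f0 g0 fg; apply: ge0_ae_eq_integral => //.
- exact: measurable_hint.
- exact: measurable_hint.
- by move=> p _; rewrite lee_fin mulr_ge0// exprn_ge0// haar_ge0.
- by move=> p _; rewrite lee_fin mulr_ge0// exprn_ge0// haar_ge0.
apply: (@negligibleS _ _ _ mu2 _ _ _ negligible_genericN) => p /= H.
have [y0|y0] /= := boolP (0 < p.2).
  by apply/negP => gp; apply: H => _; rewrite fg.
by exfalso; apply: H => _; rewrite /haar (negbTE y0) expr0n/= !mulr0.
Qed.

Lemma hint_eq f g : (forall p, 0 < p.2 -> f p = g p) -> hint f = hint g.
Proof.
move=> fg; apply: eq_integral => p _; congr (_%:E).
have [y0|y0] := ltP 0 p.2; first by rewrite fg.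
by rewrite /haar ltNge y0 /= expr0n/= !mulr0.
Qed.

Definition on A f : R * R -> R := fun p => if A p then f p else 0.

Lemma measurable_on A f : measurable_fun setT A -> measurable_fun setT f ->
  measurable_fun setT (on A f).
Proof. by move=> mA mf; apply: measurable_fun_ifT. Qed.

Lemma on_ge0 A f : (forall p, 0 <= f p) -> forall p, 0 <= on A f p.
Proof. by move=> f0 p; rewrite /on; case: ifPn. Qed.

(** The equation of truth values read in [nat] expresses at once that [B] and [C] cover [A] and that
    they are disjoint, up to a null set of the half plane. *)
Lemma hint_onD A B C f : measurable_fun setT f -> (forall p, 0 <= f p) ->
  measurable_fun setT A -> measurable_fun setT B -> measurable_fun setT C ->
  (forall p, generic p -> (A p : nat) = (B p + C p)%N) ->
  hint (on A f) = (hint (on B f) + hint (on C f))%E.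
Proof.
move=> mf f0 mA mB mC ABC.
transitivity (hint (fun p => on B f p + on C f p)).
  apply: hint_ae => //.
  - exact: measurable_on.
  - by apply: measurable_funD; exact: measurable_on.
  - exact: on_ge0.
  - by move=> p; rewrite addr_ge0// on_ge0.
  move=> p /ABC; rewrite /on.
  by case: (A p) (B p) (C p) => [] [] [] //= _; rewrite ?addr0 ?add0r.
rewrite /hint -ge0_integralD//.
- by apply: eq_integral => p _; rewrite -EFinD mulrDl.
- by move=> p _; rewrite lee_fin mulr_ge0// ?on_ge0// exprn_ge0// haar_ge0.
- by apply: measurable_hint; exact: measurable_on.
- by move=> p _; rewrite lee_fin mulr_ge0// ?on_ge0// exprn_ge0// haar_ge0.
- by apply: measurable_hint; exact: measurable_on.
Qed.

Lemma hint_on_trans A f b : measurable_fun setT f -> (forall p, 0 <= f p) ->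
  measurable_fun setT A ->
  hint (on (A \o trans b) f) = hint (on A (f \o trans (- b))).
Proof.
move=> mf f0 mA; rewrite [RHS](@hint_trans _ _ _ _ b); first last.
- by move=> p; apply: on_ge0 => q; exact: f0.
- apply: measurable_on => //; apply: measurableT_comp => //; exact: measurable_trans.
apply: hint_eq => -[x y] _; rewrite /on /trans /=; case: ifP => //.
by rewrite addrK.
Qed.

Lemma sqnorm_gt0 p : 0 < p.2 -> 0 < sqnorm p.
Proof. by move=> y0; rewrite /sqnorm ltr_wpDl ?sqr_ge0// exprn_gt0. Qed.

Lemma invSK p : 0 < p.2 -> invS (invS p) = p.
Proof.
case: p => x y /= y0; have n0 : x ^+ 2 + y ^+ 2 != 0.
  by rewrite gt_eqF// ltr_wpDl ?sqr_ge0// exprn_gt0.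
rewrite /invS /=.
have -> : (- x / (x ^+ 2 + y ^+ 2)) ^+ 2 + (y / (x ^+ 2 + y ^+ 2)) ^+ 2 =
  (x ^+ 2 + y ^+ 2)^-1 by field.
by rewrite invrK !mulNr opprK !mulfVK.
Qed.

Lemma sqnorm_invS p : 0 < p.2 -> sqnorm (invS p) = (sqnorm p)^-1.
Proof.
by move=> y0; have := sqnorm_gt0 y0; rewrite /sqnorm /= => n0; field; rewrite gt_eqF.
Qed.

Lemma hint_on_invS A f : measurable_fun setT f -> (forall p, 0 <= f p) ->
  measurable_fun setT A ->
  hint (on (A \o invS) f) = hint (on A (f \o invS)).
Proof.
move=> mf f0 mA; rewrite [RHS]hint_invS; first last.
- by move=> p; apply: on_ge0 => q; exact: f0.
- apply: measurable_on => //; apply: measurableT_comp => //; exact: measurable_invS.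
by apply: hint_eq => p y0; rewrite /on /=; case: ifP => //; rewrite invSK.
Qed.

(* [D4] is the fundamental domain of Gamma0(4) bounded by [|x| = 1/2] and the
   circles [|z + 1/4| = 1/4], [|z - 1/4| = 1/4]; unlike the union of the six
   translates of [Fd], it is stable under [x -> x + 1/2] modulo [x -> x + 1]. *)
Definition Fd p := [&& `|p.1| <= 1/2, 0 < p.2 & 1 <= sqnorm p].
Definition D4 p := [&& `|p.1| <= 1/2, 0 < p.2 & `|p.1| / 2 <= sqnorm p].
(** The image under z -> -1/z of the part of [D4] inside the unit circle: the two circles of [D4]
    become the lines |x| = 2, and its sides |x| = 1/2 become the circles |z - 1| = 1 and |z + 1| =
    1. [Eo] is what remains beyond the central [Fd], and [Eh e] is its half on the side of the sign
    [e]. *)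
Definition Ed p := [&& `|p.1| <= 2, 0 < p.2, 2 * `|p.1| <= sqnorm p & 1 <= sqnorm p].
Definition Eo p := Ed p && (1/2 < `|p.1|).
Definition Eh (e : R) p := Ed p && (1/2 < e * p.1).
(** The end of [Eh (- e)] beyond |x| = 3/2, moved back by two periods: half a strip above the circle
    |z - e| = 1. It consists of one half of [Fd] and the image of the other half under z -> -1/z. *)
Definition Gd (e : R) p := [&& 0 <= e * p.1 <= 1/2, 0 < p.2 & 2 * (e * p.1) <= sqnorm p].
Definition Fh (e : R) p := Fd p && (0 <= e * p.1).
Definition D4h (e : R) p := D4 p && (0 <= e * p.1).

Lemma addb_nat (a b c : bool) : a = b || c -> ~~ (b && c) -> (a : nat) = (b + c)%N.
Proof. by move=> ->; case: b c => [] []. Qed.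

Lemma neq_ltP (x y : R) : x != y -> x < y \/ y < x.
Proof. by rewrite neq_lt => /orP. Qed.

Lemma norm2_le (a n : R) : (2 * `|a| <= n) = (- n <= 2 * a <= n).
Proof. by rewrite -ler_norml normrM ger0_norm. Qed.

Lemma genericP p : generic p -> [/\ 0 < p.2, sqnorm p != 1, p.1 != 0,
  p.1 != 1/2 & p.1 != -(1/2)] /\ p.1 != 3/2 /\ p.1 != -(3/2).
Proof.
by rewrite /generic !inE !negb_or => /and3P[-> -> /and5P[-> -> -> -> ->]].
Qed.

Lemma sqnorm_trans b p : sqnorm (trans b p) = sqnorm p + 2 * b * p.1 + b ^+ 2.
Proof. by rewrite /sqnorm /trans /=; ring. Qed.

Lemma D4E p : generic p -> (D4 p : nat) = (Fd p + (Ed \o invS) p)%N.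
Proof.
move=> /genericP[[y0 n1 _ _ _] _]; have n0 := sqnorm_gt0 y0.
have -> : (Ed \o invS) p = [&& `|p.1| <= 2 * sqnorm p, 2 * `|p.1| <= 1 & sqnorm p <= 1].
  rewrite /Ed /= sqnorm_invS// -/(sqnorm p) divr_gt0//= normrM normrN normfV.
  rewrite (gtr0_norm n0) ler_pdivrMr// invf_ge1//; congr (_ && (_ && _)).
  by rewrite mulrA ler_pdivrMr// mulVf ?gt_eqF.
rewrite /D4 /Fd y0; move: n0 n1 (normr_ge0 p.1).
move: (sqnorm p) `|p.1| => n a; rewrite neq_lt => n0 /orP n1 a0.
apply: addb_nat; [apply/idP/idP; lra | lra].
Qed.

Lemma EdE p : generic p -> (Ed p : nat) = (Fd p + Eo p)%N.
Proof.
move=> /genericP[[y0 n1 _ u1 u2] _]; have n0 := sqnorm_gt0 y0.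
rewrite /Ed /Eo /Fd /Ed y0 /=; move: n0 (normr_ge0 p.1).
move: (sqnorm p) `|p.1| => n a n0 a0.
apply: addb_nat; [apply/idP/idP; lra | lra].
Qed.

Lemma EoE p : generic p -> (Eo p : nat) = (Eh 1 p + Eh (-1) p)%N.
Proof.
move=> _; rewrite /Eo /Eh ltr_normr mul1r mulN1r; rewrite andb_orr.
by apply: addb_nat => //; case: (Ed p) => //=; lra.
Qed.

(** The circle |z - e| = 1 bounding [Ed] on this side is the unit circle moved by [e], so the part
    with 1/2 < e x < 3/2 is a translate of [Fd]. *)
Lemma EhE e p : e = 1 \/ e = -1 -> generic p ->
  (Eh e p : nat) = ((Fd \o trans (- e)) p + (Gd (- e) \o trans (- (2 * e))) p)%N.
Proof.
move=> he /genericP[[y0 n1 _ u1 u2] [u3 u4]].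
rewrite /Eh /Ed /Fd /Gd /= !sqnorm_trans y0 /=.
rewrite norm2_le !ler_norml.
move: n1 u1 u2 u3 u4; move: (sqnorm p) p.1 => n u /neq_ltP n1 /neq_ltP u1 /neq_ltP u2 /neq_ltP u3 /neq_ltP u4.
by case: he => ->; apply: addb_nat; [apply/idP/idP; lra | lra | apply/idP/idP; lra | lra].
Qed.

Lemma GdE e p : e = 1 \/ e = -1 -> generic p ->
  (Gd e p : nat) = (Fh e p + (Fh (- e) \o invS) p)%N.
Proof.
move=> he /genericP[[y0 n1 _ u1 u2] _]; have n0 := sqnorm_gt0 y0.
have -> : (Fh (- e) \o invS) p = [&& 2 * `|p.1| <= sqnorm p, sqnorm p <= 1 & 0 <= e * p.1].
  rewrite /Fh /Fd /= sqnorm_invS// -/(sqnorm p) divr_gt0//= normrM normrN normfV.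
  rewrite (gtr0_norm n0) ler_pdivrMr// invf_ge1// !mulrA mulrNN pmulr_lge0 ?invr_gt0//.
  by rewrite -andbA; congr (_ && _); apply/idP/idP; lra.
rewrite /Gd /Fh /Fd y0 norm2_le !ler_norml.
move: n0 n1; move: (sqnorm p) p.1 => n u n0 /neq_ltP n1.
by case: he => ->; apply: addb_nat; [apply/idP/idP; lra | lra | apply/idP/idP; lra | lra].
Qed.

Lemma FdE p : generic p -> (Fd p : nat) = (Fh 1 p + Fh (-1) p)%N.
Proof.
move=> /genericP[[y0 n1 u0 u1 u2] _].
rewrite /Fh mul1r mulN1r; move/neq_ltP: u0 => u0.
by apply: addb_nat; case: (Fd p) => //=; [apply/esym|]; lra.
Qed.

Lemma D4hE p : generic p -> (D4 p : nat) = (D4h 1 p + D4h (-1) p)%N.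
Proof.
move=> /genericP[[y0 n1 u0 u1 u2] _].
rewrite /D4h mul1r mulN1r; move/neq_ltP: u0 => u0.
by apply: addb_nat; case: (D4 p) => //=; [apply/esym|]; lra.
Qed.

(** Shifting [D4] by 1/2 puts it over 0 <= x <= 1, bounded below by |z - 1/4| = 1/4 and |z - 3/4| =
    1/4: the right half of [D4], followed by its left half moved by one period. *)
Lemma D4transE p : generic p ->
  ((D4 \o trans (-(1/2))) p : nat) = (D4h 1 p + (D4h (-1) \o trans (-1)) p)%N.
Proof.
move=> /genericP[[y0 n1 u0 u1 u2] _].
rewrite /D4h /D4 /= !sqnorm_trans y0 /= !ler_pdivrMr// !ler_norml.
move: u0 u1; move: (sqnorm p) p.1 => n u /neq_ltP u0 /neq_ltP u1.
by apply: addb_nat; [apply/idP/idP; lra | lra].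
Qed.

Lemma measurable_absfst : measurable_fun setT (fun p => `|p.1|).
Proof. by apply: measurableT_comp => //; exact: measurable_fst. Qed.

Lemma measurable_efst (e : R) : measurable_fun setT (fun p => e * p.1).
Proof. by apply: measurable_funM => //; exact: measurable_fst. Qed.

Ltac meas := repeat (apply: measurable_and);
  try (apply: measurable_fun_ler || apply: measurable_fun_ltr);
  rewrite //;
  repeat (first [exact: measurable_sqnorm | exact: measurable_absfst
    | exact: measurable_efst | exact: measurable_snd | exact: measurable_cst
    | apply: measurable_funM]).

Lemma measurable_Fd : measurable_fun setT Fd. Proof. by rewrite /Fd; meas. Qed.
Lemma measurable_D4 : measurable_fun setT D4. Proof. by rewrite /D4; meas. Qed.
Lemma measurable_Ed : measurable_fun setT Ed. Proof. by rewrite /Ed; meas. Qed.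
Lemma measurable_Gd e : measurable_fun setT (Gd e). Proof. by rewrite /Gd; meas. Qed.
Lemma measurable_Eo : measurable_fun setT Eo.
Proof. by apply: measurable_and; [exact: measurable_Ed|meas]. Qed.
Lemma measurable_Eh e : measurable_fun setT (Eh e).
Proof. by apply: measurable_and; [exact: measurable_Ed|meas]. Qed.
Lemma measurable_Fh e : measurable_fun setT (Fh e).
Proof. by apply: measurable_and; [exact: measurable_Fd|meas]. Qed.
Lemma measurable_D4h e : measurable_fun setT (D4h e).
Proof. by apply: measurable_and; [exact: measurable_D4|meas]. Qed.

Lemma hint_D4_half f : measurable_fun setT f -> (forall p, 0 <= f p) ->
  f \o trans 1 = f -> hint (on D4 (f \o trans (1/2))) = hint (on D4 f).
Proof.
move=> mf f0 f1.
have mD := measurable_D4; have mDh := measurable_D4h.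
rewrite -[1/2]opprK -hint_on_trans//.
rewrite (hint_onD mf f0 _ (mDh 1) _ D4transE); last 2 first.
- by apply: measurableT_comp => //; exact: measurable_trans.
- by apply: measurableT_comp => //; exact: measurable_trans.
by rewrite hint_on_trans// opprK f1 -(hint_onD mf f0 mD (mDh 1) (mDh (-1)) D4hE).
Qed.

Lemma hint_Gd e f : measurable_fun setT f -> (forall p, 0 <= f p) ->
  e = 1 \/ e = -1 ->
  hint (on (Gd e) f) = (hint (on (Fh e) f) + hint (on (Fh (- e)) (f \o invS)))%E.
Proof.
move=> mf f0 he; have mS := @measurable_invS R.
rewrite (hint_onD mf f0 (measurable_Gd e) (measurable_Fh e) _ (fun p => @GdE e p he)).
  by rewrite hint_on_invS//; exact: measurable_Fh.
by apply: measurableT_comp mS; exact: measurable_Fh.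
Qed.

Lemma hint_Eh e f : measurable_fun setT f -> (forall p, 0 <= f p) ->
  e = 1 \/ e = -1 ->
  hint (on (Eh e) f) = (hint (on Fd (f \o trans e)) +
    (hint (on (Fh (- e)) (f \o trans (2 * e))) +
     hint (on (Fh e) (f \o trans (2 * e) \o invS))))%E.
Proof.
move=> mf f0 he; have mT := @measurable_trans R.
have mG := measurable_Gd (- e).
rewrite (hint_onD mf f0 (measurable_Eh e) _ _ (fun p => @EhE e p he)); last 2 first.
- by apply: measurableT_comp (mT _); exact: measurable_Fd.
- by apply: measurableT_comp (mT _).
rewrite !hint_on_trans//; last exact: measurable_Fd.
rewrite !opprK; congr (_ + _)%E; rewrite hint_Gd ?opprK//.
- by apply: measurableT_comp (mT _).
- by move=> p; exact: f0.
- by case: he => ->; [right|left; rewrite opprK].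
Qed.

(** Four whole copies of [Fd] and four pairs of terms would exceed the index six: the translations
    by 2 and by -2 each contribute only halves [Fh], and for forms of level 4 these four halves
    recombine into two further copies. *)
Lemma hint_D4 f : measurable_fun setT f -> (forall p, 0 <= f p) ->
  let fS := f \o invS in
  hint (on D4 f) = (hint (on Fd f) + (hint (on Fd fS) +
   ((hint (on Fd (fS \o trans 1)) + (hint (on (Fh (-1)) (fS \o trans 2)) +
       hint (on (Fh 1) (fS \o trans 2 \o invS)))) +
    (hint (on Fd (fS \o trans (-1))) + (hint (on (Fh 1) (fS \o trans (-2))) +
       hint (on (Fh (-1)) (fS \o trans (-2) \o invS)))))))%E.
Proof.
move=> mf f0 fS; have mS := @measurable_invS R.
have mfS : measurable_fun setT fS by apply: measurableT_comp mS.
have fS0 p : 0 <= fS p by exact: f0.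
rewrite (hint_onD mf f0 measurable_D4 measurable_Fd _ D4E); last first.
  by apply: measurableT_comp mS; exact: measurable_Ed.
rewrite hint_on_invS//; last exact: measurable_Ed.
rewrite (hint_onD mfS fS0 measurable_Ed measurable_Fd measurable_Eo EdE).
rewrite (hint_onD mfS fS0 measurable_Eo (measurable_Eh 1) (measurable_Eh (-1)) EoE).
rewrite !hint_Eh//; [|by right|by left].
by rewrite mulr1 mulrN1 opprK.
Qed.

Lemma hint_Fd f : measurable_fun setT f -> (forall p, 0 <= f p) ->
  hint (on Fd f) = (hint (on (Fh 1) f) + hint (on (Fh (-1)) f))%E.
Proof.
move=> mf f0.
exact: hint_onD mf f0 measurable_Fd (measurable_Fh 1) (measurable_Fh (-1)) FdE.
Qed.

End Tessellation.

(** * Fourier expansions *)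

Section ComplexLimits.
Variable R : realType.
Local Notation C := R[i].

Lemma normcE' (z : C) : `|z| = (normc z)%:C.
Proof. by case: z. Qed.

Lemma normc_ge0 (z : C) : 0 <= normc z.
Proof. by case: z => a b; rewrite /= sqrtr_ge0. Qed.

Lemma normc_real (x : R) : normc x%:C = `|x|.
Proof. by rewrite /= expr0n addr0 sqrtr_sqr. Qed.

Lemma normc_eq0 (z : C) : (normc z == 0) = (z == 0).
Proof. by apply/eqP/eqP => [/eq0_normc|->]; rewrite ?normc0. Qed.

Lemma sqr_normc_ReIm (z : C) : normc z ^+ 2 = complex.Re z ^+ 2 + complex.Im z ^+ 2.
Proof. by case: z => a b /=; rewrite sqr_sqrtr// addr_ge0 ?sqr_ge0. Qed.

Lemma normc_Re (z : C) : `|complex.Re z| <= normc z.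
Proof.
by rewrite -ler_sqr ?nnegrE ?normc_ge0// real_normK ?num_real// sqr_normc_ReIm lerDl sqr_ge0.
Qed.

Lemma normc_Im (z : C) : `|complex.Im z| <= normc z.
Proof.
by rewrite -ler_sqr ?nnegrE ?normc_ge0// real_normK ?num_real// sqr_normc_ReIm lerDr sqr_ge0.
Qed.

Lemma normc_sum (I : Type) (s : seq I) (P : pred I) (F : I -> C) :
  normc (\sum_(i <- s | P i) F i) <= \sum_(i <- s | P i) normc (F i).
Proof.
elim/big_rec2: _ => [|i x y _ h]; first by rewrite normc0.
by apply: le_trans (le_normcD _ _) _; rewrite lerD2l.
Qed.

Lemma normcX (z : C) n : normc (z ^+ n) = normc z ^+ n.
Proof. by elim: n => [|n IH]; rewrite ?expr0 ?normc1// !exprS normcM IH. Qed.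

Lemma ReB (x y : C) : complex.Re (x - y) = complex.Re x - complex.Re y.
Proof. by case: x y => [a b] [c d]. Qed.

Lemma ImB (x y : C) : complex.Im (x - y) = complex.Im x - complex.Im y.
Proof. by case: x y => [a b] [c d]. Qed.

(** A positive complex tolerance is real, so estimates of [normc] with real tolerances suffice. *)
Lemma cvgCP (u : nat -> C) (l : C) :
  (u : nat -> C^o) @ \oo --> (l : C^o) <->
  forall e : R, 0 < e -> exists N, forall n, (N <= n)%N -> normc (u n - l) < e.
Proof.
split=> [/cvgrPdist_lt H e e0|H].
  have [|N _ HN] := H e%:C; first by rewrite ltcR.
  exists N => n /HN /=; rewrite distrC.
  by rewrite (normcE' (u n - l)) ltcR.
apply/cvgrPdist_lt => e e0.
have eE : e = (complex.Re e)%:C by rewrite RRe_real// gtr0_real.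
move: e0; rewrite eE ltcR => /H[N HN].
by exists N => // n /= /HN; rewrite distrC (normcE' (u n - l)) ltcR.
Qed.

Lemma cvgC_Re (u : nat -> C) (l : C) : (u : nat -> C^o) @ \oo --> (l : C^o) ->
  (fun n => complex.Re (u n)) @ \oo --> complex.Re l.
Proof.
move/cvgCP => H; apply/cvgrPdist_lt => e /H[N HN]; exists N => // n /= /HN.
rewrite distrC; apply: le_lt_trans; by rewrite -ReB normc_Re.
Qed.

Lemma cvgC_Im (u : nat -> C) (l : C) : (u : nat -> C^o) @ \oo --> (l : C^o) ->
  (fun n => complex.Im (u n)) @ \oo --> complex.Im l.
Proof.
move/cvgCP => H; apply/cvgrPdist_lt => e /H[N HN]; exists N => // n /= /HN.
rewrite distrC; apply: le_lt_trans; by rewrite -ImB normc_Im.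
Qed.

Lemma cvgC_normc_le (u : nat -> C) (l c : C) (K : R) :
  (u : nat -> C^o) @ \oo --> (l : C^o) ->
  (exists N, forall n, (N <= n)%N -> normc (u n - c) <= K) -> normc (l - c) <= K.
Proof.
move=> /cvgCP H [N HN]; apply/ler_addgt0Pr => e /H[N' HN'].
have := HN (maxn N N') (leq_maxl _ _); have := HN' (maxn N N') (leq_maxr _ _).
set v := u _ => h1 h2.
have -> : l - c = - (v - l) + (v - c) by ring.
apply: le_trans (le_normcD _ _) _; rewrite normcN addrC lerD// ltW//.
Qed.

Lemma cvgC_unique (u : nat -> C) (l l' : C) :
  (u : nat -> C^o) @ \oo --> (l : C^o) -> (u : nat -> C^o) @ \oo --> (l' : C^o) -> l = l'.
Proof.
move=> ul /cvgCP ul'; apply/eqP; rewrite -subr_eq0 -normc_eq0 eq_le normc_ge0 andbT.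
apply/ler_addgt0Pr => e /ul'[N HN]; rewrite add0r.
by apply: (cvgC_normc_le ul); exists N => n Nn; rewrite ltW// HN.
Qed.

Lemma cexpD (a b : C) : cexp (a + b) = cexp a * cexp b.
Proof.
case: a b => [a1 a2] [b1 b2]; rewrite /cexp /= expRD cosD sinD.
by simpc; congr (_ +i* _); ring.
Qed.

Lemma cexp0 : cexp (0 : C) = 1.
Proof. by rewrite /cexp /= expR0 cos0 sin0 mul1r. Qed.

Lemma cexpX (z : C) n : cexp (n%:R * z) = cexp z ^+ n.
Proof.
elim: n => [|n IH]; first by rewrite mul0r cexp0.
by rewrite exprS -IH -cexpD; congr cexp; rewrite -natr1; ring.
Qed.

Lemma normc_cexp (z : C) : normc (cexp z) = expR (complex.Re z).
Proof.
rewrite /cexp normcM normc_real gtr0_norm ?expR_gt0//=.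
by rewrite cos2Dsin2 sqrtr1 mulr1.
Qed.

End ComplexLimits.

Section Fourier.
Variable R : realType.
Local Notation C := R[i].
Local Notation uhp := (uhp R).
Implicit Types (h : nat) (a : nat -> C) (f : uhp -> C) (z : C) (t : uhp).

Lemma natcE n : (n%:R : C) = (n%:R : R)%:C.
Proof. by rewrite (rmorph_nat (real_complex R)). Qed.

Lemma realcV (x : R) : (x%:C)^-1 = (x^-1)%:C.
Proof. by rewrite (fmorphV (real_complex R)). Qed.

Lemma realcM (x : R) z : x%:C * z = (x * complex.Re z) +i* (x * complex.Im z).
Proof. by case: z => u v; simpc. Qed.

Definition qexp h z : C := cexp ((2 * pi)%:C * 'i * z / h%:R).

Lemma qexp_arg h z : (2 * pi)%:C * 'i * z / h%:R =
  (- (2 * pi * complex.Im z / h%:R)) +i* (2 * pi * complex.Re z / h%:R).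
Proof.
rewrite natcE realcV mulrC; case: z => u v; simpc => /=.
by congr (_ +i* _); ring.
Qed.

Definition decay h (y : R) : R := expR (- (2 * pi * y / h%:R)).

Lemma normc_qexp h z : normc (qexp h z) = decay h (complex.Im z).
Proof. by rewrite /qexp normc_cexp qexp_arg. Qed.

Definition fourier h a f := forall t,
  (series (fun n => a n * qexp h (val t) ^+ n.+1) : nat -> C^o) @ \oo --> (f t : C^o).

Lemma vanishesP f : vanishes_at_infty f <->
  exists h a, (0 < h)%N /\ fourier h a f.
Proof.
have E h a t : (fun n => a n * cexp ((2 * pi)%:C * 'i * n.+1%:R * val t / h%:R)) =
    (fun n => a n * qexp h (val t) ^+ n.+1).
  apply/funext => n; rewrite /qexp -cexpX; congr (_ * cexp _); ring.
by split=> -[h [a [h0 H]]]; exists h, a; split=> // t; have := H t; rewrite E.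
Qed.

Lemma decay_gt0 h y : 0 < decay h y. Proof. exact: expR_gt0. Qed.

Lemma decayD h x y : decay h (x + y) = decay h x * decay h y.
Proof. by rewrite /decay -expRD; congr expR; ring. Qed.

Lemma decay_lt1 h y : (0 < h)%N -> 0 < y -> decay h y < 1.
Proof.
move=> h0 y0; rewrite /decay -[ltRHS]expR0 ltr_expR oppr_lt0 divr_gt0 ?ltr0n//.
by rewrite !mulr_gt0 ?pi_gt0.
Qed.

Lemma decay_le h x y : (0 < h)%N -> x <= y -> decay h y <= decay h x.
Proof.
move=> h0; rewrite le_eqVlt => /predU1P[->//|xy].
rewrite -(subrK x y) addrC decayD ler_piMr ?ltW ?decay_gt0// decay_lt1//.
by rewrite subr_gt0.
Qed.

Lemma geo_sum (rho : R) m N : (m <= N)%N ->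
  (1 - rho) * \sum_(m <= n < N) rho ^+ n.+1 = rho ^+ m.+1 - rho ^+ N.+1.
Proof.
elim: N => [|N IH]; first by rewrite leqn0 => /eqP ->; rewrite big_geq// mulr0 subrr.
rewrite leq_eqVlt => /predU1P[->|mN]; first by rewrite big_geq// mulr0 subrr.
by rewrite big_nat_recr//= mulrDr IH// !exprS; ring.
Qed.

(** Beyond [N] a term is the difference of two partial sums within 1 of the limit, whence the
    constant 2; the finitely many earlier terms are added to it. *)
Lemma fourier_bound h a f t : fourier h a f ->
  exists2 B : R, 0 <= B & forall n, normc (a n) * decay h (complex.Im (val t)) ^+ n.+1 <= B.
Proof.
move=> /(_ t) /cvgCP H; have [N HN] := H _ ltr01.
pose u n := normc (a n) * decay h (complex.Im (val t)) ^+ n.+1.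
have u0 n : 0 <= u n by rewrite mulr_ge0 ?normc_ge0// exprn_ge0// ltW// decay_gt0.
exists (2 + \sum_(n < N) u n); first by rewrite addr_ge0// sumr_ge0.
move=> n; rewrite -/(u n); have [nN|Nn] := ltnP n N.
  rewrite (bigD1 (Ordinal nN))//= addrCA lerDl addr_ge0// sumr_ge0//.
apply: (@le_trans _ _ 2); last by rewrite lerDl sumr_ge0.
have := HN n.+1 (leqW Nn); have := HN n Nn.
set s := series _; set l := f t => h1 h2.
have -> : u n = normc ((s n.+1 - l) + - (s n - l)).
  have -> : s n.+1 - l + - (s n - l) = s n.+1 - s n by ring.
  have -> : s n.+1 - s n = a n * qexp h (val t) ^+ n.+1.
    by rewrite /s /series /= big_nat_recr//= addrAC subrr add0r.
  by rewrite normcM normcX normc_qexp.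
by apply: le_trans (le_normcD _ _) _; rewrite normcN; lra.
Qed.

Lemma quarter_subproof : 0 < complex.Im (0 +i* (1/4) : C).
Proof. by rewrite /=; lra. Qed.

Definition quarter : uhp := exist _ (0 +i* (1/4)) quarter_subproof.

(** Convergence at the point [quarter] bounds the coefficients. From height 1/2 on, at least 1/4
    higher, the terms are dominated by a geometric series whose ratio is at most [decay h (1/4)]. *)
Lemma fourier_tail h a f m : (0 < h)%N -> fourier h a f ->
  exists2 K : R, 0 <= K & forall t, 1/2 <= complex.Im (val t) ->
    normc (f t - \sum_(0 <= n < m) a n * qexp h (val t) ^+ n.+1) <=
      K * decay h (complex.Im (val t)) ^+ m.+1.
Proof.
move=> h0 F; have [B B0 HB] := fourier_bound quarter F.
rewrite /= in HB; set r0 := decay h (1/4) in HB.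
have r00 : 0 < r0 by exact: decay_gt0.
have r01 : r0 < 1 by apply: decay_lt1 => //; lra.
exists (B / (r0 ^+ m.+1 * (1 - r0))).
  by rewrite divr_ge0// mulr_ge0 ?exprn_ge0 ?subr_ge0 ?ltW.
move=> t ht; apply: (cvgC_normc_le (F t)); exists m => N mN.
set r := decay h (complex.Im (val t)).
set rho := decay h (complex.Im (val t) - 1/4).
have rE : r = rho * r0 by rewrite -decayD subrK.
have rho0 : 0 < rho by exact: decay_gt0.
have rhor0 : rho <= r0 by apply: decay_le => //; lra.
rewrite /series /= (big_cat_nat _ mN)//= addrAC subrr add0r.
apply: le_trans (normc_sum _ _ _) _.
have le1 : \sum_(m <= i < N) normc (a i * qexp h (val t) ^+ i.+1) <=
    B * \sum_(m <= i < N) rho ^+ i.+1.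
  rewrite mulr_sumr; apply: ler_sum => n _.
  rewrite normcM normcX normc_qexp -/r rE exprMn mulrCA mulrC ler_pM2r ?exprn_gt0//.
apply: le_trans le1 _.
have [E E2] : rho ^+ m.+1 - rho ^+ N.+1 <= rho ^+ m.+1 /\ r0 < 1.
  by split=> //; rewrite gerDl oppr_le0 exprn_ge0// ltW.
rewrite -(geo_sum rho mN) in E.
have lt1 : 0 < 1 - rho by lra.
have lt2 : 0 < 1 - r0 by lra.
have -> : B / (r0 ^+ m.+1 * (1 - r0)) * r ^+ m.+1 = B * (rho ^+ m.+1 / (1 - r0)).
  by rewrite rE exprMn; field; rewrite expf_neq0 !gt_eqF.
rewrite ler_wpM2l//.
rewrite ler_pdivlMr//; apply: le_trans E; rewrite mulrC ler_wpM2r//; last by lra.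
by rewrite sumr_ge0// => i _; rewrite exprn_ge0// ltW.
Qed.

End Fourier.

Section FourierClosure.
Variable R : realType.
Local Notation C := R[i].
Local Notation uhp := (uhp R).
Implicit Types (h : nat) (a : nat -> C) (f : uhp -> C) (z : C) (t : uhp).

Lemma qexpD h z w : qexp h (z + w) = qexp h z * qexp h w.
Proof. by rewrite /qexp -cexpD; congr cexp; ring. Qed.

Lemma qexpMn h n z : qexp h (n%:R * z) = qexp h z ^+ n.
Proof. by rewrite /qexp -cexpX; congr cexp; ring. Qed.

Lemma qexp_div h d z : qexp h (z / d%:R) = qexp (h * d) z.
Proof. by rewrite /qexp natrM invfM; congr cexp; ring. Qed.

Lemma Im_affine (al de : nat) (be : R) z :
  complex.Im ((al%:R * z + be%:C) / de%:R) = al%:R * complex.Im z / de%:R.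
Proof. by rewrite !natcE realcV; case: z => u v; simpc => /=; ring. Qed.

Definition mkuhp z (z0 : 0 < complex.Im z) : uhp := exist _ z z0.

Lemma seriesSC (u : nat -> C) n : series u n.+1 = series u n + u n.
Proof. by rewrite /series /= big_nat_recr. Qed.

Lemma fourier_subst h a f (al de : nat) (be : R) (g : uhp -> C) :
  (0 < al)%N -> (0 < de)%N -> fourier h a f ->
  (forall t s : uhp, val s = (al%:R * val t + be%:C) / de%:R -> g t = f s) ->
  exists b, fourier (h * de) b g.
Proof.
move=> al0 de0 F gf.
(* Index [n] carries the exponent [n.+1]. The new parameter enters through its [al]-th power, so
   only exponents divisible by [al] occur; the shift by [be] contributes a phase. *)
pose b n := if (al %| n.+1)%N
  then a (n.+1 %/ al).-1 * qexp (h * de) be%:C ^+ (n.+1 %/ al) else 0.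
exists b => t.
have s0 : 0 < complex.Im ((al%:R * val t + be%:C) / de%:R).
  by rewrite Im_affine divr_gt0 ?mulr_gt0 ?ltr0n//; exact: (valP t).
pose s := mkuhp s0.
rewrite (gf t s)//.
have qs : qexp h (val s) = qexp (h * de) (val t) ^+ al * qexp (h * de) be%:C.
  by rewrite /= qexp_div qexpD qexpMn.
(* The inserted zeros do not change sums: the first [N] new terms amount to the first [N %/ al] old
   ones. *)
have E N : series (fun n => b n * qexp (h * de) (val t) ^+ n.+1) N =
    series (fun n => a n * qexp h (val s) ^+ n.+1) (N %/ al)%N.
  elim: N => [|N IH]; first by rewrite div0n /series /= !big_geq.
  rewrite seriesSC IH divnS// {1}/b; case: ifPn => dv; last by rewrite mul0r addr0.
  rewrite add1n seriesSC; congr (_ + _).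
  have nE : (N.+1 %/ al = (N %/ al)%N.+1)%N by rewrite divnS// dv.
  have NE : N.+1 = ((N %/ al).+1 * al)%N by rewrite -nE divnK.
  rewrite nE qs; move: (qexp _ be%:C) (qexp _ (val t)) => B Q /=.
  by rewrite exprMn -exprM [(al * _)%N]mulnC -NE -mulrA [B ^+ _ * _]mulrC.
have /cvgCP H := F s; apply/cvgCP => e /H[N HN].
exists (N * al)%N => n Nn; rewrite E HN//.
by rewrite leq_divRL.
Qed.

Lemma vanishes_subst f (g : uhp -> C) (al de : nat) (be : R) :
  (0 < al)%N -> (0 < de)%N -> vanishes_at_infty f ->
  (forall t s : uhp, val s = (al%:R * val t + be%:C) / de%:R -> g t = f s) ->
  vanishes_at_infty g.
Proof.
move=> al0 de0 /vanishesP[h [a [h0 F]]] gf; apply/vanishesP.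
have [b Fb] := fourier_subst al0 de0 F gf.
by exists (h * de)%N, b; rewrite muln_gt0 h0.
Qed.

Lemma fourier_period h a f m : (0 < m)%N -> fourier h a f ->
  exists b, fourier (h * m) b f.
Proof.
move=> m0 F; apply: (fourier_subst (be := 0) m0 m0 F) => t s.
rewrite addr0 mulrAC divff ?mul1r ?pnatr_eq0 -?lt0n// => st.
by congr f; apply: val_inj.
Qed.

Lemma vanishesD f (g : uhp -> C) : vanishes_at_infty f -> vanishes_at_infty g ->
  vanishes_at_infty (f + g).
Proof.
move=> /vanishesP[h1 [a1 [h10 F1]]] /vanishesP[h2 [a2 [h20 F2]]].
have [b1 G1] := fourier_period h20 F1; have [b2 G2] := fourier_period h10 F2.
apply/vanishesP; exists (h1 * h2)%N, (fun n => b1 n + b2 n).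
split=> [|t]; first by rewrite muln_gt0 h10.
rewrite mulnC in G2.
have /cvgCP H1 := G1 t; have /cvgCP H2 := G2 t.
apply/cvgCP => e e0; have e20 : 0 < e / 2 by rewrite divr_gt0.
have [N1 HN1] := H1 _ e20; have [N2 HN2] := H2 _ e20.
exists (maxn N1 N2) => n; rewrite geq_max => /andP[/HN1 h1n /HN2 h2n].
have -> : series (fun n => (b1 n + b2 n) * qexp (h1 * h2) (val t) ^+ n.+1) n =
   series (fun n => b1 n * qexp (h1 * h2) (val t) ^+ n.+1) n +
   series (fun n => b2 n * qexp (h1 * h2) (val t) ^+ n.+1) n.
  by rewrite /series /= -big_split; apply: eq_bigr => i _; rewrite mulrDl.
rewrite -[(f + g) t]/(f t + g t) opprD addrACA.
by apply: le_lt_trans (le_normcD _ _) _; lra.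
Qed.

Lemma vanishesZ (c : C) f : vanishes_at_infty f -> vanishes_at_infty (c *: f).
Proof.
move=> /vanishesP[h [a [h0 F]]]; apply/vanishesP; exists h, (fun n => c * a n).
split; [exact: h0 | move=> t]; have /cvgCP H := F t; apply/cvgCP => e e0.
have c0 := normc_ge0 c.
have ec0 : 0 < e / (normc c + 1) by rewrite divr_gt0//; lra.
have [N HN] := H _ ec0; exists N => n /HN hn.
have -> : series (fun n => c * a n * qexp h (val t) ^+ n.+1) n =
   c * series (fun n => a n * qexp h (val t) ^+ n.+1) n.
  by rewrite /series /= mulr_sumr; apply: eq_bigr => i _; rewrite mulrA.
rewrite -[(c *: f) t]/(c * f t) -mulrBr normcM.
rewrite ltr_pdivlMr in hn; last by lra.
apply: le_lt_trans hn; rewrite mulrC ler_wpM2l ?normc_ge0//; lra.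
Qed.

Lemma vanishes0 : vanishes_at_infty (0 : uhp -> C).
Proof.
apply/vanishesP; exists 1%N, (fun=> 0); split=> // t; apply/cvgCP => e e0.
exists 0%N => n _; rewrite /series /= big1; first by rewrite subrr normc0.
by move=> i _; rewrite mul0r.
Qed.

(** Some coefficient is nonzero, and far up the first such term dominates the sum of all later ones,
    by the tail estimate started just after it. *)
Lemma fourier_nonvanishing h a f t0 : (0 < h)%N -> fourier h a f -> f t0 != 0 ->
  exists2 Y : R, 1 <= Y & forall t, Y <= complex.Im (val t) -> f t != 0.
Proof.
move=> h0 F ft0.
have [n an] : exists n, a n != 0.
  apply: contrapT => H; move/eqP: ft0; apply.
  apply: (cvgC_unique (F t0)); apply/cvgCP => e e0; exists 0%N => n _.
  rewrite /series /= big1 ?subrr ?normc0// => i _.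
  have -> : a i = 0 by apply/eqP; apply: contrapT => /negP ai; apply: H; exists i.
  by rewrite mul0r.
have [m am mmin] := ex_minnP (ex_intro (fun n => a n != 0) n an).
have [K K0 HK] := fourier_tail m.+1 h0 F.
have A0 : 0 < normc (a m) by rewrite lt_neqAle normc_ge0 eq_sym normc_eq0 am.
have [Y Y1 HY] : exists2 Y : R, 1 <= Y & K * decay h Y < normc (a m).
  (* Since exp(x) >= 1 + x and 2 pi >= 1, [decay h Y] is below [h / Y]; this [Y] then makes
     [K * h / Y] smaller than the modulus of the leading coefficient. *)
  pose Y := 1 + K * h%:R / normc (a m).
  have hR : 0 < h%:R :> R by rewrite ltr0n.
  exists Y; first by rewrite /Y lerDl !mulr_ge0// ?invr_ge0 ltW.
  have dY : decay h Y < h%:R / Y.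
    have Y0 : 0 < Y by rewrite /Y ltr_pwDl// !mulr_ge0// ?invr_ge0 ltW.
    rewrite /decay expRN -[ltRHS]invrK ltf_pV2 ?posrE ?expR_gt0 ?invr_gt0 ?divr_gt0//.
    rewrite invf_div; apply: lt_le_trans (expR_ge1Dx _).
    have : Y / h%:R <= 2 * pi * Y / h%:R.
      rewrite ler_pM2r ?invr_gt0// ler_peMl ?(ltW Y0)//.
      by have := pi_ge2 R; lra.
    lra.
  have Y0 : 0 < Y by rewrite /Y ltr_pwDl// !mulr_ge0// ?invr_ge0 ltW.
  apply: (@le_lt_trans _ _ (K * (h%:R / Y))); first by rewrite ler_wpM2l// ltW.
  rewrite mulrA ltr_pdivrMr//.
  by rewrite /Y mulrDr mulr1 mulrCA divff ?gt_eqF// mulr1; lra.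
exists Y => // t Yt; apply/eqP => ft.
have := HK t; rewrite ft big_nat_recr//= big1_seq; last first.
  move=> i; rewrite mem_index_iota => /andP[_ /andP[_ im]].
  have [->|ai] := eqVneq (a i) 0; first by rewrite mul0r.
  by have := mmin _ ai; rewrite leqNgt im.
rewrite !add0r normcN normcM normcX normc_qexp [_ ^+ m.+2]exprS => H.
have {H} := H ltac:(lra).
rewrite mulrA ler_pM2r ?exprn_gt0 ?decay_gt0// leNgt => /negP; apply.
apply: le_lt_trans HY; rewrite ler_wpM2l//; exact: decay_le.
Qed.

End FourierClosure.

(** * Two by two matrices and the generators of SL2(Z) *)

Lemma sum_I2 (V : nmodType) (F : 'I_2 -> V) : \sum_(i < 2) F i = F 0 + F 1.
Proof.
by rewrite !big_ord_recl big_ord0 addr0; congr (F _ + F _); apply: val_inj.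
Qed.

Lemma I2P (i : 'I_2) : i = 0 \/ i = 1.
Proof. by case: i => -[|[|//]] hi; [left|right]; apply: val_inj. Qed.

Section TwoByTwo.
Variable R : comNzRingType.
Implicit Types A B : 'M[R]_2.

Lemma mx22_eta A : A = mx22 (A 0 0) (A 0 1) (A 1 0) (A 1 1).
Proof.
by apply/matrixP => i j; rewrite mxE; case: (I2P i) => ->; case: (I2P j) => ->.
Qed.

Lemma mx22E (a b c d : R) : [/\ mx22 a b c d 0 0 = a, mx22 a b c d 0 1 = b,
  mx22 a b c d 1 0 = c & mx22 a b c d 1 1 = d].
Proof. by split; rewrite mxE. Qed.

Lemma det22 A : \det A = A 0 0 * A 1 1 - A 0 1 * A 1 0.
Proof. by rewrite {1}[A]mx22_eta det_mx22. Qed.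

Lemma mulmx22 A B i j : (A *m B) i j = A i 0 * B 0 j + A i 1 * B 1 j.
Proof. by rewrite mxE sum_I2. Qed.

Lemma mul_mx22 (a b c d a' b' c' d' : R) :
  mx22 a b c d *m mx22 a' b' c' d' =
  mx22 (a * a' + b * c') (a * b' + b * d') (c * a' + d * c') (c * b' + d * d').
Proof.
by apply/matrixP => i j; rewrite mulmx22 !mxE; case: (I2P i) => ->; case: (I2P j) => ->.
Qed.

End TwoByTwo.

Lemma map_mx22 (R S : Type) (f : R -> S) (a b c d : R) :
  map_mx f (mx22 a b c d) = mx22 (f a) (f b) (f c) (f d).
Proof.
by apply/matrixP => i j; rewrite !mxE; case: (I2P i) => ->; case: (I2P j) => ->.
Qed.

Section SL2ZTheory.
Implicit Types M N : SL2Z.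

Lemma SL2Z_det M : val M 0 0 * val M 1 1 - val M 0 1 * val M 1 0 = 1.
Proof. by rewrite -det22 (eqP (valP M)). Qed.

Fact mkSL_subproof (a b c d : int) : a * d - b * c = 1 -> \det (mx22 a b c d) == 1.
Proof. by move=> h; rewrite det_mx22 h. Qed.

Definition mkSL (a b c d : int) (h : a * d - b * c = 1) : SL2Z :=
  Sub (mx22 a b c d) (mkSL_subproof h).

Lemma SL2Z_ext M N : val M 0 0 = val N 0 0 -> val M 0 1 = val N 0 1 ->
  val M 1 0 = val N 1 0 -> val M 1 1 = val N 1 1 -> M = N.
Proof.
move=> h1 h2 h3 h4; apply: val_inj.
by rewrite [val M]mx22_eta [val N]mx22_eta h1 h2 h3 h4.
Qed.

Lemma SL2Z_mulE M N i j :
  val (M * N)%g i j = val M i 0 * val N 0 j + val M i 1 * val N 1 j.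
Proof. by rewrite SL2Z_valM mulmx22. Qed.

Lemma mkSLE (a b c d : int) (h : a * d - b * c = 1) :
  [/\ val (mkSL h) 0 0 = a, val (mkSL h) 0 1 = b, val (mkSL h) 1 0 = c & val (mkSL h) 1 1 = d].
Proof. by split; rewrite /= mxE. Qed.

Lemma SL2Z_1E : [/\ val (1%g : SL2Z) 0 0 = 1, val (1%g : SL2Z) 0 1 = 0,
  val (1%g : SL2Z) 1 0 = 0 & val (1%g : SL2Z) 1 1 = 1].
Proof. by split; rewrite SL2Z_val1 mxE. Qed.

Lemma SL2Z_invE M : [/\ val M^-1%g 0 0 = val M 1 1, val M^-1%g 0 1 = - val M 0 1,
  val M^-1%g 1 0 = - val M 1 0 & val M^-1%g 1 1 = val M 0 0].
Proof.
have h : val M 1 1 * val M 0 0 - (- val M 0 1) * (- val M 1 0) = 1.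
  by apply: etrans (SL2Z_det M); ring.
suff -> : (M^-1)%g = mkSL h by exact: mkSLE.
apply: (mulgI M); rewrite mulgV; have dM := SL2Z_det M.
have [i1 i2 i3 i4] := SL2Z_1E; have [e1 e2 e3 e4] := mkSLE h.
by apply: SL2Z_ext; rewrite SL2Z_mulE ?i1 ?i2 ?i3 ?i4 ?e1 ?e2 ?e3 ?e4;
  first [ring | rewrite -[LHS]dM; ring].
Qed.

Lemma SL2Z_Tpow (n : nat) : val (SL2Z_T ^+ n)%g = mx22 1 n%:Z 0 1.
Proof.
elim: n => [|n IH].
  by rewrite expg0 SL2Z_val1 [1%:M]mx22_eta !mxE.
by rewrite expgS SL2Z_valM IH /= mul_mx22; congr mx22; rewrite ?intS; ring.
Qed.

(** Generation of SL2(Z) by S and T. This is the Euclidean algorithm on the first column, with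
    powers of T for the division and S for the exchange; it ends at a power of T up to sign. *)
Lemma SL2Z_ind (P : SL2Z -> Prop) : P 1%g ->
  (forall M, P M -> P (SL2Z_S * M)%g) -> (forall M, P M -> P (SL2Z_T * M)%g) ->
  (forall M, P M -> P (SL2Z_T^-1 * M)%g) -> forall M, P M.
Proof.
move=> P1 PS PT PV.
have PTn n M : P M -> P (SL2Z_T ^+ n * M)%g.
  by move=> PM; elim: n => [|n IH]; rewrite ?expg0 ?mul1g// expgS -mulgA; exact: PT.
have PVn n M : P M -> P ((SL2Z_T ^+ n)^-1 * M)%g.
  move=> PM; elim: n => [|n IH]; first by rewrite expg0 invg1 mul1g.
  by rewrite expgSr invgM -mulgA; exact: PV.
(* S^4 = 1, so applying S twice more undoes S^2. *)
have PN M : P (SL2Z_S * (SL2Z_S * M))%g -> P M.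
  move=> H; have := PS _ (PS _ H); rewrite !mulgA.
  suff -> : (SL2Z_S * SL2Z_S * SL2Z_S * SL2Z_S)%g = 1%g by rewrite mul1g.
  apply: val_inj; rewrite !SL2Z_valM SL2Z_val1 /= !mul_mx22 [1%:M]mx22_eta !mxE.
  by congr mx22; ring.
have SE M : [/\ val (SL2Z_S * M)%g 0 0 = - val M 1 0, val (SL2Z_S * M)%g 0 1 = - val M 1 1,
   val (SL2Z_S * M)%g 1 0 = val M 0 0 & val (SL2Z_S * M)%g 1 1 = val M 0 1].
  have [e1 e2 e3 e4] := mx22E (0 : int) (-1) 1 0.
  by split; rewrite SL2Z_mulE ?e1 ?e2 ?e3 ?e4; ring.
have PSi M : P (SL2Z_S * M)%g -> P M by move=> /PS H; exact: PN.
have TE n M : [/\ val (SL2Z_T ^+ n * M)%g 0 0 = val M 0 0 + n%:Z * val M 1 0,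
   val (SL2Z_T ^+ n * M)%g 0 1 = val M 0 1 + n%:Z * val M 1 1,
   val (SL2Z_T ^+ n * M)%g 1 0 = val M 1 0 & val (SL2Z_T ^+ n * M)%g 1 1 = val M 1 1].
  have [e1 e2 e3 e4] := mx22E (1 : int) n%:Z 0 1.
  by split; rewrite SL2Z_valM SL2Z_Tpow mulmx22 ?e1 ?e2 ?e3 ?e4; ring.
(* The quotient of a division may have either sign, so both T and its inverse are iterated. *)
have PTz (q : int) : exists U : SL2Z, (forall M, P (U * M)%g -> P M) /\
   (forall M, val (U * M)%g 0 0 = val M 0 0 + q * val M 1 0 /\ val (U * M)%g 1 0 = val M 1 0).
  case: q => q.
    exists (SL2Z_T ^+ q)%g; split => M; last by have [-> _ -> _] := TE q M.
    by move/(PVn q); rewrite mulKg.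
  exists ((SL2Z_T ^+ q.+1)^-1)%g; split=> M; first by move/(PTn q.+1); rewrite mulVKg.
  have := TE q.+1 ((SL2Z_T ^+ q.+1)^-1 * M)%g; rewrite mulVKg => -[e1 _ e2 _].
  by rewrite -e2; split=> //; rewrite e1 NegzE e2; ring.
have base M : val M 1 0 = 0 -> val M 0 0 = 1 -> P M.
  move=> c0 a1; have [i1 i2 i3 i4] := SL2Z_1E.
  have d1 : val M 1 1 = 1 by apply: etrans (SL2Z_det M); rewrite c0 a1; ring.
  case E : (val M 0 1) => [b|b].
    have -> : M = (SL2Z_T ^+ b * 1)%g; last exact: PTn.
    have [t1 t2 t3 t4] := TE b 1%g.
    by apply: SL2Z_ext; rewrite ?t1 ?t2 ?t3 ?t4 ?c0 ?a1 ?d1 ?E ?i1 ?i2 ?i3 ?i4; ring.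
  have -> : M = ((SL2Z_T ^+ b.+1)^-1 * 1)%g; last exact: PVn.
  apply: (mulgI (SL2Z_T ^+ b.+1)%g); rewrite mulVKg.
  have [t1 t2 t3 t4] := TE b.+1 M.
  by apply: SL2Z_ext; rewrite ?t1 ?t2 ?t3 ?t4 ?c0 ?a1 ?d1 ?E ?NegzE ?i1 ?i2 ?i3 ?i4; ring.
move=> M; have [n] := ubnP (absz (val M 1 0)).
elim: n M => // n IH M; rewrite ltnS => Mn.
have [c0|c0] := eqVneq (val M 1 0) 0.
  have ad : val M 0 0 * val M 1 1 = 1 by apply: etrans (SL2Z_det M); rewrite c0; ring.
  have [a1|a1] : val M 0 0 = 1 \/ val M 0 0 = -1.
    have /eqP := congr1 absz ad; rewrite abszM muln_eq1 => /andP[+ _].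
    by case: (val M 0 0) => [m|m] /= /eqP => [->|[->]]; [left|right].
    exact: base.
  (* Here the upper left entry is -1; multiplication by S^2 = -I makes it 1. *)
  apply: PN; have [s1 _ s3 _] := SE (SL2Z_S * M)%g; have [s1' _ s3' _] := SE M.
  by apply: base; [rewrite s3 s1' c0 oppr0 | rewrite s1 s3' a1 opprK].
have [U [PU UE]] := PTz (- divz (val M 0 0) (val M 1 0)).
apply: PU; apply: PSi; apply: IH.
have [_ _ -> _] := SE (U * M)%g; have [-> _] := UE M.
apply: leq_trans Mn.
have -> : val M 0 0 + - divz (val M 0 0) (val M 1 0) * val M 1 0 = modz (val M 0 0) (val M 1 0).
  by rewrite {1}(divz_eq (val M 0 0) (val M 1 0)); ring.
rewrite -ltz_nat gez0_abs ?modz_ge0// abszE.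
exact: ltz_mod.
Qed.

End SL2ZTheory.

(** * Slash operators *)

Section Slash.
Variable R : realType.
Local Notation C := R[i].
Local Notation uhp := (uhp R).
Implicit Types (f g : uhp -> C) (t : uhp) (A B : 'M[R]_2) (M N : SL2Z) (k : nat).

Lemma uhp_Im t : 0 < complex.Im (val t).
Proof. exact: (valP t). Qed.

Lemma ext_val f t : ext f (val t) = f t.
Proof. by rewrite /ext valK. Qed.

Lemma ext_mkuhp f (z : C) (z0 : 0 < complex.Im z) : ext f z = f (mkuhp z0).
Proof. by rewrite -ext_val. Qed.

Lemma ext_out f (z : C) : complex.Im z <= 0 -> ext f z = 0.
Proof. by move=> z0; rewrite /ext insubN// -leNgt. Qed.

Definition act A t : uhp := insubd t (moebius A (val t)).

Lemma val_act A t : 0 < \det A -> val (act A t) = moebius A (val t).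
Proof. by move=> dA; rewrite /act insubdK//; apply: Im_moebius. Qed.

Lemma ext_moebius f A t : 0 < \det A -> ext f (moebius A (val t)) = f (act A t).
Proof. by move=> dA; rewrite -val_act// ext_val. Qed.

Definition jfac A (z : C) : C := (A 1 0)%:C * z + (A 1 1)%:C.

Lemma jfac_neq0 A t : 0 < \det A -> jfac A (val t) != 0.
Proof.
rewrite det22 => dA; apply/eqP => /(f_equal (fun z : C => (complex.Re z, complex.Im z))).
rewrite /jfac realcM; have := uhp_Im t; case: (val t) => x y /= y0 [].
rewrite addr0 => h1 /eqP; rewrite mulf_eq0 (gt_eqF y0) orbF => /eqP c0.
move: h1; rewrite c0 mul0r add0r => d0.
by move: dA; rewrite c0 d0 !mulr0 subrr ltxx.
Qed.

(* The slash operator without its determinant factor. *)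
Definition pslash k A f : uhp -> C := fun t => (jfac A (val t)) ^- k * f (act A t).

Lemma slashE k A f : \det A = 1 -> slash k A f = pslash k A f.
Proof.
move=> dA; apply/funext => t; rewrite /slash dA powR1 mul1r.
by rewrite ext_moebius ?dA.
Qed.

Lemma moebiusM A B t : 0 < \det A -> 0 < \det B ->
  moebius (A *m B) (val t) = moebius A (moebius B (val t)) /\
  jfac (A *m B) (val t) = jfac A (moebius B (val t)) * jfac B (val t).
Proof.
move=> dA dB; have jB := jfac_neq0 t dB.
have jA : jfac A (moebius B (val t)) != 0 by rewrite -val_act// jfac_neq0.
have jE : jfac (A *m B) (val t) = jfac A (moebius B (val t)) * jfac B (val t).
  rewrite /moebius -/(jfac B _) {1 2}/jfac mulrDl -!mulrA mulVf// mulr1.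
  by rewrite /jfac !mulmx22 !rmorphD !rmorphM /=; ring.
split=> //; rewrite {1}/moebius -/(jfac _ _) jE [in RHS]/moebius -/(jfac A _).
apply: (mulIf jB); apply: (mulIf jA).
rewrite -mulrA [jfac B _ * _]mulrC divfK ?mulf_neq0//.
rewrite [RHS]mulrAC divfK//.
rewrite /moebius -/(jfac B _) mulrDl -!mulrA mulVf// mulr1.
by rewrite /jfac !mulmx22 !rmorphD !rmorphM /=; ring.
Qed.

Lemma actM A B t : 0 < \det A -> 0 < \det B -> act (A *m B) t = act A (act B t).
Proof.
move=> dA dB; apply: val_inj; rewrite !val_act ?det_mulmx ?mulr_gt0//.
by have [-> _] := moebiusM t dA dB.
Qed.

Lemma pslashM k A B f : 0 < \det A -> 0 < \det B ->
  pslash k (A *m B) f = pslash k B (pslash k A f).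
Proof.
move=> dA dB; apply/funext => t; rewrite /pslash actM//.
have [_ ->] := moebiusM t dA dB.
by rewrite val_act// exprMn invfM mulrA [_^-1 * _^-1]mulrC.
Qed.

Lemma pslash_lin k A (c : C) f g : pslash k A (c *: f + g) = c *: pslash k A f + pslash k A g.
Proof.
apply/funext => t; rewrite /pslash.
rewrite -[(c *: f + g) _]/(c * f _ + g _).
rewrite -[RHS]/(c * (jfac A (val t) ^- k * f (act A t)) + jfac A (val t) ^- k * g (act A t)).
by ring.
Qed.

Lemma pslash1 k f : pslash k (1%:M : 'M[R]_2) f = f.
Proof.
apply/funext => t; have e : act 1%:M t = t.
  apply: val_inj; rewrite val_act ?det1//.
  by rewrite /moebius !mxE /= mul1r mul0r addr0 add0r divr1.
by rewrite /pslash e /jfac !mxE /= mul0r add0r expr1n invr1 mul1r.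
Qed.

Lemma act_upper (al be de : R) t : 0 < al -> 0 < de ->
  val (act (mx22 al be 0 de) t) = (al%:C * val t + be%:C) / de%:C.
Proof.
move=> a0 d0; rewrite val_act; last by rewrite det_mx22 mulr0 subr0 mulr_gt0.
by rewrite /moebius !mxE /= mul0r add0r.
Qed.

Lemma jfac_upper (al be de : R) z : jfac (mx22 al be 0 de) z = de%:C.
Proof. by rewrite /jfac !mxE /= mul0r add0r. Qed.

Lemma realmxM M N : realmx R (M * N)%g = realmx R M *m realmx R N.
Proof. by rewrite /realmx SL2Z_valM map_mxM. Qed.

Lemma realmx1 : realmx R 1%g = 1%:M.
Proof. by rewrite /realmx SL2Z_val1 map_mx1. Qed.

Lemma det_realmx M : \det (realmx R M) = 1.
Proof. by rewrite /realmx det_map_mx (eqP (valP M)). Qed.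

Lemma det_realmx_gt0 M : 0 < \det (realmx R M).
Proof. by rewrite det_realmx. Qed.

Definition sl k M f := pslash k (realmx R M) f.

Lemma slashSL k M f : slash k (realmx R M) f = sl k M f.
Proof. by rewrite slashE// det_realmx. Qed.

Lemma slM k M N f : sl k (M * N)%g f = sl k N (sl k M f).
Proof. by rewrite /sl realmxM pslashM// det_realmx_gt0. Qed.

Lemma sl1 k f : sl k 1%g f = f.
Proof. by rewrite /sl realmx1 pslash1. Qed.

Lemma sl_lin k M (c : C) f g : sl k M (c *: f + g) = c *: sl k M f + sl k M g.
Proof. exact: pslash_lin. Qed.

Lemma slD k M f g : sl k M (f + g) = sl k M f + sl k M g.
Proof. by have := sl_lin k M 1 f g; rewrite !scale1r. Qed.

Lemma sl0 k M : sl k M 0 = 0.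
Proof. by apply/funext => t; rewrite /sl /pslash mulr0. Qed.

Lemma slZ k M (c : C) f : sl k M (c *: f) = c *: sl k M f.
Proof. by have := sl_lin k M c f 0; rewrite sl0 !addr0. Qed.

Lemma slN k M f : sl k M (- f) = - sl k M f.
Proof. by rewrite -scaleN1r slZ scaleN1r. Qed.

Definition cuspidal k f := forall M, vanishes_at_infty (sl k M f).

Lemma cuspidal_lin k (c : C) f g : cuspidal k f -> cuspidal k g -> cuspidal k (c *: f + g).
Proof. by move=> cf cg M; rewrite sl_lin; apply: vanishesD => //; exact: vanishesZ. Qed.

Lemma cuspidal0 k : cuspidal k 0.
Proof. by move=> M; rewrite sl0; exact: vanishes0. Qed.

Lemma cuspidalZ k (c : C) f : cuspidal k f -> cuspidal k (c *: f).
Proof. by move=> cf; rewrite -[c *: f]addr0; apply: cuspidal_lin; [exact: cf|exact: cuspidal0]. Qed.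

Lemma cuspidalD k f g : cuspidal k f -> cuspidal k g -> cuspidal k (f + g).
Proof. by move=> cf cg; rewrite -[f]scale1r; apply: cuspidal_lin; [exact: cf|exact: cg]. Qed.

Lemma cuspidal_sl k M f : cuspidal k f -> cuspidal k (sl k M f).
Proof. by move=> cf N; rewrite -slM. Qed.

(* Elementary divisors in dimension 2: a positive determinant integer matrix
   is upper triangular up to left multiplication by [SL2(Z)]. *)
Lemma SL2Z_upper (A : 'M[int]_2) : 0 < \det A ->
  exists M (al de : nat) (be : int), [/\ (0 < al)%N, (0 < de)%N &
    A = val M *m mx22 al%:Z be 0 de%:Z].
Proof.
rewrite det22; set p := A 0 0; set q := A 0 1; set r := A 1 0; set s := A 1 1 => dA.
(* The first column of [A] is its greatest common divisor times a primitive vector, and the Bezout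
   coefficients complete that vector to a matrix of determinant 1. *)
have [u [v uv]] : exists u v : int, u * p + v * r = gcdz p r by case: (Bezoutz p r) => u [v uv]; exists u, v.
have e0 : 0 < gcdz p r.
  rewrite lt_neqAle; apply/andP; split; last by [].
  rewrite eq_sym gcdz_eq0; apply/negP => /andP[/eqP p0 /eqP r0].
  by move: dA; rewrite p0 r0 mul0r mulr0 subrr ltxx.
have /dvdzP[p' pE] : (gcdz p r %| p)%Z by exact: dvdz_gcdl.
have /dvdzP[r' rE] : (gcdz p r %| r)%Z by exact: dvdz_gcdr.
have [e eE] : exists e : nat, gcdz p r = e%:Z by exists `|gcdz p r|%N; rewrite gez0_abs// ltW.
rewrite eE in uv pE rE e0.
have uv1 : p' * u - (- v) * r' = 1.
  apply: (mulIf (x := e%:Z)); first by rewrite gt_eqF.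
  by rewrite mul1r -[RHS]uv pE rE; ring.
pose M := mkSL uv1; pose de := - r' * q + p' * s.
have de0 : 0 < de.
  have : 0 < e%:Z * de.
    by have -> : e%:Z * de = p * s - q * r by rewrite /de pE rE; ring.
  by rewrite pmulr_rgt0.
exists M, e, `|de|%N, (u * q + v * s); split.
- by rewrite -ltz_nat.
- by rewrite absz_gt0 gt_eqF.
rewrite gez0_abs ?ltW//= mul_mx22 [LHS]mx22_eta -/p -/q -/r -/s.
congr mx22; rewrite /de.
- by rewrite pE; ring.
- by rewrite -[LHS]mul1r -uv1; ring.
- by rewrite rE; ring.
- by rewrite -[LHS]mul1r -uv1; ring.
Qed.

(** Write A M = N U with N in SL2(Z) and U upper triangular. The expansion of f|A at the cusp of M
    is then the one of [f] at the cusp of N, under an affine substitution. *)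
Lemma cuspidal_pslash k (A : 'M[int]_2) f : 0 < \det A -> cuspidal k f ->
  cuspidal k (pslash k (map_mx intr A) f).
Proof.
move=> dA cf M.
have dAM : 0 < \det (A *m val M) by rewrite det_mulmx (eqP (valP M)) mulr1.
have [N [al [de [be [al0 de0 E]]]]] := SL2Z_upper dAM.
have alR : 0 < al%:R :> R by rewrite ltr0n.
have deR : 0 < de%:R :> R by rewrite ltr0n.
have dU : 0 < \det (mx22 (al%:R : R) be%:~R 0 de%:R).
  by rewrite det_mx22 mulr0 subr0 mulr_gt0.
have -> : sl k M (pslash k (map_mx intr A) f) =
    pslash k (mx22 al%:R be%:~R 0 de%:R) (sl k N f).
  rewrite /sl -!pslashM ?det_realmx_gt0 ?det_map_mx ?ltr0z//; congr (pslash k _ f).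
  by rewrite /realmx -map_mxM E map_mxM map_mx22.
have -> : pslash k (mx22 al%:R be%:~R 0 de%:R) (sl k N f) =
    ((de%:R%:C) ^- k : C) *: (fun t => sl k N f (act (mx22 al%:R be%:~R 0 de%:R) t)).
  by apply/funext => t; rewrite /pslash jfac_upper.
apply: vanishesZ; apply: (vanishes_subst (be := be%:~R) al0 de0 (cf N)) => t s st.
congr (sl k N f _); apply: val_inj; rewrite act_upper// st.
by rewrite !natcE.
Qed.

End Slash.

(** * The Petersson product *)

Section MeasurableComplex.
Variable R : realType.
Local Notation C := R[i].
Context d (T : measurableType d).
Implicit Types u v : T -> C.

Definition mC u := measurable_fun setT (fun x => complex.Re (u x)) /\
  measurable_fun setT (fun x => complex.Im (u x)).

Lemma mC_cst (c : C) : mC (fun=> c).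
Proof. by split; exact: measurable_cst. Qed.

Lemma mCD u v : mC u -> mC v -> mC (fun x => u x + v x).
Proof.
move=> [ur ui] [vr vi]; split.
- rewrite (_ : (fun _ => _) = (fun x => complex.Re (u x) + complex.Re (v x))).
    exact: measurable_funD.
  by apply/funext => x; case: (u x) (v x) => [a b] [c e].
- rewrite (_ : (fun _ => _) = (fun x => complex.Im (u x) + complex.Im (v x))).
    exact: measurable_funD.
  by apply/funext => x; case: (u x) (v x) => [a b] [c e].
Qed.

Lemma mCM u v : mC u -> mC v -> mC (fun x => u x * v x).
Proof.
move=> [ur ui] [vr vi]; split.
- rewrite (_ : (fun _ => _) = (fun x => complex.Re (u x) * complex.Re (v x) -
     complex.Im (u x) * complex.Im (v x))).
    by apply: measurable_funB; exact: measurable_funM.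
  by apply/funext => x; case: (u x) (v x) => [a b] [c e].
- rewrite (_ : (fun _ => _) = (fun x => complex.Re (u x) * complex.Im (v x) +
     complex.Im (u x) * complex.Re (v x))).
    by apply: measurable_funD; exact: measurable_funM.
  by apply/funext => x; case: (u x) (v x) => [a b] [c e].
Qed.

Lemma mC_conj u : mC u -> mC (fun x => (u x)^*).
Proof.
move=> [ur ui]; split.
- rewrite (_ : (fun _ => _) = (fun x => complex.Re (u x)))//.
  by apply/funext => x; case: (u x).
- rewrite (_ : (fun _ => _) = (fun x => - complex.Im (u x))).
    exact: measurable_funN.
  by apply/funext => x; case: (u x).
Qed.

Lemma mCX u n : mC u -> mC (fun x => u x ^+ n).
Proof.
move=> mu; elim: n => [|n IH]; first by under eq_fun do rewrite expr0; exact: mC_cst.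
by under eq_fun do rewrite exprS; exact: mCM.
Qed.

Lemma mC_real (u : T -> R) : measurable_fun setT u -> mC (fun x => (u x)%:C).
Proof. by move=> mu; split => //=; exact: measurable_cst. Qed.

Lemma mC_sum n (u : nat -> T -> C) : (forall i, mC (u i)) ->
  mC (fun x => \sum_(0 <= i < n) u i x).
Proof.
move=> mu; elim: n => [|n IH].
  by under eq_fun do rewrite big_geq//; exact: mC_cst.
by under eq_fun do rewrite big_nat_recr//=; exact: mCD.
Qed.

Lemma mC_cexp u : mC u -> mC (fun x => cexp (u x)).
Proof.
move=> [ur ui]; apply: mCM.
- by apply: mC_real; apply: measurableT_comp => //; exact: measurable_expR.
- split=> /=; apply: measurableT_comp => //.
  + by apply: continuous_measurable_fun; exact: continuous_cos.
  + by apply: continuous_measurable_fun; exact: continuous_sin.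
Qed.

Lemma mC_normc u : mC u -> measurable_fun setT (fun x => normc (u x) ^+ 2).
Proof.
move=> [ur ui]; under eq_fun do rewrite sqr_normc_ReIm.
by apply: measurable_funD; exact: measurable_funX.
Qed.

End MeasurableComplex.

Section CuspIntegrability.
Variable R : realType.
Local Notation C := R[i].
Local Notation uhp := (uhp R).
Local Notation mu := (@lebesgue_measure R).
Local Notation mu2 := (product_measure1 mu mu).
Implicit Types (F G : uhp -> C) (p : R * R).

Definition pt p : C := p.1 +i* p.2.

Definition fe F p : C := ext F (pt p).

Lemma mC_pt : mC (T := (R * R)%type) pt.
Proof. by split; [exact: measurable_fst|exact: measurable_snd]. Qed.

Lemma fe_in F p (y0 : 0 < p.2) : fe F p = F (mkuhp (y0 : 0 < complex.Im (pt p))).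
Proof. by rewrite /fe ext_mkuhp. Qed.

Lemma fe_out F p : p.2 <= 0 -> fe F p = 0.
Proof. by move=> y0; rewrite /fe ext_out. Qed.

(** The partial sums of the Fourier expansion are measurable and converge pointwise; they are cut
    off to 0 below the real axis in order to agree with [ext]. *)
Lemma mC_fe F : vanishes_at_infty F -> mC (T := (R * R)%type) (fe F).
Proof.
move=> /vanishesP[h [a [h0 FF]]].
pose u n p := series (fun n => a n * qexp h (pt p) ^+ n.+1) n.
have mu n : mC (T := (R * R)%type) (u n).
  apply: mC_sum => i; apply: mCM; first exact: mC_cst.
  apply: mCX; apply: mC_cexp; apply: mCM; last exact: mC_cst.
  by apply: mCM; [exact: mC_cst|exact: mC_pt].
pose v n p := if 0 < p.2 then u n p else 0.
have vcvg p : (v ^~ p : nat -> C^o) @ \oo --> (fe F p : C^o).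
  have [y0|y0] := ltP 0 p.2.
    pose t := mkuhp (y0 : 0 < complex.Im (pt p)).
    have -> : fe F p = F t by exact: fe_in.
    have := FF t; rewrite [val t]/(pt p).
    suff -> : v ^~ p = series (fun n => a n * qexp h (pt p) ^+ n.+1) by [].
    by apply/funext => n; rewrite /v y0 /u.
  rewrite fe_out// (_ : (v ^~ p) = (fun=> 0)); last first.
    by apply/funext => n; rewrite /v ltNge y0.
  by apply/cvgCP => e e0; exists 0%N => n _; rewrite subrr normc0.
have mpos : measurable_fun setT (fun p : R * R => 0 < p.2).
  by apply: measurable_fun_ltr => //; exact: measurable_snd.
split.
- apply: (measurable_fun_cvg (h := fun n p => complex.Re (v n p))).
    move=> n; rewrite (_ : (fun _ => _) = (fun p => if 0 < p.2 then complex.Re (u n p) else 0)).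
      by apply: measurable_fun_ifT => //; case: (mu n).
    by apply/funext => p; rewrite /v; case: ifP.
  by move=> p _; exact: cvgC_Re.
- apply: (measurable_fun_cvg (h := fun n p => complex.Im (v n p))).
    move=> n; rewrite (_ : (fun _ => _) = (fun p => if 0 < p.2 then complex.Im (u n p) else 0)).
      by apply: measurable_fun_ifT => //; case: (mu n).
    by apply/funext => p; rewrite /v; case: ifP.
  by move=> p _; exact: cvgC_Im.
Qed.

Lemma fund_domainE : @fund_domain R = [set p | Fd p].
Proof.
apply/seteqP; split=> p; rewrite /fund_domain /Fd /sqnorm /=.
  by move=> [-> -> ->].
by move=> /and3P[? ? ?].
Qed.

Lemma measurable_fund_domain : measurable (@fund_domain R).
Proof.
rewrite fund_domainE (_ : [set p | Fd p] = setT `&` (@Fd R) @^-1` [set true]).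
  exact: measurable_Fd.
by rewrite setTI.
Qed.

(** The sharp bound is sqrt(3)/2; 1/2 is the height from which the Fourier tail is controlled. *)
Lemma fund_half p : fund_domain p -> 1/2 <= p.2.
Proof.
case=> h1 h2 h3; rewrite leNgt; apply/negP => h4.
have : p.1 ^+ 2 <= 1/4.
  rewrite -real_normK ?num_real//; have := normr_ge0 p.1; nra.
nra.
Qed.

(** Write exp(x) as the (k+1)-st power of exp(x / (k+1)); bound k of these factors below by x /
    (k+1) and the remaining one by 1. *)
Lemma pow_expR_bound (c : R) k : 0 < c ->
  exists2 K : R, 0 <= K & forall y, 0 <= y -> y ^+ k * expR (- (c * y)) <= K.
Proof.
move=> c0; exists ((k.+1%:R / c) ^+ k); first by rewrite exprn_ge0// divr_ge0// ltW.
move=> y y0; have k0 : 0 < k.+1%:R :> R by rewrite ltr0n.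
rewrite expRN ler_pdivrMr ?expR_gt0//.
have le1 : (c * y / k.+1%:R) ^+ k <= expR (c * y).
  have -> : expR (c * y) = expR (c * y / k.+1%:R) ^+ k.+1.
    rewrite -expRM_natl; congr expR; rewrite [RHS]mulrC divfK// gt_eqF.
  have a0 : 0 <= c * y / k.+1%:R by rewrite divr_ge0// mulr_ge0// ltW.
  apply: (@le_trans _ _ (expR (c * y / k.+1%:R) ^+ k)).
    rewrite lerXn2r ?nnegrE ?expR_ge0//.
    by apply: le_trans (expR_ge1Dx _); rewrite lerDr.
  by rewrite exprS ler_peMl ?exprn_ge0 ?expR_ge0// -[leLHS]expR0 ler_expR.
have -> : y ^+ k = (k.+1%:R / c) ^+ k * (c * y / k.+1%:R) ^+ k.
  by rewrite -exprMn; congr (_ ^+ _); move: k0; move: (k.+1%:R) => m m0; field; rewrite !gt_eqF.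
by rewrite ler_wpM2l// exprn_ge0// divr_ge0// ltW.
Qed.

Lemma vanishes_decay F : vanishes_at_infty F -> exists2 c : R, 0 < c &
  exists2 K : R, 0 <= K & forall p, 1/2 <= p.2 -> normc (fe F p) <= K * expR (- (c * p.2)).
Proof.
move=> /vanishesP[h [a [h0 FF]]]; exists (2 * pi / h%:R).
  by rewrite divr_gt0 ?mulr_gt0 ?pi_gt0 ?ltr0n.
have [K K0 HK] := fourier_tail 0 h0 FF; exists K => // p p2.
have y0 : 0 < p.2 by apply: lt_le_trans p2.
have := HK (mkuhp (y0 : 0 < complex.Im (pt p))) p2.
by rewrite big_geq// subr0 fe_in expr1 /decay /= mulrAC.
Qed.

End CuspIntegrability.

Section ComplexIntegral.
Variable R : realType.
Local Notation C := R[i].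
Context d (T : measurableType d) (mu : {measure set T -> \bar R}) (D : set T).
Hypothesis mD : measurable D.
Implicit Types u v : T -> C.

Definition cintegrable u := mu.-integrable D (fun x => (complex.Re (u x))%:E) /\
  mu.-integrable D (fun x => (complex.Im (u x))%:E).

Lemma cintegral_lin (c : C) u v : cintegrable u -> cintegrable v ->
  cintegral mu D (fun x => c * u x + v x) = c * cintegral mu D u + cintegral mu D v.
Proof.
move=> [ur ui] [vr vi]; case: c => a b; rewrite /cintegral.
have Z f (r : R) : mu.-integrable D (fun x => (f x)%:E) ->
    mu.-integrable D (EFin \o (fun x => r * f x)).
  by move=> fi; exact: (integrableZl mD r fi).
have ReE x : complex.Re ((a +i* b) * u x + v x) =
    a * complex.Re (u x) + ((- b) * complex.Im (u x) + complex.Re (v x)).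
  by case: (u x) (v x) => [p q] [r s] /=; ring.
have ImE x : complex.Im ((a +i* b) * u x + v x) =
    a * complex.Im (u x) + (b * complex.Re (u x) + complex.Im (v x)).
  by case: (u x) (v x) => [p q] [r s] /=; ring.
under eq_Rintegral do rewrite ReE.
under [X in _ +i* X = _]eq_Rintegral do rewrite ImE.
have S f g : mu.-integrable D (EFin \o f) -> mu.-integrable D (EFin \o g) ->
    mu.-integrable D (EFin \o (fun x => f x + g x)).
  by move=> fi gi; exact: (integrableD mD fi gi).
rewrite !RintegralD//; try by [apply: Z | apply: S => //; apply: Z].
by rewrite !RintegralZl//; simpc; congr (_ +i* _); ring.
Qed.

Lemma cintegral_conj u : cintegrable u ->
  cintegral mu D (fun x => (u x)^*) = (cintegral mu D u)^*.
Proof.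
move=> [ur ui]; rewrite /cintegral /=; congr (_ +i* _).
  by apply: eq_Rintegral => x _; case: (u x).
rewrite -mulN1r -RintegralZl//.
by apply: eq_Rintegral => x _; case: (u x) => p q /=; rewrite mulN1r.
Qed.

End ComplexIntegral.

Section PeterssonPiece.
Variables (R : realType) (k : nat).
Local Notation C := R[i].
Local Notation uhp := (uhp R).
Local Notation mu := (@lebesgue_measure R).
Local Notation mu2 := (product_measure1 mu mu).
Implicit Types (F G : uhp -> C) (p : R * R).

(** Under y -> 1 / y the integral of dy / y^2 over y >= 1/2 becomes the length of []0, 2]]. *)
Lemma integral_inv_sqr :
  (\int[mu]_y (haar y * (if 1/2 <= y then y^-1 else 0))%:E = 2%:E)%E.
Proof.
rewrite (@haar_integral_inv _ 1 _ ltr01); last 2 first.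
- apply: measurable_fun_ifT => //; first exact: measurable_fun_ler.
  exact: measurable_invr.
- by move=> x; case: ifP => // h; rewrite invr_ge0; lra.
transitivity (\int[mu]_y (\1_(`]0, 2]) y)%:E)%E.
  apply: eq_integral => y _; congr (_%:E); rewrite indicE /haar.
  have [yI|/negP yI] := boolP (y \in `]0, 2]%classic).
    move: yI; rewrite inE/= in_itv/= => /andP[y0 y2]; rewrite y0 mul1r ifT.
      by rewrite div1r invrK mulVf// gt_eqF.
    by rewrite !div1r lef_pV2 ?posrE.
  move: yI; rewrite inE/= in_itv/= => /negP; rewrite negb_and -leNgt -ltNge => /orP[y0|y2].
    by rewrite ltNge y0 mul0r.
  rewrite [X in _ * X]ifF ?mulr0//; apply/negbTE.
  rewrite -ltNge !div1r ltf_pV2 ?posrE//; lra.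
rewrite integral_indic//= setIT lebesgue_measure_itv/= lte_fin ltr0n.
by rewrite -EFinB subr0.
Qed.

Lemma integrable_inv_sqr : mu2.-integrable (@fund_domain R) (fun p => (p.2 ^- 2)%:E).
Proof.
have mFD := @measurable_fund_domain R.
have my2 : measurable_fun setT (fun p : R * R => p.2 ^- 2).
  by apply: measurable_funV; apply: measurable_funX; exact: measurable_snd.
apply/integrableP; split.
  by apply: measurable_funTS; exact/measurable_EFinP.
(* A majorant of product form: the fundamental domain lies in |x| <= 1, y >= 1/2. *)
pose g p := (\1_(`[-1, 1]) p.1 : R) * (haar p.2 * (if 1/2 <= p.2 then p.2^-1 else 0)).
have g2 (y : R) : 0 <= haar y * (if 1/2 <= y then y^-1 else 0).
  by rewrite mulr_ge0 ?haar_ge0//; case: ifP => // h; rewrite invr_ge0; lra.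
have m2 : measurable_fun setT (fun y : R => haar y * (if 1/2 <= y then y^-1 else 0)).
  apply: measurable_funM; first exact: measurable_haar.
  apply: measurable_fun_ifT => //; first exact: measurable_fun_ler.
  exact: measurable_invr.
have mg : measurable_fun setT (fun p => (g p)%:E).
  apply/measurable_EFinP/measurable_funM.
    have m1 : measurable_fun setT (\1_(`[-1, 1]) : R -> R) by exact: measurable_indic.
    by apply: (measurableT_comp m1); exact: measurable_fst.
  by apply: (measurableT_comp m2); exact: measurable_snd.
have g0 p : (0 <= (g p)%:E)%E by rewrite lee_fin mulr_ge0 ?g2// indicE.
apply: (@le_lt_trans _ _ (\int[mu2]_p (g p)%:E)%E).
  apply: (@le_trans _ _ (\int[mu2]_(p in @fund_domain R) (g p)%:E)%E); last first.
    exact: ge0_subset_integral.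
  apply: ge0_le_integral => //.
  - by apply: measurable_funTS; apply: measurableT_comp => //; exact/measurable_EFinP.
  - exact: measurable_funTS.
  move=> p pF; have y2 := fund_half pF; case: pF => x1 y0 _.
  rewrite abse_EFin lee_fin /g indicE mem_set/= ?in_itv/=; last first.
    by rewrite -ler_norml; lra.
  rewrite y2 mul1r /haar y0 ger0_norm ?invr_ge0 ?exprn_ge0 ?(ltW y0)//.
  by rewrite expr2 invfM.
rewrite [ltLHS]fubini_tonelli1; [|exact: mg|exact: g0]; rewrite /fubini_F /g /=.
under eq_integral => x _.
  under eq_integral do rewrite EFinM.
  rewrite ge0_integralZl_EFin; [|by []|by move=> y _; rewrite lee_fin|
    exact/measurable_EFinP|by rewrite indicE].
  rewrite integral_inv_sqr muleC.
  over.
rewrite ge0_integralZl; [|by []|by apply/measurable_EFinP; exact: measurable_indic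
  |by move=> x _; rewrite lee_fin indicE|by []].
rewrite integral_indic//= setIT lebesgue_measure_itv/= lte_fin.
by case: ifP => _; rewrite ?mule0 ?ltry// -EFinB -EFinM ltry.
Qed.

Definition W F G p : C := fe F p * (fe G p)^* * (p.2 ^+ k)%:C * (p.2 ^- 2)%:C.

Lemma mC_W F G : vanishes_at_infty F -> vanishes_at_infty G ->
  mC (T := (R * R)%type) (W F G).
Proof.
move=> vF vG; apply: mCM; last first.
  by apply: mC_real; apply: measurable_funV; apply: measurable_funX; exact: measurable_snd.
apply: mCM; last first.
  by apply: mC_real; apply: measurable_funX; exact: measurable_snd.
by apply: mCM; [exact: mC_fe|apply: mC_conj; exact: mC_fe].
Qed.

Lemma normc_conj (z : C) : normc z^* = normc z.
Proof. by case: z => a b /=; rewrite sqrrN. Qed.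

(** The exponential decay of one form absorbs the power y^k, while the other form is merely bounded.
    Only the integrable y^-2 is left. *)
Lemma W_bound F G : vanishes_at_infty F -> vanishes_at_infty G ->
  exists2 K : R, 0 <= K & forall p, fund_domain p -> normc (W F G p) <= K * p.2 ^- 2.
Proof.
move=> /vanishes_decay[c c0 [K K0 HF]] /vanishes_decay[c' c'0 [K' K'0 HG]].
have [L L0 HL] := pow_expR_bound k c0.
exists (K * K' * L); first by rewrite !mulr_ge0.
move=> p pF; have y2 := fund_half pF; have y0 : 0 < p.2 by case: pF.
rewrite /W !normcM !normc_real normc_conj.
rewrite !ger0_norm ?invr_ge0 ?exprn_ge0 ?(ltW y0)//.
rewrite ler_wpM2r ?invr_ge0 ?exprn_ge0 ?(ltW y0)//.
apply: (@le_trans _ _ ((K * expR (- (c * p.2))) * K' * p.2 ^+ k)).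
  rewrite ler_wpM2r ?exprn_ge0 ?(ltW y0)// ler_pM ?normc_ge0 ?HF//.
  apply: le_trans (HG p y2) _; rewrite ler_piMr// -[leRHS]expR0 ler_expR.
  by rewrite oppr_le0 mulr_ge0 ?ltW.
have -> : K * expR (- (c * p.2)) * K' * p.2 ^+ k = K * K' * (p.2 ^+ k * expR (- (c * p.2))).
  by ring.
by rewrite ler_wpM2l ?mulr_ge0// HL// ltW.
Qed.

Lemma cintegrable_W F G : vanishes_at_infty F -> vanishes_at_infty G ->
  cintegrable mu2 (@fund_domain R) (W F G).
Proof.
move=> vF vG; have [mr mi] := mC_W vF vG; have [K K0 HK] := W_bound vF vG.
have mFD := @measurable_fund_domain R.
have i2 : mu2.-integrable (@fund_domain R) (fun p => K%:E * (p.2 ^- 2)%:E)%E.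
  by apply: integrableZl; [exact: mFD|exact: integrable_inv_sqr].
split.
- apply: (le_integrable _ _ _ i2); first exact: mFD.
    by apply: measurable_funTS; exact/measurable_EFinP.
  move=> p pF; rewrite -EFinM !abse_EFin lee_fin.
  apply: le_trans (normc_Re _) _; apply: le_trans (HK p pF) _; exact: ler_norm.
- apply: (le_integrable _ _ _ i2); first exact: mFD.
    by apply: measurable_funTS; exact/measurable_EFinP.
  move=> p pF; rewrite -EFinM !abse_EFin lee_fin.
  apply: le_trans (normc_Im _) _; apply: le_trans (HK p pF) _; exact: ler_norm.
Qed.

Definition IP F G : C := cintegral mu2 (@fund_domain R) (W F G).

Lemma feD F G p : fe (F + G) p = fe F p + fe G p.
Proof.
have [y0|y0] := ltP 0 p.2; first by rewrite !(fe_in _ y0).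
by rewrite !fe_out// addr0.
Qed.

Lemma feZ (c : C) F p : fe (c *: F) p = c * fe F p.
Proof.
have [y0|y0] := ltP 0 p.2; first by rewrite !(fe_in _ y0).
by rewrite !fe_out// mulr0.
Qed.

Lemma IP_lin (c : C) F F' G : vanishes_at_infty F -> vanishes_at_infty F' ->
  vanishes_at_infty G -> IP (c *: F + F') G = c * IP F G + IP F' G.
Proof.
move=> vF vF' vG; rewrite /IP -cintegral_lin//; last 3 first.
- exact: measurable_fund_domain.
- exact: cintegrable_W.
- exact: cintegrable_W.
by congr cintegral; apply/funext => p; rewrite /W feD feZ; ring.
Qed.

Lemma IP_conj F G : vanishes_at_infty F -> vanishes_at_infty G -> IP G F = (IP F G)^*.
Proof.
move=> vF vG; rewrite /IP -cintegral_conj; last 2 first.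
- exact: measurable_fund_domain.
- exact: cintegrable_W.
congr cintegral; apply/funext => p; rewrite /W.
case: (fe F p) (fe G p) => [a b] [c e]; move: (p.2 ^+ k) (p.2 ^- 2) => r s.
by apply/eqP; rewrite eq_complex /=; apply/andP; split; apply/eqP; ring.
Qed.

(** The density |F|^2 y^k of the norm. Slashing [F] by an element of SL2(Z) only moves the argument
    ([phi_sl]), so comparing norms becomes a matter of moving domains. *)
Definition phi F p : R := normc (fe F p) ^+ 2 * p.2 ^+ k.

Lemma phi_ge0 F p : 0 <= phi F p.
Proof.
rewrite /phi; have [y0|y0] := ltP 0 p.2.
  by rewrite mulr_ge0 ?exprn_ge0 ?normc_ge0 ?ltW.
by rewrite fe_out// normc0 expr0n mul0r.
Qed.

Lemma measurable_phi F : vanishes_at_infty F -> measurable_fun setT (phi F).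
Proof.
move=> vF; apply: measurable_funM; first by apply: mC_normc; exact: mC_fe.
by apply: measurable_funX; exact: measurable_snd.
Qed.

Lemma W_self F p : W F F p = (phi F p * p.2 ^- 2)%:C.
Proof.
rewrite /W; have -> : fe F p * (fe F p)^* = (normc (fe F p) ^+ 2)%:C.
  rewrite sqr_normc_ReIm; case: (fe F p) => a b.
  by apply/eqP; rewrite eq_complex /=; apply/andP; split; apply/eqP; ring.
by rewrite /phi !rmorphM.
Qed.

Lemma hint_phi F : vanishes_at_infty F ->
  hint (on (@Fd R) (phi F)) = (\int[mu2]_(p in @fund_domain R) (phi F p * p.2 ^- 2)%:E)%E.
Proof.
move=> vF; rewrite /hint [RHS]integral_mkcond; apply: eq_integral => p _.
rewrite /patch fund_domainE; have [pF|pF] := boolP (Fd p); last first.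
  by rewrite /on (negbTE pF) mul0r memNset//; apply/negP.
rewrite mem_set// /on pF; case/and3P: pF => _ y0 _.
by rewrite /haar y0 exprVn.
Qed.

Lemma IP_self F : vanishes_at_infty F ->
  (complex.Re (IP F F))%:E = hint (on (@Fd R) (phi F)) /\ complex.Im (IP F F) = 0.
Proof.
move=> vF; have [ir ii] := cintegrable_W vF vF.
have E : W F F = (fun p => (phi F p * p.2 ^- 2)%:C) by apply/funext => p; rewrite W_self.
rewrite hint_phi// /IP /cintegral E /=; split.
  rewrite /Rintegral fineK//; rewrite E in ir.
  by apply: integrable_fin_num => //; exact: measurable_fund_domain.
by rewrite /Rintegral integral0.
Qed.

(* A nonzero cusp form does not vanish near the cusp, hence not on a set of
   positive measure. *)
Lemma IP_eq0 F : vanishes_at_infty F -> IP F F = 0 -> F = 0.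
Proof.
move=> vF F0; apply/funext => t0; apply/eqP; rewrite -[0 t0]/(0 : C).
apply: contrapT => /negP Ft0.
have [h [a [h0 FF]]] := (vanishesP F).1 vF.
have [Y Y1 HY] := fourier_nonvanishing h0 FF Ft0.
have [E _] := IP_self vF; move: E; rewrite F0 /=.
rewrite hint_phi// => /esym E.
have mFD := @measurable_fund_domain R.
have mf : measurable_fun (@fund_domain R) (fun p => (phi F p * p.2 ^- 2)%:E).
  apply: measurable_funTS; apply/measurable_EFinP; apply: measurable_funM.
    exact: measurable_phi.
  by apply: measurable_funV; apply: measurable_funX; exact: measurable_snd.
have f0 p : 0 <= phi F p * p.2 ^- 2.
  rewrite mulr_ge0 ?phi_ge0// invr_ge0 exprn_even_ge0//.
have E' : (\int[mu2]_(p in @fund_domain R) `|(phi F p * p.2 ^- 2)%:E| = 0)%E.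
  by rewrite -[RHS]E; apply: eq_integral => p _; rewrite gee0_abs// lee_fin.
have [N [mN N0 sN]] := (ae_eq_integral_abs mu2 mFD mf).1 E'.
(* Above height [Y] the form has no zero, so the null set [N] would contain a rectangle of area
   1. *)
have sub : `[-(1/2), 1/2]%classic `*` `[Y, Y + 1]%classic `<=` N.
  move=> p [/=]; rewrite !in_itv/= => x1 /andP[y1 y2]; apply: sN => /= H.
  have y0 : 0 < p.2 by lra.
  have pF : fund_domain p.
    split=> //; first by rewrite ler_norml.
    have := sqr_ge0 p.1; nra.
  have := H pF => -[] /eqP; rewrite mulf_eq0 invr_eq0 expf_eq0 (gt_eqF y0) orbF.
  rewrite /phi mulf_eq0 !expf_eq0 (gt_eqF y0) andbF orbF /= normc_eq0 (fe_in F y0).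
  by apply/negP/HY.
pose b : R := Y + 1; rewrite -/b in sub; pose a' : R := -(1/2); rewrite -/a' in sub.
have : (mu2 (`[a', (1/2)%R]%classic `*` `[Y, b]%classic) <= mu2 N)%E.
  by apply: le_measure; rewrite ?inE; [exact: measurableX|exact: mN|exact: sub].
rewrite N0 product_measure1E//= /a' /b !lebesgue_measure_itv/= !lte_fin.
rewrite ifT; last by lra.
rewrite ifT; last by lra.
rewrite -!EFinB -EFinM lee_fin; lra.
Qed.

End PeterssonPiece.

(** * Isometries of level 4 *)

Section Gamma0Cosets.
Implicit Types (N : nat) (A M : SL2Z).

Lemma Gamma0_1 N : Gamma0 N 1%g.
Proof. by rewrite /Gamma0 /=; have [_ _ -> _] := SL2Z_1E; rewrite dvdz0. Qed.

Lemma Gamma0M N A M : Gamma0 N A -> Gamma0 N M -> Gamma0 N (A * M)%g.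
Proof.
rewrite /Gamma0 /= => hA hM; rewrite SL2Z_mulE.
by apply: rpredD; [exact: dvdz_mulr|exact: dvdz_mull].
Qed.

Lemma Gamma0V N A : Gamma0 N A -> Gamma0 N A^-1%g.
Proof. by rewrite /Gamma0 /=; have [_ _ -> _] := SL2Z_invE A; rewrite rpredN. Qed.

Definition coset N M : set SL2Z := [set (A * M)%g | A in Gamma0 N].

Lemma coset_eqP N A M : coset N A = coset N M <-> Gamma0 N (A * M^-1)%g.
Proof.
split=> [E|h].
  have : coset N A A by exists 1%g; [exact: Gamma0_1|rewrite mul1g].
  by rewrite E => -[B hB <-]; rewrite mulgK.
apply/seteqP; split=> _ [B hB <-].
  exists (B * (A * M^-1))%g; first exact: Gamma0M.
  by rewrite !mulgA mulgVK.
exists (B * (A * M^-1)^-1)%g; first by apply: Gamma0M => //; exact: Gamma0V.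
by rewrite invgM invgK !mulgA mulgVK.
Qed.

(** The lower left entry of the quotient is the determinant of the two bottom rows: a coset is a
    point of the projective line over Z/N. *)
Lemma Gamma0_divE N A M : Gamma0 N (A * M^-1)%g <->
  (N%:Z %| (val A 1 0 * val M 1 1 - val A 1 1 * val M 1 0)%R)%Z.
Proof.
rewrite /Gamma0 /mkset SL2Z_mulE; have [-> _ -> _] := SL2Z_invE M.
by rewrite mulrN.
Qed.

(** The bottom rows run through the six points of the projective line over Z/4; the words in S and T
    are the ones that occur when [D4] is cut up in [hint_D4]. *)
Definition rep4 (i : nat) : SL2Z :=
  match i with
  | 0 => 1%g
  | 1 => SL2Z_S
  | 2 => (SL2Z_S * SL2Z_T)%g
  | 3 => (SL2Z_S * SL2Z_T^-1)%g
  | 4 => (SL2Z_S * (SL2Z_T * SL2Z_T))%g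
  | _ => (SL2Z_S * (SL2Z_T * SL2Z_T) * SL2Z_S)%g
  end.

Lemma SL2Z_SE : [/\ val SL2Z_S 0 0 = 0, val SL2Z_S 0 1 = -1, val SL2Z_S 1 0 = 1 & val SL2Z_S 1 1 = 0].
Proof. exact: mx22E. Qed.

Lemma SL2Z_TE : [/\ val SL2Z_T 0 0 = 1, val SL2Z_T 0 1 = 1, val SL2Z_T 1 0 = 0 & val SL2Z_T 1 1 = 1].
Proof. exact: mx22E. Qed.

Lemma SL2Z_TVE : [/\ val SL2Z_T^-1%g 0 0 = 1, val SL2Z_T^-1%g 0 1 = -1,
  val SL2Z_T^-1%g 1 0 = 0 & val SL2Z_T^-1%g 1 1 = 1].
Proof.
by have [-> -> -> ->] := SL2Z_invE SL2Z_T; have [-> -> -> ->] := SL2Z_TE; rewrite oppr0.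
Qed.

Lemma rep4E i : (i < 6)%N ->
  val (rep4 i) 1 0 = nth 0 [:: 0; 1; 1; 1; 1; 2] i /\
  val (rep4 i) 1 1 = nth 0 [:: 1; 0; 1; -1; 2; -1] i.
Proof.
have [s1 s2 s3 s4] := SL2Z_SE; have [t1 t2 t3 t4] := SL2Z_TE.
have [v1 v2 v3 v4] := SL2Z_TVE; have [i1 i2 i3 i4] := SL2Z_1E.
by case: i => [|[|[|[|[|[|//]]]]]] _; rewrite /rep4 ?SL2Z_mulE ?s1 ?s2 ?s3 ?s4 ?t1 ?t2 ?t3 ?t4
  ?v1 ?v2 ?v3 ?v4 ?i1 ?i2 ?i3 ?i4.
Qed.

Lemma rep4_div i j : (i < 6)%N -> (j < 6)%N -> coset 4 (rep4 i) = coset 4 (rep4 j) -> i = j.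
Proof.
move=> hi hj /coset_eqP/Gamma0_divE.
have [-> ->] := rep4E hi; have [-> ->] := rep4E hj.
by case: i hi => [|[|[|[|[|[|//]]]]]] _; case: j hj => [|[|[|[|[|[|//]]]]]] _.
Qed.

Lemma mod4_cases (n : int) :
  [\/ modz n 4 = 0, modz n 4 = 1, modz n 4 = 2 | modz n 4 = 3].
Proof.
have h4 : (4 : int) != 0 by [].
have := ltz_mod n h4; have := modz_ge0 n h4.
case: (modz n 4) => // -[|[|[|[|m]]]] // _ _;
  by [constructor 1|constructor 2|constructor 3|constructor 4].
Qed.

Lemma rep4_surj M : exists2 i, (i < 6)%N & coset 4 M = coset 4 (rep4 i).
Proof.
suff [i hi /Gamma0_divE/coset_eqP E] : exists2 i, (i < 6)%N &
   (4%:Z %| (val M 1 0 * val (rep4 i) 1 1 - val M 1 1 * val (rep4 i) 1 0)%R)%Z by exists i.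
have := SL2Z_det M; set a := val M 0 0; set b := val M 0 1; set c := val M 1 0; set d := val M 1 1.
move=> det.
have H i x y : (i < 6)%N -> x = nth 0 [:: 0; 1; 1; 1; 1; 2] i -> y = nth 0 [:: 1; 0; 1; -1; 2; -1] i ->
   (4%:Z %| (c * y - d * x)%R)%Z -> exists2 i, (i < 6)%N &
   (4%:Z %| (c * val (rep4 i) 1 1 - d * val (rep4 i) 1 0)%R)%Z.
  by move=> hi ex ey dv; exists i => //; have [-> ->] := rep4E hi; rewrite -ex -ey.
have [c4 [r [cE hr]]] : exists c4 r : int, c = 4 * c4 + r /\ [\/ r = 0, r = 1, r = 2 | r = 3].
  exists (divz c 4), (modz c 4); split; first by rewrite {1}(divz_eq c 4) mulrC.
  exact: mod4_cases.
have [d4 [s [dE hs]]] : exists d4 s : int, d = 4 * d4 + s /\ [\/ s = 0, s = 1, s = 2 | s = 3].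
  exists (divz d 4), (modz d 4); split; first by rewrite {1}(divz_eq d 4) mulrC.
  exact: mod4_cases.
(* Determinant 1 forbids an even bottom row, which rules out four of the sixteen pairs of residues
   below. *)
have odd : ~ (exists u v : int, c = 2 * u /\ d = 2 * v).
  move=> [u [v [cu dv]]]; have : 2 * (a * v - b * u) = 1 by rewrite -[RHS]det cu dv; ring.
  by lia.
have D n m : n = 4 * m -> (4%:Z %| n)%Z by move=> ->; rewrite dvdz_mulr.
case: hr => hr; rewrite hr in cE; case: hs => hs; rewrite hs in dE.
- by case: odd; exists (2 * c4), (2 * d4); rewrite cE dE; split; ring.
- by apply: (H 0%N 0 1) => //; apply: (D _ c4); rewrite cE; ring.
- by case: odd; exists (2 * c4), (2 * d4 + 1); rewrite cE dE; split; ring.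
- by apply: (H 0%N 0 1) => //; apply: (D _ c4); rewrite cE; ring.
- by apply: (H 1%N 1 0) => //; apply: (D _ (- d4)); rewrite dE; ring.
- by apply: (H 2%N 1 1) => //; apply: (D _ (c4 - d4)); rewrite cE dE; ring.
- by apply: (H 4%N 1 2) => //; apply: (D _ (2 * c4 - d4)); rewrite cE dE; ring.
- by apply: (H 3%N 1 (-1)) => //; apply: (D _ (- c4 - d4 - 1)); rewrite cE dE; ring.
- by case: odd; exists (2 * c4 + 1), (2 * d4); rewrite cE dE; split; ring.
- by apply: (H 5%N 2 (-1)) => //; apply: (D _ (- c4 - 2 * d4 - 1)); rewrite cE dE; ring.
- by case: odd; exists (2 * c4 + 1), (2 * d4 + 1); rewrite cE dE; split; ring.
- by apply: (H 5%N 2 (-1)) => //; apply: (D _ (- c4 - 2 * d4 - 2)); rewrite cE dE; ring.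
- by apply: (H 1%N 1 0) => //; apply: (D _ (- d4)); rewrite dE; ring.
- by apply: (H 3%N 1 (-1)) => //; apply: (D _ (- c4 - d4 - 1)); rewrite cE dE; ring.
- by apply: (H 4%N 1 2) => //; apply: (D _ (2 * c4 + 1 - d4)); rewrite cE dE; ring.
- by apply: (H 2%N 1 1) => //; apply: (D _ (c4 - d4)); rewrite cE dE; ring.
Qed.

End Gamma0Cosets.

Section PeterssonFour.
Variables (R : realType) (k : nat).
Local Notation C := R[i].
Local Notation uhp := (uhp R).
Local Notation mu := (@lebesgue_measure R).
Local Notation mu2 := (product_measure1 mu mu).
Local Notation sl := (@sl R k).
Local Notation phi := (@phi R k).
Implicit Types (f g h : uhp -> C) (p : R * R) (t : uhp) (M A : SL2Z).

(** Holomorphy is kept apart: the Petersson product sees only the invariance and the Fourier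
    expansions at the cusps. *)
Definition level4 f := (forall M, Gamma0 4 M -> sl M f = f) /\ cuspidal k f.

Lemma Im_act (A : 'M[R]_2) t : 0 < \det A ->
  complex.Im (val (act A t)) = \det A * complex.Im (val t) / normc (jfac A (val t)) ^+ 2.
Proof.
move=> dA; have j0 := jfac_neq0 t dA; move: j0; rewrite val_act// /moebius -/(jfac A _).
rewrite sqr_normc_ReIm det22 /jfac !realcM.
case: (val t) => x y /=; rewrite !addr0 => j0.
set n := (_ ^+ 2 + _); have n0 : n != 0.
  apply: contra j0; rewrite paddr_eq0 ?sqr_ge0// !sqrf_eq0 => /andP[/eqP h1 /eqP h2].
  by rewrite eq_complex /= addr0 h1 h2 !eqxx.
by field.
Qed.

Lemma sl_act M f t : f (act (realmx R M) t) = jfac (realmx R M) (val t) ^+ k * sl M f t.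
Proof.
rewrite /sl /pslash mulrA divff ?mul1r// expf_neq0// jfac_neq0//.
exact: det_realmx_gt0.
Qed.

Lemma Im_act_SL M t : complex.Im (val (act (realmx R M) t)) =
  complex.Im (val t) / normc (jfac (realmx R M) (val t)) ^+ 2.
Proof. by rewrite Im_act ?det_realmx_gt0// det_realmx mul1r. Qed.

Definition cp t : R * R := (complex.Re (val t), complex.Im (val t)).

Lemma pt_cp t : pt (cp t) = val t.
Proof. by rewrite /pt /cp /=; case: (val t). Qed.

Lemma fe_cp f t : fe f (cp t) = f t.
Proof. by rewrite /fe pt_cp ext_val. Qed.

Lemma cp_surj p : 0 < p.2 -> exists t, p = cp t.
Proof.
by move=> y0; exists (mkuhp (y0 : 0 < complex.Im (pt p))); case: p y0.
Qed.

(** The automorphy factors of [f] and of the conjugate of [g] multiply to |j|^(2k), which cancels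
    the denominator of the k-th power of the imaginary part of M t. *)
Lemma W_sl M f g t :
  let z := val (act (realmx R M) t) in
  ext f z * (ext g z)^* * (complex.Im z ^+ k)%:C * (complex.Im (val t) ^- 2)%:C =
  W k (sl M f) (sl M g) (cp t).
Proof.
move=> z; rewrite /W !fe_cp /z !ext_val (sl_act M f) (sl_act M g) Im_act_SL /=.
set j := jfac _ _; have j0 : j != 0 by rewrite jfac_neq0// det_realmx_gt0.
have nj0 : normc j != 0 by rewrite normc_eq0.
congr (_ * _); rewrite rmorphM rmorphXn /= expr_div_n rmorphM /=.
have E : (j ^+ k) * (j ^+ k)^* * ((normc j ^+ 2) ^+ k)^-1%:C = 1.
  rewrite rmorphXn /= -exprMn -[(_)^-1%:C]realcV rmorphXn /= -exprVn -exprMn.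
  have -> : j * j^* = (normc j ^+ 2)%:C.
    rewrite sqr_normc_ReIm; case: (j) => a b.
    by apply/eqP; rewrite eq_complex /=; apply/andP; split; apply/eqP; ring.
  by rewrite divff ?expr1n// -[0]/(0%:C) (inj_eq (@complexI R)) sqrf_eq0.
rewrite -[RHS]mulr1 -[X in _ = _ * X]E -rmorphXn /=.
by ring.
Qed.

Definition term M f g : C := IP k (sl M f) (sl M g).

Lemma petersson_term M f g :
  cintegral (lebesgue_measure \x lebesgue_measure)%E (@fund_domain R)
    (fun p => let z := moebius (realmx R M) (p.1 +i* p.2) in
       ext f z * (ext g z)^* * (complex.Im z ^+ k)%:C * (p.2 ^- 2)%:C) = term M f g.
Proof.
rewrite /term /IP /cintegral.
have E p : fund_domain p -> (let z := moebius (realmx R M) (p.1 +i* p.2) in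
       ext f z * (ext g z)^* * (complex.Im z ^+ k)%:C * (p.2 ^- 2)%:C) =
   W k (sl M f) (sl M g) p.
  case=> _ y0 _; have [t ->] := cp_surj y0.
  have -> : (cp t).1 +i* (cp t).2 = val t by exact: pt_cp.
  by rewrite -W_sl val_act ?det_realmx_gt0.
by congr (_ +i* _); apply: eq_Rintegral => p; rewrite inE => /E <-.
Qed.

Lemma term_coset A M f g : level4 f -> level4 g -> coset 4 A = coset 4 M ->
  term A f g = term M f g.
Proof.
move=> [ff _] [gg _] /coset_eqP h; have -> : A = (A * M^-1 * M)%g by rewrite mulgVK.
by rewrite /term !(slM k (A * M^-1)%g M) ff// gg.
Qed.

Lemma peterssonE f g : level4 f -> level4 g ->
  petersson 4 k f g = \sum_(i <- iota 0 6) term (rep4 i) f g.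
Proof.
move=> Kf Kg; rewrite /petersson.
rewrite (fsbigE [seq coset 4 (rep4 i) | i <- iota 0 6]); first last.
- move=> _ [M _ <-] /negP[]; have [i hi E] := rep4_surj M.
  by apply/mapP; exists i; rewrite ?mem_iota.
- move=> c cr; have /mapP[i _ ->] : c \in [seq coset 4 (rep4 i) | i <- iota 0 6] by exact: cr.
  by exists (rep4 i).
- rewrite map_inj_in_uniq ?iota_uniq// => i j; rewrite !mem_iota /= => hi hj.
  exact: rep4_div.
rewrite big_map big_seq_cond [RHS]big_seq; apply: eq_big => [i|i _].
  rewrite andb_idr// => _; apply/mem_set; by exists (rep4 i).
(* [xget] selects an unknown member of the coset; invariance allows it to be replaced by
   [rep4 i]. *)
rewrite petersson_term; apply: term_coset => //; apply/coset_eqP.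
have : coset 4 (rep4 i) (xget 1%g (coset 4 (rep4 i))).
  apply: (@xgetI _ _ _ (rep4 i)).
  by exists 1%g; [exact: Gamma0_1|rewrite mul1g].
by case=> B hB <-; rewrite mulgK.
Qed.

Lemma level4_lin (c : C) f g : level4 f -> level4 g -> level4 (c *: f + g).
Proof.
move=> [ff cf] [gg cg]; split; last exact: cuspidal_lin.
by move=> M hM; rewrite sl_lin ff// gg.
Qed.

Lemma petersson_lin (c : C) f f' g : level4 f -> level4 f' -> level4 g ->
  petersson 4 k (c *: f + f') g = c * petersson 4 k f g + petersson 4 k f' g.
Proof.
move=> Kf Kf' Kg; rewrite (peterssonE (level4_lin c Kf Kf') Kg) (peterssonE Kf Kg) (peterssonE Kf' Kg).
rewrite mulr_sumr -big_split; apply: eq_bigr => i _.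
by rewrite /term sl_lin; apply: IP_lin; [exact: Kf.2|exact: Kf'.2|exact: Kg.2].
Qed.

Lemma petersson_conj f g : level4 f -> level4 g ->
  petersson 4 k g f = (petersson 4 k f g)^*.
Proof.
move=> Kf Kg; rewrite (peterssonE Kg Kf) (peterssonE Kf Kg) rmorph_sum; apply: eq_bigr => i _.
by rewrite /term; apply: IP_conj; [exact: Kf.2|exact: Kg.2].
Qed.

(** The Petersson norm as an extended real, where pieces can be cut and rearranged freely. *)
Definition Q f : \bar R := (\sum_(i <- iota 0 6) hint (on (@Fd R) (phi (sl (rep4 i) f))))%E.

Lemma petersson_self f : level4 f ->
  (complex.Re (petersson 4 k f f))%:E = Q f /\ complex.Im (petersson 4 k f f) = 0.
Proof.
move=> Kf; rewrite (peterssonE Kf Kf) /Q.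
elim: (iota 0 6) => [|i s [IH1 IH2]]; first by rewrite !big_nil.
rewrite !big_cons; have [E1 E2] := IP_self k ((Kf.2) (rep4 i)).
move: E1 E2 IH1 IH2; rewrite -/(term _ f f).
by case: (term _ _ _) (\sum_(_ <- _) _) => [a b] [c e] /= <- -> <- ->; rewrite addr0.
Qed.

(** All six terms are nonnegative, so the one of the identity coset vanishes and [IP_eq0]
    applies. *)
Lemma petersson_eq0 f : level4 f -> petersson 4 k f f = 0 -> f = 0.
Proof.
move=> Kf P0; have [E _] := petersson_self Kf; move: E; rewrite P0 /= => /esym.
rewrite /Q /= big_cons /= => E.
have h0 M : (0 <= hint (on (@Fd R) (phi (sl M f))))%E.
  apply: integral_ge0 => p _; rewrite lee_fin mulr_ge0 ?exprn_ge0 ?haar_ge0//.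
  by apply: on_ge0 => q; exact: phi_ge0.
have E1 : hint (on (@Fd R) (phi (sl (rep4 0) f))) = 0%E.
  apply/eqP; rewrite eq_le h0 andbT -[leRHS]E leeDl//.
  by apply: sume_ge0.
rewrite /rep4 sl1 in E1; have v : vanishes_at_infty f by rewrite -[f](sl1 k); exact: Kf.2.
have [F1 F2] := IP_self k v; apply: (IP_eq0 v (k := k)).
move: F1 F2; rewrite E1; case: (IP _ _ _) => a b /= [->] ->.
by [].
Qed.

End PeterssonFour.

Section Retiling.
Variables (R : realType) (k : nat).
Local Notation C := R[i].
Local Notation uhp := (uhp R).
Local Notation sl := (@sl R k).
Local Notation phi := (@phi R k).
Local Notation level4 := (@level4 R k).
Local Notation Q := (@Q R k).
Implicit Types (f g h : uhp -> C) (p : R * R) (t : uhp) (M A : SL2Z).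

Lemma phi_cp f t : phi f (cp t) = normc (f t) ^+ 2 * complex.Im (val t) ^+ k.
Proof. by rewrite /phi fe_cp. Qed.

Lemma phi_sl M f t : phi (sl M f) (cp t) = phi f (cp (act (realmx R M) t)).
Proof.
rewrite !phi_cp (sl_act k M f t) (normcM (jfac (realmx R M) (val t) ^+ k)) normcX Im_act_SL expr_div_n exprMn -!exprM mulnC.
set j := normc (jfac _ _); have j0 : j != 0.
  by rewrite normc_eq0 jfac_neq0// det_realmx_gt0.
by field; rewrite expf_neq0.
Qed.

Lemma realmxE (a b c e : int) M : val M = mx22 a b c e ->
  realmx R M = mx22 a%:~R b%:~R c%:~R e%:~R.
Proof. by move=> E; rewrite /Defs.realmx E map_mx22. Qed.

Lemma cp_S t : cp (act (realmx R SL2Z_S) t) = invS (cp t).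
Proof.
rewrite /cp val_act ?det_realmx_gt0// (@realmxE 0 (-1) 1 0)// /moebius !mxE /=.
rewrite mul0r add0r mul1r addr0 rmorphN1 mulN1r /invS; case: (sval t) => x y /=.
by congr (_, _); rewrite ?mulNr ?opprK.
Qed.

Lemma cp_T (e : int) M t : val M = mx22 1 e 0 1 ->
  cp (act (realmx R M) t) = trans e%:~R (cp t).
Proof.
move=> E; rewrite /cp val_act ?det_realmx_gt0// (realmxE E) /moebius !mxE /=.
rewrite mul0r add0r mul1r divr1; case: (val t) => x y /=.
by rewrite /trans /= addr0.
Qed.

Lemma val_TV : val SL2Z_T^-1%g = mx22 1 (-1) 0 1.
Proof. by have [h1 h2 h3 h4] := SL2Z_TVE; rewrite [LHS]mx22_eta h1 h2 h3 h4. Qed.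

Lemma phi_S f p : 0 < p.2 -> phi (sl SL2Z_S f) p = phi f (invS p).
Proof. by move=> /cp_surj[t ->]; rewrite phi_sl cp_S. Qed.

Lemma phi_T f p : 0 < p.2 -> phi (sl SL2Z_T f) p = phi f (trans 1 p).
Proof. by move=> /cp_surj[t ->]; rewrite phi_sl (@cp_T 1). Qed.

Lemma phi_TV f p : 0 < p.2 -> phi (sl SL2Z_T^-1%g f) p = phi f (trans (-1) p).
Proof. by move=> /cp_surj[t ->]; rewrite phi_sl (@cp_T (-1))// val_TV. Qed.

Lemma invS_gt0 p : 0 < p.2 -> 0 < (invS p).2.
Proof. by move=> y0; rewrite /invS /= divr_gt0// (sqnorm_gt0 y0). Qed.

Lemma trans_trans (a b : R) p : trans a (trans b p) = trans (a + b) p.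
Proof. by rewrite /trans /= [a + b]addrC addrA. Qed.

Lemma phi_out f p : ~~ (0 < p.2) -> phi f p = 0.
Proof. by rewrite -leNgt => y0; rewrite /phi fe_out// normc0 expr0n mul0r. Qed.

Definition hFd M f := hint (on (@Fd R) (phi (sl M f))).

Lemma QE f : Q f = (hFd 1%g f + (hFd SL2Z_S f + (hFd (SL2Z_S * SL2Z_T)%g f +
  (hFd (SL2Z_S * SL2Z_T^-1)%g f + (hFd (SL2Z_S * (SL2Z_T * SL2Z_T))%g f +
   hFd (SL2Z_S * (SL2Z_T * SL2Z_T) * SL2Z_S)%g f)))))%E.
Proof.
have -> : Q f = (\sum_(i <- iota 0 6) hFd (rep4 i) f)%E by [].
have -> : iota 0 6 = [:: 0; 1; 2; 3; 4; 5]%N by [].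
rewrite 5!big_cons.
rewrite big_seq1.
exact: erefl.
Qed.

Lemma hFd_coset A M f : level4 f -> coset 4 A = coset 4 M -> hFd A f = hFd M f.
Proof.
move=> [ff _] /coset_eqP h; have -> : A = (A * M^-1 * M)%g by rewrite mulgVK.
by rewrite /hFd (slM k (A * M^-1)%g M) ff.
Qed.

Lemma hint_on_eq (A : R * R -> bool) (u v : R * R -> R) :
  (forall p, 0 < p.2 -> u p = v p) -> hint (on A u) = hint (on A v).
Proof. by move=> uv; apply: hint_eq => p y0; rewrite /on uv. Qed.

(** Each piece in [hint_D4] is an integral of [phi] for a slash of [f]; once T^-2 is replaced by
    T^2, the left and right halves of [Fd] carry the same integrand and join. *)
Lemma Q_D4 f : level4 f -> Q f = hint (on (@D4 R) (phi f)).
Proof.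
move=> Kf; have vf : vanishes_at_infty f by rewrite -[f](sl1 k); exact: Kf.2.
rewrite hint_D4; [|exact: measurable_phi|exact: phi_ge0].
have vF M : measurable_fun setT (phi (sl M f)) by apply: measurable_phi; exact: Kf.2.
have q M : hint (on (@Fd R) (phi (sl M f))) = hFd M f by [].
have e1 : hint (on (@Fd R) (phi f)) = hFd 1%g f by rewrite /hFd sl1.
have eS p : 0 < p.2 -> (phi f \o invS) p = phi (sl SL2Z_S f) p.
  by move=> y0; rewrite phi_S.
have tr (b : R) p : 0 < p.2 -> 0 < (trans b p).2 by [].
have eST p : 0 < p.2 -> (phi f \o invS \o trans 1) p = phi (sl (SL2Z_S * SL2Z_T)%g f) p.
  by move=> y0; rewrite slM phi_T//= -eS.
have eSTV p : 0 < p.2 ->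
    (phi f \o invS \o trans (-1)) p = phi (sl (SL2Z_S * SL2Z_T^-1)%g f) p.
  by move=> y0; rewrite slM phi_TV//= -eS.
have eST2 p : 0 < p.2 ->
    (phi f \o invS \o trans 2) p = phi (sl (SL2Z_S * (SL2Z_T * SL2Z_T))%g f) p.
  by move=> y0; rewrite mulgA slM phi_T// -eST//= trans_trans.
have eSTV2 p : 0 < p.2 -> (phi f \o invS \o trans (-2)) p =
    phi (sl (SL2Z_S * (SL2Z_T^-1 * SL2Z_T^-1))%g f) p.
  move=> y0; rewrite mulgA slM phi_TV// -eSTV//= trans_trans.
  by congr (phi f (invS (trans _ p))); ring.
have eST2S p : 0 < p.2 -> (phi f \o invS \o trans 2 \o invS) p =
    phi (sl (SL2Z_S * (SL2Z_T * SL2Z_T) * SL2Z_S)%g f) p.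
  by move=> y0; rewrite slM phi_S// -eST2//; exact: invS_gt0.
have eSTV2S p : 0 < p.2 -> (phi f \o invS \o trans (-2) \o invS) p =
    phi (sl (SL2Z_S * (SL2Z_T^-1 * SL2Z_T^-1) * SL2Z_S)%g f) p.
  by move=> y0; rewrite slM phi_S// -eSTV2//; exact: invS_gt0.
have [s1 s2 s3 s4] := SL2Z_SE; have [t1 t2 t3 t4] := SL2Z_TE.
have [v1 v2 v3 v4] := SL2Z_TVE.
have fx M N : coset 4 M = coset 4 N -> phi (sl M f) = phi (sl N f).
  move=> /coset_eqP h; have -> : M = (M * N^-1 * N)%g by rewrite mulgVK.
  by rewrite (slM k (M * N^-1)%g N) Kf.1.
(* The two words differ by the conjugate under S of a fourth power of T, which lies in
   [Gamma0 4]. *)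
have c1 : phi (sl (SL2Z_S * (SL2Z_T^-1 * SL2Z_T^-1))%g f) =
          phi (sl (SL2Z_S * (SL2Z_T * SL2Z_T))%g f).
  apply: fx; apply/coset_eqP/Gamma0_divE.
  by rewrite !SL2Z_mulE ?s1 ?s2 ?s3 ?s4 ?t1 ?t2 ?t3 ?t4 ?v1 ?v2 ?v3 ?v4.
have c2 : phi (sl (SL2Z_S * (SL2Z_T^-1 * SL2Z_T^-1) * SL2Z_S)%g f) =
          phi (sl (SL2Z_S * (SL2Z_T * SL2Z_T) * SL2Z_S)%g f).
  apply: fx; apply/coset_eqP/Gamma0_divE.
  by rewrite !SL2Z_mulE ?s1 ?s2 ?s3 ?s4 ?t1 ?t2 ?t3 ?t4 ?v1 ?v2 ?v3 ?v4.
rewrite (hint_on_eq _ eS) (hint_on_eq _ eST) !(hint_on_eq _ eST2) (hint_on_eq _ eST2S).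
rewrite (hint_on_eq _ eSTV) !(hint_on_eq _ eSTV2) (hint_on_eq _ eSTV2S) c1 c2.
rewrite QE e1 -!/(hFd _ f).
have F M : hFd M f = (hint (on (Fh 1) (phi (sl M f))) + hint (on (Fh (-1)) (phi (sl M f))))%E.
  by rewrite /hFd (hint_Fd (vF M) (phi_ge0 k _)).
rewrite (F (SL2Z_S * (SL2Z_T * SL2Z_T))%g) (F (SL2Z_S * (SL2Z_T * SL2Z_T) * SL2Z_S)%g).
have AC (a b c d x y u v : \bar R) : (a + (b + (c + (y + u) + (d + (x + v)))) =
    a + (b + (c + (d + (x + y + (u + v))))))%E.
  congr (_ + (_ + _))%E; rewrite addeACA -!addeA; congr (_ + (_ + _))%E.
  by rewrite [RHS]addeCA; congr (_ + _)%E; rewrite addeCA.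
exact/esym/AC.
Qed.

End Retiling.

Section Polarized.
Variables (R : realType) (k : nat).
Local Notation C := R[i].
Local Notation uhp := (uhp R).
Local Notation sl := (@sl R k).
Local Notation phi := (@phi R k).
Local Notation level4 := (@level4 R k).
Local Notation Q := (@Q R k).
Local Notation hFd := (@hFd R k).
Implicit Types (f g h : uhp -> C) (p : R * R) (t : uhp) (M A : SL2Z).

Lemma A1_subproof : (1 : int) * 1 - 0 * 2 = 1. Proof. by []. Qed.
Definition A1 : SL2Z := mkSL A1_subproof.

Lemma A1E : [/\ val A1 0 0 = 1, val A1 0 1 = 0, val A1 1 0 = 2 & val A1 1 1 = 1].
Proof. exact: mkSLE. Qed.

Lemma Gamma0_odd N M : (2 %| N)%N -> Gamma0 N M ->
  exists a c d : int, [/\ val M 0 0 = 2 * a + 1, val M 1 0 = 2 * c & val M 1 1 = 2 * d + 1].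
Proof.
move=> N2; rewrite /Gamma0 /mkset => cN.
have /dvdzP[c cE] : (2 %| (val M 1 0)%R)%Z by apply: dvdz_trans cN; rewrite dvdzE.
have det := SL2Z_det M.
have two (n : int) : exists m, n = 2 * m \/ n = 2 * m + 1.
  have h2 : (2 : int) != 0 by [].
  exists (divz n 2); move: (divz_eq n 2) (ltz_mod n h2) (modz_ge0 n h2).
  by move: (divz n 2) (modz n 2) => q [[|[|m]]|m] // -> _ _; [left|right]; ring.
move: det; rewrite cE.
have [a [aE|aE]] := two (val M 0 0); have [d [dE|dE]] := two (val M 1 1); rewrite aE dE.
- by move=> h; exfalso; have : 2 * (2 * a * d - val M 0 1 * c) = 1; [rewrite -[RHS]h; ring|lia].
- by move=> h; exfalso; have : 2 * (a * (2 * d + 1) - val M 0 1 * c) = 1; [rewrite -[RHS]h; ring|lia].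
- by move=> h; exfalso; have : 2 * ((2 * a + 1) * d - val M 0 1 * c) = 1; [rewrite -[RHS]h; ring|lia].
- by move=> _; exists a, c, d; split; ring.
Qed.

Lemma Gamma0_4_odd M : Gamma0 4 M ->
  exists a c d : int, [/\ val M 0 0 = 2 * a + 1, val M 1 0 = 4 * c & val M 1 1 = 2 * d + 1].
Proof.
move=> h; have [a [_ [d [-> _ ->]]]] := @Gamma0_odd 4 M isT h.
move: h; rewrite /Gamma0 /mkset => /dvdzP[c cE].
by exists a, c, d; rewrite cE; split; ring.
Qed.

(** For M with rows (a, b) and (c, d) the lower left entry of the conjugate is c + 2 (a - d) - 4 b,
    divisible by 4 because a and d are both odd. *)
Lemma A1_normal M : Gamma0 4 M -> Gamma0 4 (A1 * M * A1^-1)%g.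
Proof.
move=> /Gamma0_4_odd[a [c [d [aE cE dE]]]]; rewrite /Gamma0 /mkset.
have [e1 e2 e3 e4] := A1E; have [v1 v2 v3 v4] := SL2Z_invE A1.
rewrite SL2Z_mulE v1 v3 !SL2Z_mulE ?e1 ?e2 e3 e4 aE cE dE.
apply/dvdzP; exists (a - d + c - val M 0 1); ring.
Qed.

Lemma level4_A1 f : level4 f -> level4 (sl A1 f).
Proof.
move=> [ff cf]; split; last exact: cuspidal_sl.
move=> M hM; rewrite -slM.
have -> : (A1 * M = A1 * M * A1^-1 * A1)%g by rewrite mulgVK.
by rewrite (slM k (A1 * M * A1^-1)%g A1) ff//; exact: A1_normal.
Qed.

(** Left multiplication by [A1] exchanges the cosets in pairs: 1 with S T^2 S, S with S T^2, and S T
    with S T^-1. *)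
Lemma Q_A1 f : level4 f -> Q (sl A1 f) = Q f.
Proof.
move=> Kf; rewrite !QE.
have H (M N : SL2Z) : (4%:Z %| (val (A1 * M)%g 1 0 * val N 1 1 - val (A1 * M)%g 1 1 * val N 1 0)%R)%Z ->
    hFd M (sl A1 f) = hFd N f.
  move=> h; rewrite /hFd -slM -!/(hFd _ f); apply: (hFd_coset Kf).
  exact/coset_eqP/Gamma0_divE.
have [e1 e2 e3 e4] := A1E; have [s1 s2 s3 s4] := SL2Z_SE; have [t1 t2 t3 t4] := SL2Z_TE.
have [v1 v2 v3 v4] := SL2Z_TVE; have [i1 i2 i3 i4] := SL2Z_1E.
pose E := (e1, e2, e3, e4, s1, s2, s3, s4, t1, t2, t3, t4, (v1, v2, v3, v4), (i1, i2, i3, i4)).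
rewrite (H 1%g (SL2Z_S * (SL2Z_T * SL2Z_T) * SL2Z_S)%g); last by rewrite !SL2Z_mulE !E.
rewrite (H SL2Z_S (SL2Z_S * (SL2Z_T * SL2Z_T))%g); last by rewrite !SL2Z_mulE !E.
rewrite (H (SL2Z_S * SL2Z_T)%g (SL2Z_S * SL2Z_T^-1)%g); last by rewrite !SL2Z_mulE !E.
rewrite (H (SL2Z_S * SL2Z_T^-1)%g (SL2Z_S * SL2Z_T)%g); last by rewrite !SL2Z_mulE !E.
rewrite (H (SL2Z_S * (SL2Z_T * SL2Z_T))%g SL2Z_S); last by rewrite !SL2Z_mulE !E.
rewrite (H (SL2Z_S * (SL2Z_T * SL2Z_T) * SL2Z_S)%g 1%g); last by rewrite !SL2Z_mulE !E.
have AC (a b c d x y : \bar R) : (a + (b + (c + (d + (x + y)))) =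
    y + (x + (d + (c + (b + a)))))%E.
  by rewrite [in RHS](addeC y) [in RHS](addeC x) [in RHS](addeC d) [in RHS](addeC c)
    [in RHS](addeC b) !addeA.
exact: AC.
Qed.

Definition half f : uhp -> C := pslash k (mx22 1 (1/2) 0 1) f.

Lemma det_half : 0 < \det (mx22 (1 : R) (1/2) 0 1).
Proof. by rewrite det_mx22 mulr0 subr0 mulr1. Qed.

Lemma val_act_half t : val (act (mx22 1 (1/2) 0 1) t) = val t + (1/2)%:C.
Proof. by rewrite act_upper// rmorph1 (mul1r (val t)) divr1. Qed.

Lemma halfE f t : half f t = f (act (mx22 1 (1/2) 0 1) t).
Proof. by rewrite /half /pslash jfac_upper rmorph1 expr1n invr1 (mul1r (f _)). Qed.

(** An integral matrix with the same Moebius action makes [cuspidal_pslash] available; the factor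
    2^k compensates its constant automorphy factor 2. *)
Lemma half_int f : half f = (2%:R ^+ k : C) *: pslash k (map_mx intr (mx22 2 1 0 2 : 'M[int]_2)) f.
Proof.
apply/funext => t; rewrite halfE map_mx22 -[RHS]/(2%:R ^+ k * pslash k _ f t).
rewrite /pslash jfac_upper natcE mulrA divff ?(mul1r (f _)).
  congr f; apply: val_inj; rewrite val_act_half act_upper//.
  have -> : (1 / 2 : R)%:C = 1 / 2 :> C by rewrite natcE realcV -[1 in RHS]/((1 : R)%:C) -rmorphM.
  rewrite !(rmorph1, rmorph_nat); by field.
by rewrite expf_neq0// -[0]/(0%:C) (inj_eq (@complexI R)) pnatr_eq0.
Qed.

Lemma level4_half f : level4 f -> level4 (half f).
Proof.
move=> [ff cf]; split; last first.
  by rewrite half_int; apply: cuspidalZ; apply: cuspidal_pslash => //; rewrite det_mx22.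
move=> M hM; have [a [c [d [aE cE dE]]]] := Gamma0_4_odd hM.
set b := val M 0 1.
(* These are the entries of [M] conjugated by the translation by 1/2; they are integers since the
   diagonal of [M] is odd and its lower left entry is divisible by 4. *)
have det : (2 * a + 1 + 2 * c) * (2 * d + 1 - 2 * c) - (b + d - a - c) * (4 * c) = 1.
  by apply: etrans (SL2Z_det M); rewrite aE cE dE -/b; ring.
pose N := mkSL det.
have hN : Gamma0 4 N.
  by rewrite /Gamma0 /mkset; have [_ _ -> _] := mkSLE det; rewrite dvdz_mulr.
rewrite /sl /half -pslashM ?det_half ?det_realmx_gt0//.
have -> : mx22 1 (1/2) 0 1 *m realmx R M = realmx R N *m mx22 1 (1/2) 0 1.
  rewrite (@realmxE R (2 * a + 1) b (4 * c) (2 * d + 1)); last first.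
    by rewrite [LHS]mx22_eta aE cE dE.
  rewrite (@realmxE R _ _ _ _ N (erefl _)) !mul_mx22 !(rmorphD, rmorphN, rmorphM) /=.
  by congr mx22; field.
by rewrite pslashM ?det_half ?det_realmx_gt0// -/(sl N f) ff.
Qed.

Lemma phi_half f p : 0 < p.2 -> phi (half f) p = phi f (trans (1/2) p).
Proof.
move=> /cp_surj[t ->]; rewrite phi_cp halfE.
have -> : trans (1/2) (cp t) = cp (act (mx22 1 (1/2) 0 1) t).
  by rewrite /cp val_act_half /trans /=; case: (sval t) => x y /=; rewrite addr0.
rewrite phi_cp val_act_half; congr (_ * _ ^+ _).
by case: (val t) => x y /=; rewrite addr0.
Qed.

Lemma Q_half f : level4 f -> Q (half f) = Q f.
Proof.
move=> Kf; rewrite Q_D4; last exact: level4_half.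
rewrite (Q_D4 Kf).
have vf : vanishes_at_infty f by rewrite -[f](sl1 k); exact: Kf.2.
rewrite (hint_on_eq _ (@phi_half f)).
apply: (hint_D4_half (measurable_phi k vf) (phi_ge0 k f)).
apply/funext => p /=; have [y0|y0] := boolP (0 < p.2); last by rewrite !phi_out.
rewrite -phi_T// Kf.1//.
by rewrite /Gamma0 /mkset; have [_ _ -> _] := SL2Z_TE; rewrite dvdz0.
Qed.

(** * Norm-preserving linear maps and polarization *)

Section Polarization.
Variable U : (uhp -> C) -> (uhp -> C).
Hypotheses (U4 : forall f, level4 f -> level4 (U f))
  (UD : forall f g, U (f + g) = U f + U g) (UZ : forall (c : C) f, U (c *: f) = c *: U f)
  (UQ : forall f, level4 f -> Q (U f) = Q f).
Local Notation P := (petersson 4 k).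

Lemma petersson_U f : level4 f -> P (U f) (U f) = P f f.
Proof.
move=> Kf; have [E1 E2] := petersson_self Kf; have [F1 F2] := petersson_self (U4 Kf).
move: E1 E2 F1 F2; rewrite (UQ Kf).
by move: (P f f) (P (U f) (U f)) => [a b] [c d] /= <- -> [->] ->.
Qed.

Lemma level4D f g : level4 f -> level4 g -> level4 (f + g).
Proof. by move=> Kf Kg; rewrite -[f]scale1r; exact: level4_lin. Qed.

Lemma level4_0 : level4 0.
Proof. by split; [move=> M _; exact: sl0|exact: cuspidal0]. Qed.

Lemma level4Z (c : C) f : level4 f -> level4 (c *: f).
Proof. by move=> Kf; rewrite -[c *: f]addr0; apply: level4_lin; [exact: Kf|exact: level4_0]. Qed.

Lemma peterssonDl f f' g : level4 f -> level4 f' -> level4 g -> P (f + f') g = P f g + P f' g.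
Proof.
move=> Kf Kf' Kg; have := petersson_lin 1 Kf Kf' Kg.
by rewrite scale1r mul1r.
Qed.

Lemma petersson0l g : level4 g -> P 0 g = 0.
Proof.
move=> Kg; have := petersson_lin (-1) Kg Kg Kg.
by rewrite scaleN1r addNr mulN1r addNr.
Qed.

Lemma peterssonZl (c : C) f g : level4 f -> level4 g -> P (c *: f) g = c * P f g.
Proof.
move=> Kf Kg; have := petersson_lin c Kf level4_0 Kg.
by rewrite addr0 petersson0l// addr0.
Qed.

Lemma peterssonDr f g g' : level4 f -> level4 g -> level4 g' -> P f (g + g') = P f g + P f g'.
Proof.
move=> Kf Kg Kg'; rewrite (petersson_conj (level4D Kg Kg') Kf) (petersson_conj Kg Kf).
by rewrite (petersson_conj Kg' Kf) peterssonDl// rmorphD.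
Qed.

(** [U] sends f + h to -f + h, so these have equal norms; the difference of the two norms is four
    times the real part of the product. *)
Lemma petersson_Re f h : level4 f -> level4 h -> U f = - f -> U h = h ->
  complex.Re (P f h) = 0.
Proof.
move=> Kf Kh Uf Uh; have Kfh := level4D Kf Kh.
have KN : level4 (- f) by rewrite -scaleN1r; exact: level4Z.
have := petersson_U Kfh; rewrite UD Uf Uh.
rewrite (peterssonDl Kf Kh Kfh) (peterssonDr Kf Kf Kh) (peterssonDr Kh Kf Kh).
have KNh := level4D KN Kh.
rewrite (peterssonDl KN Kh KNh) (peterssonDr KN KN Kh) (peterssonDr Kh KN Kh).
have NP g : level4 g -> P (- f) g = - P f g.
  by move=> Kg; rewrite -scaleN1r (peterssonZl _ Kf Kg) mulN1r.
rewrite (petersson_conj Kf Kh) (petersson_conj KN Kh) (NP _ KN) (NP _ Kh).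
rewrite (petersson_conj KN Kf) (NP _ Kf).
move: (P f f) (P f h) (P h h) => [a b] [c d] [e m] /(congr1 (@complex.Re R)) /=.
lra.
Qed.

(** The imaginary part is the real part of the product for 'i f, up to sign, and 'i f is again an
    eigenvector. *)
Lemma petersson_eigen f h : level4 f -> level4 h -> U f = - f -> U h = h -> P f h = 0.
Proof.
move=> Kf Kh Uf Uh; have R1 := petersson_Re Kf Kh Uf Uh.
have : complex.Re (P ('i *: f) h) = 0.
  apply: petersson_Re; [exact: level4Z|exact: Kh| |exact: Uh].
  by rewrite UZ Uf scalerN.
rewrite (peterssonZl _ Kf Kh); move: (P f h) R1 => [a b] /= -> H.
by apply/eqP; rewrite eq_complex /= eqxx; apply/eqP; lra.
Qed.

(** The hypothesis gives P f (U f) = - P f f, a real number. Expanding the norm of f + U f with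
    [petersson_U] then gives 0, and definiteness concludes. *)
Lemma petersson_proj f : level4 f -> P f (f + U f) = 0 -> f + U f = 0.
Proof.
move=> Kf H; have Ku := U4 Kf; apply: petersson_eq0; first exact: level4D.
rewrite (peterssonDl Kf Ku (level4D Kf Ku)) H add0r (peterssonDr Ku Kf Ku).
rewrite (petersson_U Kf) (petersson_conj Kf Ku).
move: H; rewrite (peterssonDr Kf Kf Ku); have [_] := petersson_self Kf.
move: (P f f) (P f (U f)) => [a b] [c d] /= -> /eqP.
rewrite eq_complex /= => /andP[/eqP h1 /eqP h2].
by apply/eqP; rewrite eq_complex /=; apply/andP; split; apply/eqP; lra.
Qed.

End Polarization.
End Polarized.

(** * Holomorphy of linear combinations and slashes *)

Section Holomorphy.
Variable R : realType.
Local Notation C := R[i].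
Local Notation uhp := (uhp R).
Implicit Types (f g : uhp -> C) (t : uhp) (A : 'M[R]_2).

Lemma holomorphic_lin (c : C) f g : holomorphic f -> holomorphic g -> holomorphic (c *: f + g).
Proof.
move=> hf hg t.
have -> : ext (c *: f + g) = ((fun z => c *: (ext f z : C^o)) + ext g : C^o -> C^o).
  apply/funext => z; rewrite -[RHS]/(c * ext f z + ext g z).
  have [z0|z0] := ltP 0 (complex.Im z); first by rewrite !(ext_mkuhp _ z0).
  by rewrite !ext_out// mulr0 addr0.
by apply: derivableD; [apply: (derivableZ (k := c)); exact: hf|exact: hg].
Qed.

Lemma holomorphic0 : holomorphic (0 : uhp -> C).
Proof.
move=> t; have -> : ext (0 : uhp -> C) = (cst 0 : C^o -> C^o).
  apply/funext => z.
  have [z0|z0] := ltP 0 (complex.Im z); first by rewrite (ext_mkuhp _ z0).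
  by rewrite ext_out.
exact: derivable_cst.
Qed.

Lemma holomorphicD f g : holomorphic f -> holomorphic g -> holomorphic (f + g).
Proof. by move=> hf hg; have := @holomorphic_lin 1 f g hf hg; rewrite scale1r. Qed.

Lemma holomorphicZ (c : C) f : holomorphic f -> holomorphic (c *: f).
Proof. by move=> hf; have := @holomorphic_lin c f 0 hf holomorphic0; rewrite addr0. Qed.

Lemma Im_moebius_le0 A (z : C) : 0 < \det A -> complex.Im z <= 0 ->
  complex.Im (moebius A z) <= 0.
Proof.
rewrite det22 /moebius !realcM; case: z => x y /= dA y0; simpc => /=.
set n := (_ ^+ 2 + _).
have -> : - ((A 0 0 * x + A 0 1) * (A 1 0 * y / n)) + A 0 0 * y * ((A 1 0 * x + A 1 1) / n) =
   (A 0 0 * A 1 1 - A 0 1 * A 1 0) * y / n by ring.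
rewrite mulr_le0_ge0 ?invr_ge0 ?addr_ge0 ?sqr_ge0//.
by rewrite pmulr_rle0.
Qed.

(** Outside the half plane both sides are 0. The identity thus holds on all of C, and the rules for
    derivatives of products and composites apply to functions on C. *)
Lemma ext_pslash k A f (z : C) : 0 < \det A ->
  ext (pslash k A f) z = jfac A z ^- k * ext f (moebius A z).
Proof.
move=> dA; have [z0|z0] := ltP 0 (complex.Im z).
  by rewrite (ext_mkuhp _ z0) /pslash -ext_moebius.
by rewrite !ext_out ?mulr0// Im_moebius_le0.
Qed.

Lemma holomorphic_pslash k A f : 0 < \det A -> holomorphic f -> holomorphic (pslash k A f).
Proof.
move=> dA hf t.
have -> : ext (pslash k A f) =
    ((fun z : C => (jfac A z ^+ k)^-1) : C^o -> C^o) * (ext f \o moebius A : C^o -> C^o).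
  by apply/funext => z; rewrite ext_pslash.
have dlin (a b z : C) : derivable ((fun z : C => a * z + b) : C^o -> C^o) z 1.
  apply: derivableD; last exact: derivable_cst.
  by apply: (derivableZ (k := a)); exact: derivable_id.
have j0 := jfac_neq0 t dA.
apply: derivableM.
  apply: derivableV; first exact: expf_neq0.
  have -> : (fun z : C^o => jfac A z ^+ k) = (jfac A : C^o -> C^o) ^+ k.
    by apply/funext => z; rewrite fctE.
  by apply: derivableX; exact: dlin.
apply/derivable1_diffP.
apply: (@differentiable_comp C C^o C^o C^o (moebius A) (ext f)).
  apply/derivable1_diffP.
  have -> : (moebius A : C^o -> C^o) =
      ((fun z : C => (A 0 0)%:C * z + (A 0 1)%:C) : C^o -> C^o) *
      ((fun z : C => (jfac A z)^-1) : C^o -> C^o) by [].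
  apply: derivableM; first exact: dlin.
  by apply: derivableV; [exact: j0|exact: dlin].
by apply/derivable1_diffP; rewrite -val_act//; exact: hf.
Qed.

End Holomorphy.

(** * The values of the character *)

Section SignCharacter.

Definition od (x : int) := modz x 2 == 1.

Lemma odD (x y : int) : od (x + y) = od x (+) od y.
Proof. by rewrite /od; lia. Qed.

Lemma odN (x : int) : od (- x) = od x.
Proof. by rewrite /od; lia. Qed.

Lemma odM (x y : int) : od (x * y) = od x && od y.
Proof.
have two (n : int) : exists q r, n = q * 2 + r /\ (r = 0 \/ r = 1).
  by exists (divz n 2), (modz n 2); lia.
have [q [r [-> hr]]] := two x; have [q' [r' [-> hr']]] := two y.
by rewrite /od; case: hr => ->; case: hr' => ->; nia.
Qed.

(* The sign of the permutation of the nonzero vectors of [F_2^2] induced by a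
   matrix: the transpositions are the elements of trace 0 other than 1. *)
Definition odd_sign (M : SL2Z) : bool :=
  ~~ (od (val M 0 0) (+) od (val M 1 1)) && (od (val M 0 1) || od (val M 1 0)).

Variables (R : realType) (chi : character R PSL2Z).
Hypotheses (chiS : chi (PSL2Z_proj SL2Z_S) = -1) (chiT : chi (PSL2Z_proj SL2Z_T) = -1).
Local Notation X M := (chi (PSL2Z_proj M)).

Lemma chiM (M N : SL2Z) : X (M * N)%g = X M * X N.
Proof. by rewrite PSL2Z_projM charM. Qed.

Lemma chi1 : X 1%g = 1.
Proof.
have h : X 1%g != 0 by exact: char_neq0.
by apply: (mulfI h); rewrite -chiM mulg1 mulr1.
Qed.

Lemma chiTV : X SL2Z_T^-1%g = -1.
Proof.
have := chi1; rewrite -(mulVg SL2Z_T) chiM chiT mulrN1 => /eqP.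
by rewrite eqr_oppLR => /eqP.
Qed.

(** Induction along words in S and T: left multiplication by S, T or the inverse of T changes the
    parities of the entries explicitly and flips [odd_sign]. *)
Lemma chi_sign (M : SL2Z) : X M = (-1) ^+ odd_sign M.
Proof.
have [s1 s2 s3 s4] := SL2Z_SE; have [t1 t2 t3 t4] := SL2Z_TE.
have [v1 v2 v3 v4] := SL2Z_TVE; have [i1 i2 i3 i4] := SL2Z_1E.
(* The determinant modulo 2, which excludes the singular ones among the sixteen parity patterns. *)
have det (N : SL2Z) : (od (val N 0 0) && od (val N 1 1)) (+) (od (val N 0 1) && od (val N 1 0)).
  by have := congr1 od (SL2Z_det N); rewrite odD odN !odM => ->.
have od1 : od 1 by []. have od0 : od 0 = false by [].
have odN1 : od (-1) by [].
elim/SL2Z_ind: M => [|M IH|M IH|M IH].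
- by rewrite chi1 /odd_sign i1 i2 i3 i4.
- rewrite chiM chiS IH /odd_sign !SL2Z_mulE s1 s2 s3 s4 !odD !odM od0 od1 odN1 /=.
  move: (det M); case: (od _) (od _) (od _) (od _) => [] [] [] [] //= _;
  by rewrite ?expr0 ?expr1 ?mulr1 ?mulrNN ?mulr1.
- rewrite chiM chiT IH /odd_sign !SL2Z_mulE t1 t2 t3 t4 !odD !odM od0 od1 /=.
  move: (det M); case: (od _) (od _) (od _) (od _) => [] [] [] [] //= _;
  by rewrite ?expr0 ?expr1 ?mulr1 ?mulrNN ?mulr1.
- rewrite chiM chiTV IH /odd_sign !SL2Z_mulE v1 v2 v3 v4 !odD !odM od0 od1 odN1 /=.
  move: (det M); case: (od _) (od _) (od _) (od _) => [] [] [] [] //= _;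
  by rewrite ?expr0 ?expr1 ?mulr1 ?mulrNN ?mulr1.
Qed.

End SignCharacter.

(** * Newforms of level 4 *)

Section Newforms.
Variables (R : realType) (k : nat).
Local Notation C := R[i].
Local Notation uhp := (uhp R).
Local Notation sl := (@sl R k).
Local Notation level4 := (@level4 R k).
Local Notation half := (@half R k).
Local Notation P := (petersson 4 k).
Implicit Types (f g h : uhp -> C) (t : uhp) (M N : SL2Z) (A B : 'M[int]_2).

Definition ip A f : uhp -> C := pslash k (map_mx intr A) f.

Lemma det_intr A : 0 < \det A -> 0 < \det (map_mx intr A : 'M[R]_2).
Proof. by move=> dA; rewrite det_map_mx ltr0z. Qed.

(** An identity A M = N B carries a transformation law of [f] under N over to one of f|A under M. *)
Lemma ip_intertwine A B M N f : 0 < \det A -> 0 < \det B ->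
  A *m val M = val N *m B -> sl M (ip A f) = ip B (sl N f).
Proof.
move=> dA dB E; have := congr1 (map_mx (intr : int -> R)) E.
rewrite !map_mxM => {}E; have dM := det_realmx_gt0 R M; have dN := det_realmx_gt0 R N.
have := congr1 (fun B' : 'M[R]_2 => pslash k B' f) E => /=.
by rewrite (pslashM k f (det_intr dA) dM) (pslashM k f dN (det_intr dB)).
Qed.

Lemma ipM A B f : 0 < \det A -> 0 < \det B -> ip B (ip A f) = ip (A *m B) f.
Proof. by move=> dA dB; rewrite /ip map_mxM (pslashM k f (det_intr dA) (det_intr dB)). Qed.

Lemma cusp_formsP (G : set SL2Z) (chi : SL2Z -> C) f : cusp_forms G k chi f <->
  [/\ holomorphic f, forall M, G M -> sl M f = chi M *: f & cuspidal k f].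
Proof.
split=> -[h1 h2 h3]; split; [exact: h1|move=> M /h2|move=> M; have := h3 M
  |exact: h1|move=> M /h2|move=> M; have := h3 M]; by rewrite slashSL.
Qed.

Lemma cusp_forms_lin (G : set SL2Z) (chi : SL2Z -> C) (c : C) f g :
  cusp_forms G k chi f -> cusp_forms G k chi g -> cusp_forms G k chi (c *: f + g).
Proof.
move=> /cusp_formsP[f1 f2 f3] /cusp_formsP[g1 g2 g3]; apply/cusp_formsP; split.
- exact: holomorphic_lin.
- move=> M hM; rewrite sl_lin (f2 M hM) (g2 M hM) scalerDr !scalerA.
  by rewrite [c * _]mulrC.
- exact: cuspidal_lin.
Qed.

Lemma cusp_forms0 (G : set SL2Z) (chi : SL2Z -> C) : cusp_forms G k chi 0.
Proof.
apply/cusp_formsP; split; [exact: holomorphic0| |exact: cuspidal0].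
move=> M _; rewrite sl0 scaler0; exact: erefl.
Qed.

Lemma level4_cusp f : cusp_forms (Gamma0 4) k (fun=> 1) f <-> holomorphic f /\ level4 f.
Proof.
rewrite cusp_formsP; split=> [[h1 h2 h3]|[h1 [h2 h3]]].
  by split; [exact: h1|split; [move=> M /h2; rewrite scale1r|exact: h3]].
by split; [exact: h1|move=> M /h2 ->; rewrite scale1r|exact: h3].
Qed.

(** The bottom row (0, 1) gives a trivial automorphy factor, so without the determinant factor no
    power of [d] appears. *)
Lemma dilateE d f : (0 < d)%N -> dilate d f = ip (mx22 d%:Z 0 0 1) f.
Proof.
move=> d0; apply/funext => t; rewrite /ip.
have -> : map_mx intr (mx22 d%:Z 0 0 1) = mx22 (d%:R : R) 0 0 1 by rewrite map_mx22.
rewrite /pslash jfac_upper rmorph1 expr1n invr1 (mul1r (f _)) -(ext_val f) act_upper ?ltr0n//.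
by rewrite /dilate rmorph0 rmorph1 addr0 divr1 natcE.
Qed.

Lemma dilate_lin d (c : C) f g : dilate d (c *: f + g) = c *: dilate d f + dilate d g.
Proof.
apply/funext => t; rewrite -[RHS]/(c * dilate d f t + dilate d g t) /dilate.
set z := _ * _; have [z0|z0] := ltP 0 (complex.Im z); first by rewrite !(ext_mkuhp _ z0).
by rewrite !ext_out// mulr0 addr0.
Qed.

Lemma dilate_inj f g : dilate 2 f = dilate 2 g -> f = g.
Proof.
move=> E; apply/funext => t.
have s0 : 0 < complex.Im (val t / 2%:R).
  have := uhp_Im t; rewrite natcE realcV mulrC realcM /= => h.
  by rewrite mulr_gt0.
have := congr1 (fun u => u (mkuhp s0)) E; rewrite /dilate /= mulrC divfK ?ext_val//.
Qed.

Lemma half_lin (c : C) f g : half (c *: f + g) = c *: half f + half g.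
Proof. exact: pslash_lin. Qed.

Lemma petersson_linr (c : C) f h h' : level4 f -> level4 h -> level4 h' ->
  P f h = 0 -> P f h' = 0 -> P f (c *: h + h') = 0.
Proof.
move=> Kf Kh Kh' e1 e2; have K := level4_lin c Kh Kh'.
rewrite (petersson_conj K Kf) (petersson_lin c Kh Kh' Kf).
rewrite (petersson_conj Kf Kh) (petersson_conj Kf Kh') e1 e2.
by rewrite rmorph0 mulr0 addr0 rmorph0.
Qed.

Lemma span_ind (S : set (uhp -> C)) (Pr : (uhp -> C) -> Prop) : Pr 0 ->
  (forall c u v, S u -> Pr v -> Pr (c *: u + v)) -> forall h, Defs.span S h -> Pr h.
Proof.
move=> P0 PS _ [n [c [u [Su ->]]]].
elim: n c u Su => [|n IH] c u Su; first by rewrite big_ord0.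
by rewrite big_ord_recl; apply: PS => //; apply: IH.
Qed.

Lemma span_gen (S : set (uhp -> C)) u : S u -> Defs.span S u.
Proof.
by move=> Su; exists 1%N, (fun=> 1), (fun=> u); rewrite big_ord1 scale1r.
Qed.

Lemma Gamma0_dvd (m n : nat) M : (m %| n)%N -> Gamma0 n M -> Gamma0 m M.
Proof. by rewrite /Gamma0 /mkset => mn; apply: dvdz_trans; rewrite dvdzE. Qed.

Section OldGenerators.
Variables (m d : nat) (h : uhp -> C).
Hypotheses (m4 : (m %| 4)%N) (mn4 : m != 4%N) (d4 : (d %| 4 %/ m)%N)
  (Hh : cusp_forms (Gamma0 m) k (fun=> 1) h).

Let m0 : (0 < m)%N. Proof. exact: dvdn_gt0 m4. Qed.

Let dm : (m * d %| 4)%N.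
Proof. by rewrite -(divnK m4) mulnC dvdn_mul. Qed.

Let d0 : (0 < d)%N.
Proof. by have := dvdn_gt0 (isT : (0 < 4)%N) dm; rewrite muln_gt0 => /andP[]. Qed.

Let h_inv M : Gamma0 m M -> sl M h = h.
Proof. by have /cusp_formsP[_ H _] := Hh; move=> /H ->; rewrite scale1r. Qed.

Let det_d : 0 < \det (mx22 d%:Z 0 0 1).
Proof. by rewrite det_mx22 mulr0 subr0 mulr1 ltz_nat. Qed.

(** Conjugation by diag(d, 1) divides the lower left entry by [d]; the quotient is divisible by [m]
    because m d divides 4. *)
Lemma level4_old : level4 (dilate d h).
Proof.
rewrite dilateE//; split; last first.
  by apply: cuspidal_pslash => //; have /cusp_formsP[] := Hh.
move=> M hM.
have [c cE] : exists c : int, val M 1 0 = d%:Z * (m%:Z * c).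
  move: hM; rewrite /Gamma0 /mkset => /dvdzP[q qE]; have /dvdnP[e eE] := dm.
  by exists (q * e%:Z); rewrite qE eE !PoszM; ring.
have det : val M 0 0 * val M 1 1 - (d%:Z * val M 0 1) * (m%:Z * c) = 1.
  by apply: etrans (SL2Z_det M); rewrite cE; ring.
rewrite (@ip_intertwine _ (mx22 d%:Z 0 0 1) M (mkSL det))//.
  rewrite h_inv// /Gamma0 /mkset; have [_ _ -> _] := mkSLE det.
  exact: dvdz_mulr.
have [e1 e2 e3 e4] := mkSLE det; have [f1 f2 f3 f4] := mx22E d%:Z 0 0 1.
rewrite [LHS]mx22_eta [RHS]mx22_eta !mulmx22 e1 e2 e3 e4 f1 f2 f3 f4 cE.
by congr mx22; ring.
Qed.

(** For d = 2 e the shift of t by 1/2 moves d t by the integer [e], a period of [h]. *)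
Lemma old_half : (2 %| d)%N -> half (dilate d h) = dilate d h.
Proof.
move=> /dvdnP[e eE]; rewrite dilateE//.
have det : (1 : int) * 1 - e%:Z * 0 = 1 by ring.
rewrite /half /ip -pslashM ?det_half ?det_intr//.
have -> : map_mx intr (mx22 d%:Z 0 0 1) *m mx22 1 (1/2) 0 1 =
    realmx R (mkSL det) *m map_mx intr (mx22 d%:Z 0 0 1).
  have dE : d%:Z%:~R = e%:Z%:~R * 2 :> R by rewrite eE PoszM rmorphM.
  rewrite (@realmxE R 1 e%:Z 0 1)// !map_mx22 !mul_mx22 dE !rmorph0 !rmorph1.
  by congr mx22; field.
have hN : sl (mkSL det) h = h.
  by apply: h_inv; rewrite /Gamma0 /mkset; have [_ _ -> _] := mkSLE det; rewrite dvdz0.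
rewrite pslashM; [congr (pslash k _ _); exact: hN|exact: det_realmx_gt0|exact: det_intr].
Qed.

(** An odd [d] dividing 4 is 1, and a proper divisor [m] of 4 divides 2, so that [A1] belongs to
    [Gamma0 m]. *)
Lemma old_A1 : ~~ (2 %| d)%N -> sl A1 (dilate d h) = dilate d h.
Proof.
have d1 : ~~ (2 %| d)%N -> d = 1%N.
  move: dm; have : (d <= 4)%N by apply: dvdn_leq => //; apply: dvdn_trans dm; exact: dvdn_mull.
  case: (d) => [|[|[|[|[|]]]]] //= _ /(dvdn_trans (dvdn_mull m (dvdnn 3))).
  by [].
move=> /d1 dE; have m2 : (m %| 2)%N.
  move: m4 mn4; have : (m <= 4)%N by exact: dvdn_leq.
  by case: (m) => [|[|[|[|[|]]]]].
have -> : dilate d h = h.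
  by rewrite dE; apply/funext => t; rewrite /dilate mul1r ext_val.
apply: h_inv; apply: (Gamma0_dvd m2).
by rewrite /Gamma0 /mkset; have [_ _ -> _] := A1E.
Qed.

End OldGenerators.

Lemma halfD f g : half (f + g) = half f + half g.
Proof. by have := half_lin 1 f g; rewrite !scale1r. Qed.

Lemma half0 : half 0 = 0.
Proof. by apply/funext => t; rewrite halfE. Qed.

Lemma halfZ (c : C) f : half (c *: f) = c *: half f.
Proof. by have := half_lin c f 0; rewrite half0 !addr0. Qed.

Lemma oldforms_orthogonal g h : level4 g -> sl A1 g = - g -> half g = - g ->
  oldforms 4 k h -> P g h = 0.
Proof.
move=> Kg gA gB Hold.
(* Membership in [level4] is carried through the induction, since the linearity of the product is
   established for such forms. *)
suff : level4 h /\ P g h = 0 by case.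
move: h Hold; apply: span_ind.
  split; first exact: level4_0.
  by rewrite (petersson_conj (level4_0 R k) Kg) (petersson0l Kg) rmorph0.
move=> c u v Su [Kv Pv]; case: Su => m [d [h' [m4 mn4 d4 Hh uE]]].
have Ku : level4 u by rewrite uE; exact: (level4_old m4 d4 Hh).
split; first exact: level4_lin.
apply: (petersson_linr _ Kg Ku Kv); last exact: Pv.
have [d2|d2] := boolP (2 %| d)%N.
  apply: (petersson_eigen (@level4_half R k) halfD halfZ (@Q_half R k) Kg Ku gB).
  by rewrite uE; exact: (old_half m4 d4 Hh).
apply: (petersson_eigen (@level4_A1 R k) (slD k A1) (slZ k A1) (@Q_A1 R k) Kg Ku gA).
by rewrite uE; exact: (old_A1 m4 mn4 d4 Hh).
Qed.

End Newforms.

(** * Forms with character and newforms of level 4 *)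

Section Isomorphism.
Variables (R : realType) (k : nat) (chi : character R PSL2Z).
Hypotheses (chiS : chi (PSL2Z_proj SL2Z_S) = -1) (chiT : chi (PSL2Z_proj SL2Z_T) = -1).
Local Notation C := R[i].
Local Notation uhp := (uhp R).
Local Notation sl := (@sl R k).
Local Notation level4 := (@level4 R k).
Local Notation half := (@half R k).
Local Notation ip := (@ip R k).
Local Notation P := (petersson 4 k).
Local Notation X M := (chi (PSL2Z_proj M)).
Local Notation V := (cusp_forms [set: SL2Z] k (fun M => X M)).
Implicit Types (f g h : uhp -> C) (t : uhp) (M N : SL2Z).

(** The substitutions 2 t, t / 2 and (t + 1) / 2; the last two add up to the Hecke operator U_2, up
    to normalization. *)
Let D2 : 'M[int]_2 := mx22 2 0 0 1.
Let H0 : 'M[int]_2 := mx22 1 0 0 2.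
Let H1 : 'M[int]_2 := mx22 1 1 0 2.

Let det_D2 : 0 < \det D2. Proof. by rewrite det_mx22. Qed.
Let det_H0 : 0 < \det H0. Proof. by rewrite det_mx22. Qed.
Let det_H1 : 0 < \det H1. Proof. by rewrite det_mx22. Qed.

Lemma ipZ A (c : C) f : ip A (c *: f) = c *: ip A f.
Proof.
apply/funext => t; rewrite -[RHS]/(c * pslash k _ f t) /ip /pslash.
by rewrite -[(c *: f) _]/(c * f _) mulrCA.
Qed.

Lemma ipN A f : ip A (- f) = - ip A f.
Proof. by rewrite -scaleN1r ipZ scaleN1r. Qed.

Lemma ipD A f g : ip A (f + g) = ip A f + ip A g.
Proof. by have := pslash_lin k (map_mx intr A) 1 f g; rewrite !scale1r. Qed.

Lemma holomorphic_ip (A : 'M[int]_2) f :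
  0 < \det A -> holomorphic f -> holomorphic (ip A f).
Proof. by move=> dA hf; exact: (@holomorphic_pslash R k _ f (det_intr R dA) hf). Qed.

Lemma L_subproof : (1 : int) * 1 - 0 * 1 = 1. Proof. by []. Qed.
Definition SL2Z_L : SL2Z := mkSL L_subproof.

Lemma SL2Z_LE : [/\ val SL2Z_L 0 0 = 1, val SL2Z_L 0 1 = 0, val SL2Z_L 1 0 = 1 & val SL2Z_L 1 1 = 1].
Proof. exact: mkSLE. Qed.

Lemma chiL : X SL2Z_L = -1.
Proof.
by rewrite (chi_sign chiS chiT) /odd_sign; have [-> -> -> ->] := SL2Z_LE.
Qed.

Lemma dilate_newform f : V f -> newforms 4 k (dilate 2 f).
Proof.
move=> /cusp_formsP[hf inv cf]; rewrite (dilateE k f (isT : (0 < 2)%N)).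
have K : level4 (ip D2 f).
  split; last exact: cuspidal_pslash.
  move=> M hM; have [a [c [d [aE cE dE]]]] := Gamma0_4_odd hM.
  have det : (2 * a + 1) * (2 * d + 1) - (2 * val M 0 1) * (2 * c) = 1.
    by apply: etrans (SL2Z_det M); rewrite aE cE dE; ring.
  have [e1 e2 e3 e4] := mkSLE det; have [f1 f2 f3 f4] := mx22E (2 : int) 0 0 1.
  rewrite (@ip_intertwine _ _ D2 D2 M (mkSL det))//; last first.
    rewrite [LHS]mx22_eta [RHS]mx22_eta !mulmx22 e1 e2 e3 e4 f1 f2 f3 f4 aE cE dE.
    by congr mx22; ring.
  (* The conjugated matrix is congruent to the identity modulo 2, where the sign is trivial. *)
  rewrite inv// (chi_sign chiS chiT) /odd_sign e1 e2 e3 e4 !odD !odM.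
  by rewrite /= expr0 scale1r.
have hol : holomorphic (ip D2 f) by exact: holomorphic_ip.
split; first by apply/level4_cusp.
move=> h; apply: oldforms_orthogonal => //.
- have [e1 e2 e3 e4] := A1E; have [f1 f2 f3 f4] := mx22E (2 : int) 0 0 1.
  have [l1 l2 l3 l4] := SL2Z_LE.
  rewrite (@ip_intertwine _ _ D2 D2 A1 SL2Z_L)//; last first.
    rewrite [LHS]mx22_eta [RHS]mx22_eta !mulmx22 e1 e2 e3 e4 f1 f2 f3 f4 l1 l2 l3 l4.
    by congr mx22; ring.
  by rewrite inv// chiL scaleN1r ipN.
(* Doubling t + 1/2 gives 2 t + 1, so the half translation of the dilated form is the action of T on
   [f]. *)
- have hT : sl SL2Z_T f = - f by rewrite inv// chiT scaleN1r.
  rewrite /half /ip -pslashM ?det_half ?det_intr//.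
  have -> : map_mx intr D2 *m mx22 1 (1/2) 0 1 = realmx R SL2Z_T *m map_mx intr D2.
    rewrite (@realmxE R 1 1 0 1)// !map_mx22 !mul_mx22 !rmorph0 !rmorph1.
    by have -> : (2 : int)%:~R = 2 :> R by []; congr mx22; field.
  rewrite pslashM; [|exact: det_realmx_gt0|exact: det_intr].
  transitivity (ip D2 (- f)); last exact: ipN.
  by congr (pslash k _ _); exact: hT.
Qed.

Lemma oldforms_level4 h : oldforms 4 k h -> level4 h.
Proof.
move: h; apply: span_ind; first exact: level4_0.
move=> c u v [m [d [h' [m4 mn4 d4 Hh ->]]]] Kv.
by apply: level4_lin; [exact: (level4_old m4 d4 Hh)|exact: Kv].
Qed.

Lemma newforms_submod : submod_closed [in newforms 4 k : set (uhp -> C)].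
Proof.
split.
  rewrite inE; split; first exact: cusp_forms0.
  by move=> h /oldforms_level4 Kh; exact: petersson0l.
move=> c u v /set_mem[hu ou] /set_mem[hv ov]; apply/mem_set.
split; first exact: (cusp_forms_lin c hu hv).
move=> h hh; have Kh := oldforms_level4 hh.
have [_ Ku] := (level4_cusp k u).1 hu; have [_ Kv] := (level4_cusp k v).1 hv.
by rewrite (petersson_lin c Ku Kv Kh) (ou h hh) (ov h hh) mulr0 addr0.
Qed.

Lemma cusp_forms_submod (G : set SL2Z) (eta : SL2Z -> C) :
  submod_closed [in cusp_forms G k eta : set (uhp -> C)].
Proof.
split; first by rewrite inE; exact: cusp_forms0.
by move=> c u v /set_mem hu /set_mem hv; apply/mem_set; exact: (cusp_forms_lin c hu hv).
Qed.

Section Surjectivity.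
Variable g : uhp -> C.
Hypothesis newg : newforms 4 k g.

Let hol_g : holomorphic g.
Proof. by case: newg => /level4_cusp[]. Qed.

Let Kg : level4 g.
Proof. by case: newg => /level4_cusp[]. Qed.

(** Compensates the automorphy factor 2 of [H0], [H1] and the scalar matrix 2. *)
Let c2 : C := 2%:R ^+ k.

Let c2_neq0 : c2 != 0.
Proof. by rewrite /c2 natcE expf_neq0// -[0]/(0%:C) (inj_eq (@complexI R)) pnatr_eq0. Qed.

(** [Gamma0 2] is the union of [Gamma0 4] and its coset of [A1], told apart by the parity of half
    the lower left entry. An element of the second coset exchanges the two summands, as the square
    of [A1] lies in [Gamma0 4]. *)
Let trace_A1 : cusp_forms (Gamma0 2) k (fun=> 1) (g + sl A1 g).
Proof.
have KA := level4_A1 Kg; apply/cusp_formsP; split; last first.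
- by apply: cuspidalD; [exact: Kg.2|exact: KA.2].
- move=> M hM; rewrite scale1r.
  have [a [c [d [aE cE dE]]]] := Gamma0_odd (isT : (2 %| 2)%N) hM.
  have KD := level4D Kg KA.
  have A2 : sl A1 (sl A1 g) = g.
    rewrite -slM Kg.1// /Gamma0 /mkset SL2Z_mulE.
    by have [-> _ -> ->] := A1E.
  have [e1 e2 e3 e4] := A1E; have [v1 v2 v3 v4] := SL2Z_invE A1.
  have [q [cq|cq]] : exists q, c = 2 * q \/ c = 2 * q + 1.
    by exists (divz c 2); lia.
    by apply: KD.1; rewrite /Gamma0 /mkset cE cq; apply/dvdzP; exists q; ring.
  have -> : M = (M * A1^-1 * A1)%g by rewrite mulgVK.
  rewrite (slM k (M * A1^-1)%g A1) KD.1; first by rewrite slD A2 addrC.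
  rewrite /Gamma0 /mkset SL2Z_mulE v1 v3 e3 e4 cE dE cq.
  by apply/dvdzP; exists (q - d); ring.
- apply: (holomorphicD hol_g).
  exact: (@holomorphic_pslash R k _ g (det_realmx_gt0 R A1) hol_g).
Qed.

Lemma newform_A1 : sl A1 g = - g.
Proof.
apply/eqP; rewrite -addr_eq0 addrC; apply/eqP.
apply: (petersson_proj (@level4_A1 R k) (@Q_A1 R k) Kg).
apply: newg.2; apply: span_gen; exists 2%N, 1%N, (g + sl A1 g); split=> //.
by apply/funext => t; rewrite /dilate mul1r ext_val.
Qed.

Let ip_D2 (A : 'M[int]_2) f : 0 < \det A -> ip D2 (ip A f) = ip (A *m D2) f.
Proof. by move=> dA; rewrite ipM. Qed.

(** The function g(t / 2) + g((t + 1) / 2). An element of [Gamma0 2] can be moved to the left of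
    [H0] and [H1], where it becomes an element of [Gamma0 4] fixing [g]; meanwhile it preserves the
    two matrices if its upper right entry is even and swaps them if it is odd. *)
Let trace_half : cusp_forms (Gamma0 2) k (fun=> 1) (c2 *: (ip H0 g + ip H1 g)).
Proof.
apply/cusp_formsP; split; last first.
- apply: cuspidalZ; apply: cuspidalD; apply: cuspidal_pslash => //; exact: Kg.2.
- move=> M hM; rewrite scale1r slZ; congr (_ *: _).
  have [a [c [d [aE cE dE]]]] := Gamma0_odd (isT : (2 %| 2)%N) hM.
  have sw (A B : 'M[int]_2) N : 0 < \det A -> 0 < \det B -> Gamma0 4 N ->
      A *m val M = val N *m B -> sl M (ip A g) = ip B g.
    by move=> dA dB hN E; rewrite (ip_intertwine k g dA dB E) Kg.1.
  have det := SL2Z_det M; rewrite slD.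
  have G4 (x y z w : int) (dt : x * w - y * z = 1) : z = 4 * c -> Gamma0 4 (mkSL dt).
    by move=> zE; rewrite /Gamma0 /mkset; have [_ _ -> _] := mkSLE dt; rewrite zE dvdz_mulr.
  have [f1 f2 f3 f4] := mx22E (1 : int) 0 0 2; have [h1 h2 h3 h4] := mx22E (1 : int) 1 0 2.
  have [b [bE|bE]] : exists b, val M 0 1 = 2 * b \/ val M 0 1 = 2 * b + 1.
  - by exists (divz (val M 0 1) 2); lia.
  - have d0 : (2 * a + 1) * (2 * d + 1) - b * (4 * c) = 1.
      by apply: etrans det; rewrite aE bE cE dE; ring.
    have d1 : (2 * a + 1 + 2 * c) * (2 * d + 1 - 2 * c) - (b + d - a - c) * (4 * c) = 1.
      by apply: etrans det; rewrite aE bE cE dE; ring.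
    rewrite (sw H0 H0 (mkSL d0))//; [|exact: G4|]; last first.
      have [e1 e2 e3 e4] := mkSLE d0; rewrite [LHS]mx22_eta [RHS]mx22_eta !mulmx22.
      by rewrite e1 e2 e3 e4 f1 f2 f3 f4 aE bE cE dE; congr mx22; ring.
    rewrite (sw H1 H1 (mkSL d1))//; [exact: G4|].
    have [e1 e2 e3 e4] := mkSLE d1; rewrite [LHS]mx22_eta [RHS]mx22_eta !mulmx22.
    by rewrite e1 e2 e3 e4 h1 h2 h3 h4 aE bE cE dE; congr mx22; ring.
  - have d0 : (2 * a + 1) * (2 * d + 1 - 2 * c) - (b - a) * (4 * c) = 1.
      by apply: etrans det; rewrite aE bE cE dE; ring.
    have d1 : (2 * a + 1 + 2 * c) * (2 * d + 1) - (b + d + 1) * (4 * c) = 1.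
      by apply: etrans det; rewrite aE bE cE dE; ring.
    rewrite addrC (sw H0 H1 (mkSL d0))//; [|exact: G4|]; last first.
      have [e1 e2 e3 e4] := mkSLE d0; rewrite [LHS]mx22_eta [RHS]mx22_eta !mulmx22.
      by rewrite e1 e2 e3 e4 f1 f2 f3 f4 h1 h2 h3 h4 aE bE cE dE; congr mx22; ring.
    rewrite (sw H1 H0 (mkSL d1))//; [exact: G4|].
    have [e1 e2 e3 e4] := mkSLE d1; rewrite [LHS]mx22_eta [RHS]mx22_eta !mulmx22.
    by rewrite e1 e2 e3 e4 f1 f2 f3 f4 h1 h2 h3 h4 aE bE cE dE; congr mx22; ring.
- exact: (holomorphicZ (holomorphicD (holomorphic_ip det_H0 hol_g)
    (holomorphic_ip det_H1 hol_g))).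
Qed.

Let ip_scalar : c2 *: ip (mx22 2 0 0 2) g = g.
Proof.
apply/funext => t; rewrite -[LHS]/(c2 * pslash k _ g t) map_mx22 rmorph0.
have -> : (2 : int)%:~R = 2 :> R by [].
rewrite /pslash jfac_upper -natcE mulrA divff// mul1r; congr g; apply: val_inj.
rewrite act_upper// rmorph0 addr0 mulrC mulKf// -natcE pnatr_eq0//.
Qed.

Let dilate_trace : dilate 2 (c2 *: (ip H0 g + ip H1 g)) = g + half g.
Proof.
rewrite (dilateE k _ (isT : (0 < 2)%N)) -/D2 ipZ ipD !ip_D2// !mul_mx22 scalerDr.
by congr (_ + _); [rewrite -[RHS]ip_scalar|rewrite half_int].
Qed.

Lemma newform_half : half g = - g.
Proof.
apply/eqP; rewrite -addr_eq0 addrC; apply/eqP.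
apply: (petersson_proj (@level4_half R k) (@Q_half R k) Kg).
apply: newg.2; apply: span_gen.
by exists 2%N, 2%N, (c2 *: (ip H0 g + ip H1 g)); split.
Qed.

(** The function g(t / 2) up to the factor [c2], which does not affect the transformation law. *)
Let F := ip H0 g.

Let FT : sl SL2Z_T F = - F.
Proof.
rewrite /F /sl /ip -pslashM; [|exact: det_intr|exact: det_realmx_gt0].
(* Halving t + 1 gives t / 2 + 1/2, so T acts on [F] as [half] acts on [g]. *)
have -> : map_mx intr H0 *m realmx R SL2Z_T = mx22 1 (1/2) 0 1 *m map_mx intr H0.
  rewrite (@realmxE R 1 1 0 1)// !map_mx22 !mul_mx22 !rmorph0 !rmorph1.
  by have -> : (2 : int)%:~R = 2 :> R by []; congr mx22; field.
rewrite pslashM; [|exact: det_half|exact: det_intr].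
transitivity (ip H0 (- g)); last exact: ipN.
by congr (pslash k _ _); exact: newform_half.
Qed.

Let FL : sl SL2Z_L F = - F.
Proof.
have [e1 e2 e3 e4] := A1E; have [f1 f2 f3 f4] := mx22E (1 : int) 0 0 2.
have [l1 l2 l3 l4] := SL2Z_LE.
rewrite /F (@ip_intertwine _ _ H0 H0 SL2Z_L A1)//; first by rewrite newform_A1 ipN.
rewrite [LHS]mx22_eta [RHS]mx22_eta !mulmx22 e1 e2 e3 e4 f1 f2 f3 f4 l1 l2 l3 l4.
by congr mx22; ring.
Qed.

Let FTV : sl SL2Z_T^-1%g F = - F.
Proof.
have := congr1 (sl SL2Z_T^-1%g) FT; rewrite -slM mulgV sl1 slN => E.
by rewrite [in RHS]E opprK.
Qed.

Let FS : sl SL2Z_S F = - F.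
Proof.
have [s1 s2 s3 s4] := SL2Z_SE; have [l1 l2 l3 l4] := SL2Z_LE.
have [v1 v2 v3 v4] := SL2Z_TVE.
(* S is a word of length three in elements acting as -1, hence acts as -1 itself. *)
have -> : SL2Z_S = (SL2Z_T^-1 * SL2Z_L * SL2Z_T^-1)%g.
  by apply: SL2Z_ext; rewrite !SL2Z_mulE ?s1 ?s2 ?s3 ?s4 ?v1 ?v2 ?v3 ?v4 ?l1 ?l2 ?l3 ?l4.
by rewrite !slM FTV !slN FL !slN FTV !opprK.
Qed.

Let F_inv M : sl M F = X M *: F.
Proof.
elim/SL2Z_ind: M => [|M IH|M IH|M IH].
- by rewrite sl1 chi1 scale1r.
- by rewrite slM FS slN IH chiM chiS mulN1r scaleNr.
- by rewrite slM FT slN IH chiM chiT mulN1r scaleNr.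
- by rewrite slM FTV slN IH chiM (chiTV chiT) mulN1r scaleNr.
Qed.

Lemma newform_dilate : exists2 f, V f & dilate 2 f = g.
Proof.
exists (c2 *: F).
  apply/cusp_formsP; split.
  - exact: (holomorphicZ (holomorphic_ip det_H0 hol_g)).
  - by move=> M _; rewrite slZ F_inv !scalerA mulrC.
  - by apply: cuspidalZ; apply: cuspidal_pslash => //; exact: Kg.2.
by rewrite (dilateE k _ (isT : (0 < 2)%N)) -/D2 ipZ ip_D2// !mul_mx22 -[RHS]ip_scalar.
Qed.

End Surjectivity.
End Isomorphism.

Theorem theorem1p2 (R : realType) (k : nat) (chi : character R PSL2Z) :
  (0 < k)%N -> ~~ odd k ->
  chi (PSL2Z_proj SL2Z_S) = -1 -> chi (PSL2Z_proj SL2Z_T) = -1 ->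
  linear_iso (cusp_forms [set: SL2Z] k (fun M => chi (PSL2Z_proj M)))
             (newforms 4 k) (dilate 2).
Proof.
move=> _ _ chiS chiT; split.
- exact: cusp_forms_submod.
- exact: newforms_submod.
- by move=> c u v _ _; exact: dilate_lin.
- split.
  + by move=> f hf; exact: (dilate_newform chiS chiT).
  + by move=> f g _ _; exact: dilate_inj.
  + by move=> g hg; have [f Vf <-] := newform_dilate chiS chiT hg; exists f.
Qed.
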